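(* For all constants $c,C>0$ and every $\varepsilon\ge0$ there exist constants $c_1>c_2>0$, $c_3>0$ and $M>0$, depending only on $c$, $C$ and $\varepsilon$, such that for every positive integer $S$, every integer $n\ge2$ and every $P=(p_1,\dots,p_S)\in\mathcal{M}_S$ satisfying $$c\ln S\;\le\;\ln n\;\le\;C\ln\Big(e^{-\varepsilon}\sum_{i=1}^S\big(\sqrt{e^\varepsilon p_i}\wedge p_i\sqrt{n\ln n}\big)\Big),$$ the estimator $\widehat d_{\varepsilon,K,c_1,c_2}(P\|Q_n)$ with $K=c_3\ln n$ (rounded down to an integer) satisfies $$\sup_{Q\in\mathcal{M}_S}\mathbb{E}_Q\Big[\big|\widehat d_{\varepsilon,K,c_1,c_2}(P\|Q_n)-d_\varepsilon(P\|Q)\big|^2\Big]\;\le\;M\Big(\sum_{i=1}^S p_i\wedge\sqrt{\frac{e^\varepsilon p_i}{n\ln n}}\Big)^2.$$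
   Context: $\mathcal{M}_S$ is the set of probability distributions on $[S]=\{1,\dots,S\}$; $x\wedge y=\min\{x,y\}$, $x\vee y=\max\{x,y\}$, $[x]^+=\max\{x,0\}$; $d_\varepsilon(P\|Q)=\sum_{i=1}^S[p_i-e^\varepsilon q_i]^+$. Sampling: $P$ is known. Two independent batches are drawn i.i.d. from $Q$, of independent sizes $N_1,N_2\sim\mathrm{Poi}(n)$; $\hat q_{i,j}$ is the number of samples in batch $j\in\{1,2\}$ equal to $i$, divided by $n$. So all $\hat q_{i,j}$ are independent and $n\hat q_{i,j}\sim\mathrm{Poi}(nq_i)$. $\mathbb{E}_Q$ is expectation over these samples. For $c_1\ge c'>0$ and $p\in[0,1]$, define the interval $U(p;c_1,c')=\big[0,\frac{(c_1+c')\ln n}{n}\big]$ if $p\le\frac{c_1e^\varepsilon\ln n}{n}$, and $U(p;c_1,c')=\Big[e^{-\varepsilon}p-\sqrt{\tfrac{c'e^{-\varepsilon}p\ln n}{n}},\,e^{-\varepsilon}p+\sqrt{\tfrac{c'e^{-\varepsilon}p\ln n}{n}}\Big]$ otherwise. $D_K(x;p)$ is the best uniform approximation on the interval $U(p;c_1,c_1)$ of the function $x\mapsto[p-e^\varepsilon x]^+$ by polynomials in $x$ of degree at most $K$. Writing $D_K(x;p)=\sum_{j=0}^K b_jx^j$, set $\tilde D_K(\hat q;p)=\sum_{j=0}^K b_j\prod_{k=0}^{j-1}\big(\hat q-\frac kn\big)$; this is the unique unbiased (minimum variance) estimator of $D_K(q;p)$ based on $n\hat q\sim\mathrm{Poi}(nq)$.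 The estimator: for each $i\in[S]$ let $\delta_i=0$ if $\hat q_{i,1}$ is larger than the right endpoint of $U(p_i;c_1,c_2)$; $\delta_i=\tilde D_K(\hat q_{i,2};p_i)$ if $\hat q_{i,1}\in U(p_i;c_1,c_2)$; and $\delta_i=[p_i-e^\varepsilon\hat q_{i,2}]^+$ if $\hat q_{i,1}$ is smaller than the left endpoint of $U(p_i;c_1,c_2)$. Then $\widehat d_{\varepsilon,K,c_1,c_2}(P\|Q_n)=0\vee\big(1\wedge\sum_{i=1}^S\delta_i\big)$. *)

(* Defs.v *)
From HB Require Import structures.
From mathcomp Require Import all_boot all_order all_algebra.
From mathcomp Require Import all_classical all_reals all_analysis.

Set Implicit Arguments.
Unset Strict Implicit.
Unset Printing Implicit Defensive.

Import Order.TTheory GRing.Theory Num.Theory.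
Import numFieldNormedType.Exports.

Local Open Scope classical_set_scope.
Local Open Scope ring_scope.

(* The alphabet [S] is 'I_S. *)
Record prob_vec (R : realType) (S : nat) := ProbVec {
  prob_vec_fun :> 'I_S -> R;
  prob_vec_ge0 : forall i, 0 <= prob_vec_fun i;
  prob_vec_sum1 : \sum_i prob_vec_fun i = 1 }.

(* The divergence d_eps(P || Q). *)
Definition hockey_stick (R : realType) (S : nat) (eps : R) (P Q : prob_vec R S)
    : R :=
  \sum_i Num.max (P i - expR eps * Q i) 0.

(* A batch of samples is the finite word of its successive samples; batches
   form a countable set, equipped with the discrete sigma-algebra. *)
Definition batch (S : nat) : Type := seq 'I_S.

HB.instance Definition _ (S : nat) := Countable.copy (batch S) (seq 'I_S).
HB.instance Definition _ (S : nat) := isPointed.Build (batch S) [::].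
HB.instance Definition _ (S : nat) := @isMeasurable.Build
  default_measure_display (batch S) discrete_measurable
  discrete_measurable0 discrete_measurableC discrete_measurableU.

(* Probability of observing exactly the word w, when the number of samples has
   law Poi(n) and the samples are i.i.d. from Q, independent of their number.
   The second argument of poisson_prob is a dummy.  The pmf poisson_pmf is not
   used since it is identically 1 (instead of a Dirac mass) for a zero rate. *)
Definition batch_pmf (R : realType) (S n : nat) (Q : prob_vec R S) (w : batch S)
    : \bar R :=
  (poisson_prob n%:R 0 [set size w] * (\prod_(x <- w) Q x)%:E)%E.

Definition batch_law (R : realType) (S n : nat) (Q : prob_vec R S)
    : set (batch S) -> \bar R :=
  fun A => (\esum_(w in A) batch_pmf n Q w)%E.

Lemma batch_pmf_ge0 (R : realType) (S n : nat) (Q : prob_vec R S)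
    (w : batch S) :
  (0 <= batch_pmf n Q w)%E.
Proof.
by rewrite mule_ge0// lee_fin prodr_ge0// => i _; exact: prob_vec_ge0.
Qed.

Lemma batch_law0 (R : realType) (S n : nat) (Q : prob_vec R S) :
  batch_law n Q set0 = 0%E.
Proof. exact: esum_set0. Qed.

Lemma batch_law_ge0 (R : realType) (S n : nat) (Q : prob_vec R S) A :
  (0 <= batch_law n Q A)%E.
Proof. by apply: esum_ge0 => w _; exact: batch_pmf_ge0. Qed.

Lemma batch_law_sigma_additive (R : realType) (S n : nat) (Q : prob_vec R S) :
  semi_sigma_additive (batch_law n Q).
Proof.
move=> F mF tF mUF; rewrite /batch_law.
apply: cvg_toP.
  apply: ereal_nondecreasing_is_cvgn => a b ab.
  by apply: lee_sum_nneg_natr => // m _ _; exact: batch_law_ge0.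
by rewrite nneseries_sum_bigcup// => i; exact: batch_pmf_ge0.
Qed.

HB.instance Definition _ (R : realType) (S n : nat) (Q : prob_vec R S) :=
  isMeasure.Build _ _ _ (batch_law n Q)
    (batch_law0 n Q) (@batch_law_ge0 R S n Q)
    (@batch_law_sigma_additive R S n Q).

Lemma sum_prod_word (R : realType) (S : nat) (Q : prob_vec R S) (k : nat) :
  \sum_(t : k.-tuple 'I_S) \prod_(x <- t) Q x = 1.
Proof.
under eq_bigr do rewrite big_tuple.
rewrite (reindex (fun f : {ffun 'I_k -> 'I_S} => [tuple f i | i < k])) /=.
  under eq_bigr => f _ do under eq_bigr => i _ do rewrite tnth_mktuple.
  rewrite -(bigA_distr_bigA (fun (_ : 'I_k) j => Q j)).
  by rewrite big1// => i _; exact: prob_vec_sum1.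
exists (fun t : k.-tuple 'I_S => [ffun i => tnth t i]).
  by move=> f _; apply/ffunP => i; rewrite ffunE tnth_mktuple.
by move=> t _; apply: eq_from_tnth => i; rewrite tnth_mktuple ffunE.
Qed.

Lemma batch_law_setT (R : realType) (S n : nat) (Q : prob_vec R S) :
  batch_law n Q setT = 1%E.
Proof.
have setT_words : [set: batch S] =
    \bigcup_(k in [set: nat]) [set w : batch S | size w = k].
  by apply/seteqP; split => // w _; exists (size w).
have setT_nat : [set: nat] = \bigcup_(k in [set: nat]) [set k].
  by apply/seteqP; split => // k _; exists k.
rewrite /batch_law setT_words esum_bigcupT; last 2 first.
- apply/trivIsetP => i j _ _ /eqP ij; apply/seteqP.
  by split => // w [/= wi wj]; apply: ij; rewrite -wi.
- by move=> w; exact: batch_pmf_ge0.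
rewrite -(probability_setT (poisson_prob (n%:R : R) 0)).
rewrite [in RHS]setT_nat measure_bigcup//; last first.
  apply/trivIsetP => i j _ _ /eqP ij; apply/seteqP.
  by split => // k [/= ki kj]; apply: ij; rewrite -ki.
rewrite nneseries_esum; last by [].
have -> : [set k | k \in [set: nat]] = [set: nat].
  by apply/seteqP; split => // k _ /=; rewrite inE.
apply: eq_esum => k _.
pose tw (t : k.-tuple 'I_S) : batch S := t.
rewrite (@reindex_esum R _ _ [set: k.-tuple 'I_S] _ tw); last first.
  split => [t _|t t' _ _ /val_inj //|w wk]; first by rewrite /= size_tuple.
  by exists (Tuple (introT eqP wk)).
rewrite esum_fset; [|exact: finite_finset|by move=> t _; exact: batch_pmf_ge0].
under eq_fsbigr => t _ do rewrite /batch_pmf size_tuple.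
have prod_ge0 (t : k.-tuple 'I_S) : (0 <= (\prod_(x <- tw t) Q x)%:E)%E.
  by rewrite lee_fin prodr_ge0// => i _; exact: prob_vec_ge0.
rewrite -ge0_mule_fsumr// fsumEFin; last exact: finite_finset.
rewrite (fsbigE (index_enum (k.-tuple 'I_S))) ?index_enum_uniq//; last first.
  by move=> t _; rewrite mem_index_enum.
rewrite (eq_bigl xpredT) ?sum_prod_word ?mule1//.
by move=> t; exact: in_setT.
Qed.

HB.instance Definition _ (R : realType) (S n : nat) (Q : prob_vec R S) :=
  @Measure_isProbability.Build _ _ R (batch_law n Q) (batch_law_setT n Q).

(* Joint law of the two independent batches; E_Q is 'E_(sampling n Q). *)
Definition sampling (R : realType) (S n : nat) (Q : prob_vec R S) :=
  (batch_law n Q \x batch_law n Q)%E : probability _ R.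

Definition empirical (R : realType) (S n : nat) (w : batch S) (i : 'I_S) : R :=
  (count_mem i w)%:R / n%:R.

Section estimator.
Context {R : realType}.
Implicit Types (eps c p x : R) (n K : nat).

(* Endpoints of U(p; c1, c'); note that the threshold on p involves only c1. *)
Definition U_left eps n c1 c' p : R :=
  if p <= c1 * expR eps * ln n%:R / n%:R then 0
  else expR (- eps) * p - Num.sqrt (c' * expR (- eps) * p * ln n%:R / n%:R).

Definition U_right eps n c1 c' p : R :=
  if p <= c1 * expR eps * ln n%:R / n%:R then (c1 + c') * ln n%:R / n%:R
  else expR (- eps) * p + Num.sqrt (c' * expR (- eps) * p * ln n%:R / n%:R).

Definition U eps n c1 c' p : interval R :=
  `[U_left eps n c1 c' p, U_right eps n c1 c' p].

Definition ramp eps p x : R := Num.max (p - expR eps * x) 0.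

Definition unif_dist (A : set R) (f g : R -> R) : \bar R :=
  ereal_sup [set `|f x - g x|%:E | x in A].

Definition is_best_approx (A : set R) (f : R -> R) K (D : {poly R}) : Prop :=
  (size D <= K.+1)%N /\
  forall r : {poly R}, (size r <= K.+1)%N ->
    (unif_dist A f (horner D) <= unif_dist A f (horner r))%E.

(* D_K(. ; p), as a polynomial; the best approximation exists and is unique on
   a nondegenerate compact interval, so that the choice made here is harmless
   (the default value 0 is a placeholder). *)
Definition best_approx eps n c1 K p : {poly R} :=
  xget 0 [set D | is_best_approx [set` U eps n c1 c1 p] (ramp eps p) K D].

(* The estimator \tilde D_K(x; p): x^j is replaced by the falling product
   x (x - 1/n) ... (x - (j-1)/n). *)
Definition unbiased_approx eps n c1 K p x : R :=
  \sum_(j < K.+1) (best_approx eps n c1 K p)`_j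
    * \prod_(k < j) (x - k%:R / n%:R).

(* delta_i, in terms of p = p_i and of x1, x2 = \hat q_{i,1}, \hat q_{i,2}. *)
Definition local_estimator eps n c1 c2 K p x1 x2 : R :=
  if U_right eps n c1 c2 p < x1 then 0
  else if x1 < U_left eps n c1 c2 p then ramp eps p x2
  else unbiased_approx eps n c1 K p x2.

Definition d_hat (S : nat) eps n c1 c2 K (P : prob_vec R S)
    (w : batch S * batch S) : R :=
  Num.max 0 (Num.min 1 (\sum_i
    local_estimator eps n c1 c2 K (P i)
      (empirical R n w.1 i) (empirical R n w.2 i))).

End estimator.

(* Main.v *)
(**
The two batches reduce the risk to [(sum of |biases|)^2 + 2 sum of second
moments]: Poisson splitting makes the counts independent Poisson variables, so
conditionally on the first batch the errors of distinct symbols are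
uncorrelated, and the same computation applies to the conditional biases.

For one symbol write [E = e^eps], [L = ln n].  Jackson's theorem (positive
trigonometric kernels discretised at Chebyshev nodes) gives approximation error
of order [min p (sqrt (E p / (n L)))] on [U (p; c1, c1)] with degree of order
[L].  A polynomial of degree [K] bounded by [B] on an interval of halfwidth [w]
has Taylor coefficients of order [j] at distance [s w] at most
[B (3 e s)^K / w^j] (Lagrange interpolation); expanding the unbiased estimator
in Charlier polynomials, whose squared norms are explicit, bounds its second
moment by [B^2 e^(8 s K)].  When [q] lies at distance [s w] with [s >= 1] the
first batch selects the polynomial only with probability at most [e^(-16 s L)],
which absorbs this growth; the plug-in and zero branches are controlled by the
same Chernoff bounds.  Summing, the squared bias is of order [T^2] with
[T = sum of min p (sqrt (E p / (n L)))], and the variance of order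
[E L n^(1/C) / n] is at most a constant times [T^2] because the hypothesis says
[n L T^2 >= n^(2/C)].
*)
Require Import Defs.
From mathcomp Require Import all_boot all_order all_algebra.
From mathcomp Require Import all_classical all_reals all_analysis.
From mathcomp Require Import zify ring lra.

Set Implicit Arguments.
Unset Strict Implicit.
Unset Printing Implicit Defensive.

Import Order.TTheory GRing.Theory Num.Theory.
Import numFieldNormedType.Exports.

Local Open Scope classical_set_scope.
Local Open Scope ring_scope.

(** * Jackson approximation of Lipschitz functions *)

(** The polynomial is controlled only on [U] at (c1, c1) while q is arbitrary, so every estimate
    must be uniform in the scaled distance s = |q - m| / w from the centre m, w being the halfwidth.
    This succeeds because both competing exponents are linear in s. A Chernoff exponent for the
    first batch is of order (n s w)^2 / (n q), and q <= 2 s m together with n w^2 = c1 m L makes it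
    of order c1 s L; the moments of the unbiased estimator grow only like e^(8 s K) with K <= L. A
    large constant c1 therefore wins for all s >= 1 at once.

    All tail events contribute p t with t = e^(-4 L) <= 1 / n. Since the p_i add up to 1, their
    total over the alphabet is a multiple of t without any factor S, and the hypothesis implies 1 /
    n <= T. *)

Section trigonometric_kernel.
Context {R : realType}.
Implicit Types (a : nat -> R) (M N : nat) (t x y : R).

(** The squared modulus of the sum of [a k] e^(i k t), expanded so that only cosines occur. *)
Definition trig_kernel a M t : R :=
  \sum_(k < M) \sum_(l < M) a k * a l * cos ((k%:R - l%:R) * t).

(** The even part in [y] of [trig_kernel a M (x - y)]: its terms are products of cosines, hence
    polynomials in cos x. *)
Definition sym_kernel a M x y : R :=
  \sum_(k < M) \sum_(l < M)
    a k * a l * (cos ((k%:R - l%:R) * x) * cos ((k%:R - l%:R) * y)).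

Let csum a M t : R := \sum_(k < M) a k * cos (k%:R * t).
Let ssum a M t : R := \sum_(k < M) a k * sin (k%:R * t).

Lemma trig_kernelE a M t : trig_kernel a M t = csum a M t ^+ 2 + ssum a M t ^+ 2.
Proof.
rewrite !expr2 /csum /ssum !mulr_suml -big_split; apply: eq_bigr => k _ /=.
rewrite !mulr_sumr -big_split; apply: eq_bigr => l _ /=.
by rewrite mulrBl cosB; ring.
Qed.

Lemma trig_kernel_ge0 a M t : 0 <= trig_kernel a M t.
Proof. by rewrite trig_kernelE addr_ge0 ?sqr_ge0. Qed.

Lemma sym_kernelE a M x y :
  sym_kernel a M x y = (trig_kernel a M (x - y) + trig_kernel a M (x + y)) / 2.
Proof.
rewrite /sym_kernel /trig_kernel -big_split /= mulr_suml; apply: eq_bigr => k _.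
rewrite -big_split /= mulr_suml; apply: eq_bigr => l _.
by rewrite mulrBr mulrDr cosB cosD; field.
Qed.

Lemma sym_kernel_ge0 a M x y : 0 <= sym_kernel a M x y.
Proof. by rewrite sym_kernelE divr_ge0 ?addr_ge0 ?trig_kernel_ge0. Qed.

(* With vanishing end coefficients, multiplying the trigonometric polynomial
   of [a] by [expi t - 1] turns its coefficients into differences. *)
Lemma trig_kernel_diff a M t : a 0%N = 0 -> a M = 0 ->
  trig_kernel (fun k => a k.+1 - a k) M t
    = 2 * (1 - cos t) * trig_kernel a M t.
Proof.
move=> a0 aM; rewrite !trig_kernelE.
have shift (f : R -> R) :
    \sum_(k < M) (a k.+1 - a k) * f (k%:R * t)
    = \sum_(k < M) a k * (f (k%:R * t - t) - f (k%:R * t)).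
  transitivity (\sum_(k < M) a k.+1 * f (k%:R * t)
                - \sum_(k < M) a k * f (k%:R * t)).
    by rewrite -sumrB; apply: eq_bigr => k _; rewrite mulrBl.
  under [RHS]eq_bigr do rewrite mulrBr.
  rewrite sumrB; congr (_ - _).
  have -> : \sum_(k < M) a k * f (k%:R * t - t)
      = \sum_(k < M.+1) a k * f (k%:R * t - t).
    by rewrite big_ord_recr /= aM mul0r addr0.
  rewrite big_ord_recl /= a0 mul0r add0r; apply: eq_bigr => k _.
  by rewrite /bump /= add1n -natr1; congr (_ * f _); ring.
have -> : csum (fun k => a k.+1 - a k) M t
    = (cos t - 1) * csum a M t + sin t * ssum a M t.
  rewrite /csum shift !mulr_sumr -big_split; apply: eq_bigr => k _ /=.
  by rewrite cosB; ring.
have -> : ssum (fun k => a k.+1 - a k) M t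
    = (cos t - 1) * ssum a M t - sin t * csum a M t.
  rewrite /ssum shift !mulr_sumr -sumrB; apply: eq_bigr => k _ /=.
  by rewrite sinB; ring.
have -> (c s X Y : R) : ((c - 1) * X + s * Y) ^+ 2 + ((c - 1) * Y - s * X) ^+ 2
   = (c ^+ 2 + s ^+ 2 + 1 - 2 * c) * (X ^+ 2 + Y ^+ 2) by ring.
by rewrite cos2Dsin2; ring.
Qed.

Lemma sqr_cosB x y : (cos x - cos y) ^+ 2 = (1 - cos (x - y)) * (1 - cos (x + y)).
Proof.
have sx : sin x ^+ 2 = 1 - cos x ^+ 2 by rewrite -(cos2Dsin2 x) addrC addKr.
have sy : sin y ^+ 2 = 1 - cos y ^+ 2 by rewrite -(cos2Dsin2 y) addrC addKr.
rewrite cosB cosD.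
transitivity (1 - 2 * cos x * cos y
  + cos x ^+ 2 * cos y ^+ 2 - sin x ^+ 2 * sin y ^+ 2); last by ring.
by rewrite sx sy; ring.
Qed.

(** [sqr_cosB] supplies the factors 1 - cos (x - y) and 1 - cos (x + y). In each half of the kernel
    one of them is absorbed by [trig_kernel_diff] and the other is at most 2. The second moment of
    the kernel about cos x is thus controlled by the differences of [a]. *)
Lemma sqr_cosB_sym_kernel a M x y : a 0%N = 0 -> a M = 0 ->
  (cos x - cos y) ^+ 2 * sym_kernel a M x y
    <= sym_kernel (fun k => a k.+1 - a k) M x y.
Proof.
move=> a0 aM; rewrite !sym_kernelE !trig_kernel_diff// sqr_cosB.
have c1 (z : R) : 0 <= 1 - cos z by rewrite subr_ge0 cos_le1.
have c2 (z : R) : 1 - cos z <= 2 by have := cos_geN1 z; lra.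
have := c1 (x - y); have := c2 (x - y); have := c1 (x + y); have := c2 (x + y).
have := trig_kernel_ge0 a M (x - y); have := trig_kernel_ge0 a M (x + y).
set X := 1 - cos (x - y); set Y := 1 - cos (x + y).
set F := trig_kernel _ _ _; set G := trig_kernel _ _ _.
move=> F0 G0 Y2 Y0 X2 X0.
have : X * Y * G <= X * 2 * G by rewrite ler_wpM2r// ler_wpM2l.
have : X * Y * F <= 2 * Y * F by rewrite ler_wpM2r// ler_wpM2r.
rewrite -/X -/Y; lra.
Qed.

(** * Quadrature at Chebyshev nodes *)

Definition cheb_node N (j : nat) : R := (j%:R *+ 2 + 1) * (pi / (N%:R *+ 2)).

(** Multiplied by sin (k h), with h half the node spacing, the sum telescopes to sin (k pi) / 2 = 0;
    k < 2 N keeps sin (k h) nonzero. *)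
Lemma sum_cos_cheb_node N (k : nat) : (0 < k < N.*2)%N ->
  \sum_(j < N) cos (k%:R * cheb_node N j) = 0.
Proof.
move=> /andP[k0 kN]; set h : R := pi / (N%:R *+ 2).
have N0 : (0 < N)%N by case: N kN {h}.
have h0 : 0 < h.
  by rewrite /h divr_gt0 ?pi_gt0// pmulrn_lgt0// ltr0n.
have kh : 0 < k%:R * h < pi.
  rewrite mulr_gt0 ?ltr0n//=.
  rewrite /h mulrCA gtr_pMr ?pi_gt0// ltr_pdivrMr ?mul1r.
    by rewrite -mulrnA ltr_nat muln2.
  by rewrite pmulrn_lgt0// ltr0n.
have sk := sin_gt0_pi kh.
apply: (mulIf (negbT (gt_eqF sk))); rewrite mul0r mulr_suml.
pose u (j : nat) := sin ((j%:R *+ 2) * (k%:R * h)) / 2.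
transitivity (\sum_(j < N) (u j.+1 - u j)).
  apply: eq_bigr => j _; rewrite /u /cheb_node -/h.
  have -> : (j.+1%:R *+ 2) * (k%:R * h)
     = k%:R * ((j%:R *+ 2 + 1) * h) + k%:R * h by rewrite -natr1; ring.
  have -> : (j%:R *+ 2) * (k%:R * h)
     = k%:R * ((j%:R *+ 2 + 1) * h) - k%:R * h by ring.
  by rewrite sinD sinB; field.
rewrite -(big_mkord predT (fun j => u j.+1 - u j)) telescope_sumr// /u.
have -> : (N%:R *+ 2) * (k%:R * h) = k%:R * pi.
  by rewrite /h; field; rewrite pnatr_eq0 -lt0n.
have -> : sin (k%:R * pi : R) = 0.
  by elim: (k) => [|i IH]; rewrite ?mul0r ?sin0// -natr1 mulrDl mul1r sinDpi IH oppr0.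
by rewrite mulr0n mul0rn !mul0r sin0 mul0r subrr.
Qed.

(** Discrete orthogonality: since |k - l| < M <= 2 N, the off-diagonal frequencies cancel over the
    nodes. The finite sum stands in for an integral over a period. *)
Lemma sum_sym_kernel_cheb a M N x : (0 < M < N.*2.+1)%N ->
  \sum_(j < N) sym_kernel a M x (cheb_node N j) = N%:R * \sum_(k < M) a k ^+ 2.
Proof.
move=> /andP[M0 MN]; rewrite exchange_big mulr_sumr /=; apply: eq_bigr => k _.
rewrite exchange_big /= (bigD1 k)//= [X in _ + X]big1 => [|l lk].
  under eq_bigr do rewrite subrr !mul0r cos0 !mulr1.
  by rewrite sumr_const card_ord addr0 mulr_natl expr2.
rewrite -mulr_sumr -mulr_sumr.
suff -> : \sum_(j < N) cos ((k%:R - l%:R) * cheb_node N j) = 0 by rewrite !mulr0.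
have kl : (k : nat) != l by rewrite eq_sym.
wlog lt_lk : k l lk kl / (l < k)%N.
  move=> wl; have [lk'|kl'|/eqP] := ltngtP l k; last by rewrite eq_sym (negbTE kl).
    by apply: wl.
  transitivity (\sum_(j < N) cos ((l%:R - k%:R) * cheb_node N j)).
    by apply: eq_bigr => j _; rewrite -opprB mulNr cosN.
  by apply: wl => //; rewrite eq_sym.
rewrite -natrB ?(ltnW lt_lk)// sum_cos_cheb_node// subn_gt0 lt_lk /=.
by rewrite (leq_ltn_trans (leq_subr _ _))// (leq_trans (ltn_ord k)).
Qed.

(** Carrying T_k and T_(k+1) together makes the two-step recurrence structural. *)
Fixpoint cheb_pair (k : nat) : {poly R} * {poly R} :=
  if k is k'.+1 then
    let: (P, Q) := cheb_pair k' in (Q, 2%:P * 'X * Q - P)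
  else (1, 'X).

Definition chebyshev (k : nat) : {poly R} := (cheb_pair k).1.

Lemma chebyshevSS k :
  chebyshev k.+2 = 2%:P * 'X * chebyshev k.+1 - chebyshev k.
Proof. by rewrite /chebyshev /=; case: (cheb_pair k). Qed.

Lemma chebyshev_ind (P : nat -> Prop) :
  P 0%N -> P 1%N -> (forall k, P k -> P k.+1 -> P k.+2) -> forall k, P k.
Proof.
move=> P0 P1 PS k; suff: P k /\ P k.+1 by case.
by elim: k => [//|k [Pk Pk1]]; split => //; exact: PS.
Qed.

Lemma horner_chebyshev k t : (chebyshev k).[cos t] = cos (k%:R * t).
Proof.
elim/chebyshev_ind: k => [||k IH0 IH1].
- by rewrite mul0r cos0 hornerC.
- by rewrite mul1r hornerX.
rewrite chebyshevSS !hornerE IH0 IH1.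
have -> : k.+2%:R * t = k.+1%:R * t + t by rewrite -natr1; ring.
have -> : k%:R * t = k.+1%:R * t - t by rewrite -natr1; ring.
by rewrite cosB cosD; ring.
Qed.

Lemma size_chebyshev k : (size (chebyshev k) <= k.+1)%N.
Proof.
elim/chebyshev_ind: k => [||k IH0 IH1].
- by rewrite size_polyC oner_eq0.
- by rewrite size_polyX.
rewrite chebyshevSS; apply: (leq_trans (size_polyD _ _)); rewrite geq_max size_polyN.
rewrite (leq_trans IH0) ?andbT; last by rewrite ltnS ltnW.
apply: (leq_trans (size_polyMleq _ _)).
have s2 : (size (2%:P * 'X : {poly R})%R <= 2)%N.
  by rewrite mul_polyC (leq_trans (size_scale_leq _ _))// size_polyX.
by rewrite -subn1 leq_subLR add1n (leq_trans (leq_add s2 IH1)).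
Qed.

Lemma horner_chebyshev_dist (k l : nat) t :
  (chebyshev `|k - l|%N).[cos t] = cos ((k%:R - l%:R) * t).
Proof.
rewrite horner_chebyshev; wlog kl : k l / (l <= k)%N.
  move=> wl; have [|/ltnW] := leqP l k; first exact: wl.
  by rewrite distnC => /wl ->; rewrite -[in RHS]opprB mulNr cosN.
by rewrite distnEl// natrB.
Qed.

(* Vanishes at [0] and [K + 2], and the sum of its squared differences over the
   sum of its squares is [10 / ((K + 2) ^ 2 + 1)]. *)
Definition jackson_coef K (k : nat) : R := k%:R * (K.+2%:R - k%:R).

Lemma jackson_coef_sqr K :
  \sum_(k < K.+2) jackson_coef K k ^+ 2
    = K.+2%:R * (K.+2%:R ^+ 2 - 1) * (K.+2%:R ^+ 2 + 1) / 30.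
Proof.
(* Freeing [m] from the number of terms is what makes the induction possible. *)
have H (m : R) (n : nat) : \sum_(k < n) (k%:R * (m - k%:R)) ^+ 2
   = m ^+ 2 * ((n%:R - 1) * n%:R * (2 * n%:R - 1) / 6)
     - 2 * m * (n%:R * (n%:R - 1) / 2) ^+ 2
     + (n%:R - 1) * n%:R * (2 * n%:R - 1) * (3 * n%:R ^+ 2 - 3 * n%:R - 1) / 30.
  elim: n => [|n IH]; first by rewrite big_ord0; field.
  by rewrite big_ord_recr /= IH -natr1; field.
by rewrite /jackson_coef H; field.
Qed.

Lemma jackson_coef_diff_sqr K :
  \sum_(k < K.+2) (jackson_coef K k.+1 - jackson_coef K k) ^+ 2
    = K.+2%:R * (K.+2%:R ^+ 2 - 1) / 3.
Proof.
have H (m : R) (n : nat) :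
    \sum_(k < n) (k.+1%:R * (m - k.+1%:R) - k%:R * (m - k%:R)) ^+ 2
    = n%:R * (m - 1) ^+ 2 - 2 * (m - 1) * n%:R * (n%:R - 1)
      + 2 * (n%:R - 1) * n%:R * (2 * n%:R - 1) / 3.
  elim: n => [|n IH]; first by rewrite big_ord0; field.
  by rewrite big_ord_recr /= IH -natr1; field.
by rewrite /jackson_coef H; field.
Qed.

(** The polynomial averages [f] over the nodes with the nonnegative weights [sym_kernel], of total
    [N%:R * A]. The error is at most l times the mean of |cos t - y_j|, whose mean square is at most
    10 h^2 with h = 1 / (K + 1); AM-GM gives (1/2 + 5) l h <= 6 l h. *)
Theorem jackson_lipschitz K (f : R -> R) (l : R) : 0 <= l ->
  (forall x y, -1 <= x <= 1 -> -1 <= y <= 1 -> `|f x - f y| <= l * `|x - y|) ->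
  exists2 P : {poly R}, (size P <= K.+1)%N &
    forall x, -1 <= x <= 1 -> `|f x - P.[x]| <= 6 * l / K.+1%:R.
Proof.
move=> l0 lip; pose a := jackson_coef K; pose N := K.+2.
pose A := \sum_(k < K.+2) a k ^+ 2.
have a0 : a 0%N = 0 by rewrite /a /jackson_coef mul0r.
have aM : a K.+2 = 0 by rewrite /a /jackson_coef subrr mulr0.
have M2 : 2 <= K.+2%:R :> R by rewrite ler_nat.
have A0 : 0 < A by rewrite /A jackson_coef_sqr; nra.
have NA0 : 0 < N%:R * A by rewrite mulr_gt0// ltr0n.
have DA : (\sum_(k < K.+2) (a k.+1 - a k) ^+ 2) * (K.+1%:R ^+ 2) <= 10 * A.
  rewrite /A jackson_coef_sqr jackson_coef_diff_sqr.
  have -> : K.+1%:R = K.+2%:R - 1 :> R by rewrite -[K.+2%:R]natr1 addrK.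
  set m : R := K.+2%:R in M2 *.
  have : 0 <= m * (m ^+ 2 - 1) by nra.
  set u := m * _ => u0.
  have : (m - 1) ^+ 2 <= m ^+ 2 + 1 by nra.
  nra.
(* T_|k - i| replaces cos ((k - i) x). As [a] vanishes at 0, only indices from 1 to K + 1
   contribute, so |k - i| <= K. *)
pose P : {poly R} := (N%:R * A)^-1 *: \sum_(j < N) f (cos (cheb_node N j)) *:
  \sum_(k < K.+2) \sum_(i < K.+2)
    (a k * a i * cos ((k%:R - i%:R) * cheb_node N j)) *: chebyshev `|k - i|%N.
have PE t : P.[cos t] = (N%:R * A)^-1 *
    \sum_(j < N) f (cos (cheb_node N j)) * sym_kernel a K.+2 t (cheb_node N j).
  rewrite hornerZ horner_sum; congr (_ * _); apply: eq_bigr => j _.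
  rewrite hornerZ horner_sum; congr (_ * _); apply: eq_bigr => k _.
  rewrite horner_sum; apply: eq_bigr => i _.
  by rewrite hornerZ horner_chebyshev_dist; ring.
pose h : R := K.+1%:R^-1.
have h0 : 0 < h by rewrite invr_gt0 ltr0n.
have DAh : \sum_(k < K.+2) (a k.+1 - a k) ^+ 2 <= 10 * A * h ^+ 2.
  by rewrite /h exprVn ler_pdivlMr// exprn_gt0// ltr0n.
exists P => [|x x11].
  apply: (leq_trans (size_scale_leq _ _)).
  have szs (I : finType) (F : I -> {poly R}) :
      (forall i, size (F i) <= K.+1)%N -> (size (\sum_i F i)%R <= K.+1)%N.
    by move=> Fi; apply: (leq_trans (size_sum _ _ _)); apply/bigmax_leqP => i _.
  apply: (szs) => j; apply: (leq_trans (size_scale_leq _ _)).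
  apply: (szs) => k; apply: (szs) => i.
  have [->|k0] := eqVneq (k : nat) 0%N.
    by rewrite a0 !mul0r scale0r size_poly0.
  have [->|i0] := eqVneq (i : nat) 0%N.
    by rewrite a0 mulr0 !mul0r scale0r size_poly0.
  apply: (leq_trans (size_scale_leq _ _)); apply: (leq_trans (size_chebyshev _)).
  rewrite ltnS; have := ltn_ord k; have := ltn_ord i.
  have [ik|ki] := leqP i k; [rewrite distnEl//|rewrite distnEr ?(ltnW ki)//];
    by move: k0 i0; rewrite -!lt0n; lia.
have xE : cos (acos x) = x by rewrite acosK// in_itv.
rewrite -xE PE; set t := acos x; pose y j := cos (cheb_node N j).
pose W j := sym_kernel a K.+2 t (cheb_node N j).
have W0 j : 0 <= W j by exact: sym_kernel_ge0.
have sumW : \sum_(j < N) W j = N%:R * A.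
  by rewrite /W sum_sym_kernel_cheb// /N /=; lia.
have sumWd : \sum_(j < N) (cos t - y j) ^+ 2 * W j <= N%:R * (10 * A * h ^+ 2).
  apply: (le_trans (ler_sum _ (fun (j : 'I_N) _ =>
    sqr_cosB_sym_kernel t (cheb_node N j) a0 aM))).
  rewrite sum_sym_kernel_cheb; first by rewrite ler_pM2l ?ltr0n.
  by rewrite /N; lia.
have -> : f (cos t) - (N%:R * A)^-1 * \sum_(j < N) f (y j) * W j
    = (N%:R * A)^-1 * \sum_(j < N) (f (cos t) - f (y j)) * W j.
  under [in RHS]eq_bigr do rewrite mulrBl.
  by rewrite sumrB -mulr_sumr sumW; field; rewrite pnatr_eq0 andbT gt_eqF.
rewrite normrM (ger0_norm (ltW _)) ?invr_gt0// [leLHS]mulrC ler_pdivrMr//.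
apply: (le_trans (ler_norm_sum _ _ _)).
apply: (@le_trans _ _ (\sum_(j < N)
    (l * h / 2 * W j + l / h / 2 * ((cos t - y j) ^+ 2 * W j)))).
  apply: ler_sum => j _; rewrite normrM (ger0_norm (W0 j)) mulrA -mulrDl.
  rewrite ler_wpM2r//; apply: le_trans (lip _ _ _ _) _.
  - by rewrite cos_geN1 cos_le1.
  - by rewrite cos_geN1 cos_le1.
  (* AM-GM: [|d| <= h / 2 + d ^ 2 / (2 h)] *)
  have -> : l * h / 2 + l / h / 2 * (cos t - y j) ^+ 2
      = l * ((h ^+ 2 + (cos t - y j) ^+ 2) / (2 * h)).
    by field; rewrite gt_eqF.
  rewrite ler_wpM2l// ler_pdivlMr ?mulr_gt0//.
  rewrite -(@real_normK _ (cos t - y j)) ?num_real//; set z := `|_|.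
  by have := sqr_ge0 (h - z); nra.
rewrite big_split /= -!mulr_sumr sumW.
have lh0 : 0 <= l / h / 2 by rewrite !divr_ge0// ltW.
have := ler_wpM2l lh0 sumWd.
have -> : l / h / 2 * (N%:R * (10 * A * h ^+ 2)) = 5 * l * h * (N%:R * A).
  by field; rewrite gt_eqF.
set Z := _ * \sum_(_ < _) _.
have : 0 <= l * h * (N%:R * A) by rewrite !mulr_ge0// ltW.
have -> : l * h / 2 * (N%:R * A) = (l * h * (N%:R * A)) / 2 by field.
have -> : 6 * l / K.+1%:R * (N%:R * A) = 6 * (l * h * (N%:R * A)) by rewrite /h; ring.
have -> : 5 * l * h * (N%:R * A) = 5 * (l * h * (N%:R * A)) by ring.
lra.
Qed.

End trigonometric_kernel.

(** * Coefficients of polynomials bounded on an interval *)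

(** The Lagrange denominator at the node i among 0, ..., n, up to sign. *)
Lemma prod_dist_fact (n i : nat) : (i <= n)%N ->
  (\prod_(j < n.+1 | (j : nat) != i) `|i - j|)%N = (i`! * (n - i)`!)%N.
Proof.
have rev_fact m : (\prod_(j < m) (m - j))%N = m`!.
  rewrite fact_prod big_add1 big_mkord (reindex_inj rev_ord_inj).
  by apply: eq_bigr => j _ /=; have := ltn_ord j; lia.
elim: n i => [|n IH] i; rewrite leq_eqVlt => /predU1P[->|lt_in] //.
- by rewrite big_mkcond big_ord_recr big_ord0.
- rewrite big_mkcond big_ord_recr eqxx /= muln1 subnn muln1 -rev_fact.
  apply: eq_bigr => j _; have := ltn_ord j.
  by case: eqVneq => [|_]; [lia|rewrite /= => jn; rewrite distnEl// ltnW].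
- rewrite big_mkcond big_ord_recr -big_mkcond /= IH// gtn_eqF//.
  by rewrite distnEr 1?ltnW// subSn// factS -mulnA [(_ * _.+1)%N]mulnC.
Qed.

Section lagrange_coef_bound.
Context {R : realType}.

(** The coefficients are dominated by those of a power of X + Z, which add up to the same power of 1
    + Z. *)
Lemma coef_prod_XsubC_le (I : Type) (r : seq I) (Pr : pred I) (x : I -> R) (Z : R)
    (k : nat) : 0 <= Z -> (forall i, `|x i| <= Z) ->
  `|(\prod_(i <- r | Pr i) ('X - (x i)%:P))`_k| <= (1 + Z) ^+ (count Pr r).
Proof.
move=> Z0 xZ; elim: r k => [|i r IH] k.
  by rewrite big_nil expr0 coefC; case: ifP; rewrite ?normr1 ?normr0.
rewrite big_cons /=; case: ifP => // _; rewrite add1n exprS.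
rewrite mulrBl coefB coefXM coefCM (le_trans (ler_normB _ _))// mulrDl mul1r.
have IH0 := le_trans (normr_ge0 _) (IH 0%N).
apply: lerD; first by case: ifP; rewrite ?normr0.
by rewrite normrM ler_pM.
Qed.

Lemma natX_le_expR_fact (k : nat) : k%:R ^+ k <= expR k%:R * k`!%:R :> R.
Proof.
case: k => [|k]; first by rewrite expR0 mulr1.
rewrite -ler_pdivrMr ?ltr0n ?fact_gt0//.
by apply: le_trans (expR_ge1Dxn k _); rewrite ?lerDr// ler0n.
Qed.

(** Interpolate at K + 1 equally spaced points of [a, a + 2]. All nodes have modulus at most s + 1,
    so the i-th basis polynomial has coefficients at most (s + 2)^K (K / 2)^K / (i! (K - i)!).
    Summing over i gives (s + 2)^K K^K / K!; then K^K / K! <= e^K and s + 2 <= 3 s. *)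
Lemma coef_le_of_bounded (K k : nat) (P : {poly R}) (a s B : R) :
  1 <= s -> (size P <= K.+1)%N -> - (s + 1) <= a -> a + 2 <= s + 1 ->
  (forall x, a <= x <= a + 2 -> `|P.[x]| <= B) ->
  `|P`_k| <= B * (3 * expR 1 * s) ^+ K.
Proof.
move=> s1 szP ha1 ha2 PB.
have [K0|K0] := posnP K.
  subst K; have [c cP] : {c | P = c%:P} by exists P`_0; exact: size1_polyC.
  rewrite cP coefC expr0 mulr1.
  have := PB a; rewrite cP hornerC => /(_ _) cB.
  have cB' : `|c| <= B by apply: cB; rewrite lexx/= lerDl.
  by case: ifP => // _; rewrite normr0 (le_trans _ cB').
pose x (j : nat) := a + 2 / K%:R * j%:R.
have K0' : 0 < K%:R :> R by rewrite ltr0n.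
have K20 : 0 < 2 / K%:R :> R by rewrite divr_gt0.
have xinj : injective x.
  by move=> i j /addrI /(mulfI (negbT (gt_eqF K20))) /eqP; rewrite eqr_nat => /eqP.
have xab (i : 'I_K.+1) : a <= x i <= a + 2.
  rewrite lerDl mulr_ge0 ?(ltW K20)//= lerD2l -mulrA ler_piMr//.
  by rewrite mulrC ler_pdivrMr// mul1r ler_nat -ltnS.
rewrite (lagrange_gen (ltn0Sn K) xinj szP) coef_sum.
apply: (le_trans (ler_norm_sum _ _ _)).
have term (i : 'I_K.+1) : `|((P.[x i])%:P * (tnth (lagrange K.+1 x) i : {poly R}))`_k|
   <= B * (s + 2) ^+ K * (K%:R / 2) ^+ K / (i`!%:R * (K - i)`!%:R).
  rewrite (lagrangeE (ltn0Sn K) xinj) !coefCM normrM -!mulrA.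
  rewrite ler_pM ?PB// normrM mulrC ler_pM//.
    have -> : s + 2 = 1 + (s + 1) by ring.
    have cK : count (fun j : 'I_K.+1 => j != i) (index_enum 'I_K.+1) = K.
      by rewrite -sum1_count sum1_card cardC1 card_ord.
    rewrite -[X in _ <= _ ^+ X]cK.
    pose y (j : nat) := if (j <= K)%N then x j else 0.
    have yZ (j : 'I_K.+1) : `|y j| <= s + 1.
      rewrite /y -ltnS ltn_ord ler_norml.
      by have := xab j; lra.
    have -> : \prod_(j < K.+1 | j != i) ('X - (x j)%:P)
      = \prod_(j < K.+1 | j != i) ('X - (y j)%:P).
      by apply: eq_bigr => j _; rewrite /y -ltnS ltn_ord.
    by apply: coef_prod_XsubC_le => //; lra.
  rewrite normfV horner_prod normr_prod.
  have -> : \prod_(j < K.+1 | j != i) `|('X - (x j)%:P).[x i]|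
    = (2 / K%:R) ^+ K * (i`! * (K - i)`!)%N%:R.
    have iK : (i <= K)%N by rewrite -ltnS.
    rewrite -(prod_dist_fact iK) natr_prod.
    transitivity (\prod_(j < K.+1 | j != i) (2 / K%:R * `|i%:R - j%:R : R|)).
      apply: eq_bigr => j _.
      rewrite hornerXsubC /x opprD addrACA subrr add0r -mulrBr normrM.
      by rewrite (gtr0_norm K20).
    rewrite big_split prodr_const /= cardC1 card_ord; congr (_ * _).
    apply: eq_bigr => j _.
    have [ij|/ltnW ij] := leqP j i; [rewrite distnEl// natrB// ger0_norm//|
      rewrite distnEr// natrB// ler0_norm ?opprB//];
      by rewrite ?subr_ge0 ?subr_le0 ler_nat.
  by rewrite invfM natrM -exprVn invf_div.
apply: (le_trans (ler_sum _ (fun i _ => term i))).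
rewrite -mulr_sumr.
have -> : \sum_(i < K.+1) (i`!%:R * (K - i)`!%:R)^-1 = 2 ^+ K / K`!%:R :> R.
  have -> : (2 : R) ^+ K = \sum_(i < K.+1) ('C(K, i))%:R.
    by rewrite -[2]/(1 + 1) exprDn; apply: eq_bigr => i _; rewrite !expr1n mulr1.
  rewrite mulr_suml; apply: eq_bigr => i _.
  have iK : (i <= K)%N by rewrite -ltnS.
  have f0 (m : nat) : m`!%:R != 0 :> R by rewrite pnatr_eq0 -lt0n fact_gt0.
  by rewrite -(bin_fact iK) !natrM; field; rewrite !f0 pnatr_eq0 -lt0n bin_gt0 iK.
have B0 : 0 <= B.
  by apply: le_trans (normr_ge0 P.[a]) (PB _ _); rewrite lexx/= lerDl.
have -> : B * (s + 2) ^+ K * (K%:R / 2) ^+ K * (2 ^+ K / K`!%:R)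
  = B * ((s + 2) ^+ K * (K%:R ^+ K / K`!%:R)).
  rewrite -!mulrA; congr (_ * (_ * _)).
  by rewrite mulrA -exprMn divfK.
have -> : 3 * expR 1 * s = (3 * s) * expR 1 :> R by ring.
rewrite ler_wpM2l// exprMn ler_pM// ?exprn_ge0 ?divr_ge0//; first by lra.
  by rewrite lerXn2r ?nnegrE//; lra.
by rewrite ler_pdivrMr ?ltr0n ?fact_gt0// -expRM_natl mulr1 natX_le_expR_fact.
Qed.
End lagrange_coef_bound.

(** * Existence of best uniform approximations *)

Section best_approximation.
Context {R : realType}.

Lemma coef_comp_scaleX (P : {poly R}) (c : R) (k : nat) :
  (P \Po (c *: 'X))`_k = P`_k * c ^+ k.
Proof.
rewrite coef_comp_poly; have [kP|Pk] := ltnP k (size P).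
  rewrite (bigD1 (Ordinal kP))//= big1 ?addr0 => [|i ik].
    by rewrite exprZn coefZ coefXn eqxx mulr1.
  rewrite exprZn coefZ coefXn -(inj_eq val_inj) /= eq_sym in ik *.
  by rewrite (negbTE ik) !mulr0.
rewrite nth_default// mul0r big1// => i _.
by rewrite exprZn coefZ coefXn (gtn_eqF (leq_trans (ltn_ord i) Pk)) !mulr0.
Qed.

(** This is [coef_le_of_bounded] in the variable (x - q) / w, in which the interval has length 2 and
    its centre lies within s of 0. *)
Lemma shifted_coef_le (K k : nat) (P : {poly R}) (m w q s B : R) :
  0 < w -> 1 <= s -> `|q - m| <= s * w -> (size P <= K.+1)%N ->
  (forall x, m - w <= x <= m + w -> `|P.[x]| <= B) ->
  `|(P \Po ('X + q%:P))`_k| * w ^+ k <= B * (3 * expR 1 * s) ^+ K.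
Proof.
move=> w0 s1 qm szP PB.
pose r := (m - q) / w.
have rs : - s <= r <= s.
  by rewrite -ler_norml /r normrM normfV (gtr0_norm w0) ler_pdivrMr// distrC.
have Q (x : R) : ((P \Po ('X + q%:P)) \Po (w *: 'X)).[x] = P.[w * x + q].
  by rewrite !horner_comp !hornerE.
rewrite -(ger0_norm (exprn_ge0 k (ltW w0))) -normrM -coef_comp_scaleX.
apply: (@coef_le_of_bounded _ K k _ (r - 1) s B) => //; [|lra|lra|].
- rewrite size_comp_poly2; first by rewrite size_comp_poly2// size_XaddC.
  by rewrite size_scale ?size_polyX// gt_eqF.
- move=> x xr; rewrite Q; apply: PB.
  have wr : w * r = m - q by rewrite /r mulrC divfK// gt_eqF.
  have : w * (r - 1) <= w * x by rewrite ler_pM2l//; lra.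
  have : w * x <= w * (r - 1 + 2) by rewrite ler_pM2l//; lra.
  by rewrite mulrDr mulrBr wr; lra.
Qed.

Lemma normr_coord_le n (v : 'rV[R]_n) (i : 'I_n) : `|v 0 i| <= `|v|.
Proof.
by rewrite -[leRHS]/(mx_norm v) mx_normrE; apply/bigmax_geP; right => /=; exists (0, i).
Qed.

Lemma rVpoly_le K (a b x : R) (v : 'rV[R]_K) : a <= x <= b ->
  `|(rVpoly v).[x]| <= `|v| * \sum_(i < K) (`|a| + `|b|) ^+ i.
Proof.
move=> axb; rewrite /rVpoly horner_poly mulr_sumr.
apply: le_trans (ler_norm_sum _ _ _) _; apply: ler_sum => i _.
rewrite normrM ler_pM//; first by case: insubP => [j _ _|_] /=; rewrite ?normr_coord_le ?normr0.
rewrite normrX lerXn2r ?nnegrE ?addr_ge0// ler_norml.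
have := ler_norm a; have := ler_norm b; have := ler_norm (-a); have := ler_norm (-b).
by rewrite !normrN; have := normr_ge0 a; have := normr_ge0 b; lra.
Qed.

(** The sup distance is Lipschitz in the coefficient vector. Its sublevel set at c contains 0 and is
    compact: its polynomials are bounded by 2 c on the interval, hence have bounded coefficients by
    [shifted_coef_le] at 0. A minimiser on this set is a global one. *)
Lemma best_approx_exists K (f : R -> R) (a b c : R) : a < b ->
  (forall x, a <= x <= b -> `|f x| <= c) ->
  exists D, is_best_approx [set` `[a, b]] f K D.
Proof.
move=> ab fc; pose I := [set` `[a, b]] : set R.
pose E (v : 'rV[R]_K.+1) := [set `|f x - (rVpoly v).[x]| | x in I].
pose F v := sup (E v); pose G := \sum_(i < K.+1) (`|a| + `|b|) ^+ i.
have inI x : I x = (a <= x <= b) :> Prop by rewrite /I /= in_itv.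
have Ia : I a by rewrite inI lexx ltW.
have E0 v : E v !=set0 by exists `|f a - (rVpoly v).[a]|, a.
have Eub v : has_ubound (E v).
  exists (c + `|v| * G) => _ [x + <-]; rewrite inI => xI.
  by rewrite (le_trans (ler_normB _ _))// lerD ?fc ?rVpoly_le.
have FE v x : I x -> `|f x - (rVpoly v).[x]| <= F v.
  by move=> Ix; apply: ub_le_sup => //; exists x.
have Fle v r : (forall x, I x -> `|f x - (rVpoly v).[x]| <= r) -> F v <= r.
  by move=> vr; apply: ge_sup => // _ [x Ix <-]; exact: vr.
have c0 : 0 <= c by apply: le_trans (fc a _) => //; rewrite lexx ltW.
have Flip v v' : F v <= F v' + `|v - v'| * G.
  apply: Fle => x Ix; rewrite -[f x](subrK (rVpoly v').[x]) -addrA.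
  rewrite (le_trans (ler_normD _ _))// lerD ?FE//.
  by rewrite distrC -hornerN -hornerD -raddfB; apply: rVpoly_le; rewrite -inI.
pose A := [set v | F v <= c].
have FA0 : F 0 <= c.
  by apply: Fle => x; rewrite inI raddf0 horner0 subr0; exact: fc.
have Fcont : continuous F.
  move=> v; apply/(@cvgrPdist_le _ _ _ _ (nbhs_filter v)) => e e0.
  have G0 : 0 <= G by apply: sumr_ge0 => i _; rewrite exprn_ge0// addr_ge0.
  have eG : 0 < e / (G + 1) by rewrite divr_gt0// ltr_wpDl.
  apply: (@filterS _ (nbhs v) (nbhs_filter v) _ _ _ (nbhsx_ballx v _ eG)) => t.
  rewrite -ball_normE /= => /ltW vt.
  have vtG : `|v - t| * G <= e.
    apply: le_trans (ler_wpM2r G0 vt) _.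
    by rewrite mulrAC ler_pdivrMr ?ltr_wpDl// ler_pM2l// lerDl.
  have := Flip v t; have := Flip t v; rewrite [`|t - v|]distrC => h1 h2.
  by rewrite ler_norml; lra.
have cA : compact A.
  apply: bounded_closed_compact.
    pose w := (b - a) / 2; pose s0 := 1 + `|(a + b) / 2| / w.
    have w0 : 0 < w by rewrite /w divr_gt0// subr_gt0.
    have s01 : 1 <= s0 by rewrite /s0 lerDl divr_ge0// ltW.
    pose Z := \sum_(i < K.+1) 2 * c * (3 * expR 1 * s0) ^+ K / w ^+ i.
    have Z0 (i : 'I_K.+1) : 0 <= 2 * c * (3 * expR 1 * s0) ^+ K / w ^+ i.
      by rewrite !mulr_ge0// ?exprn_ge0 ?invr_ge0 ?mulr_ge0 ?exprn_ge0 ?expR_ge0//; lra.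
    exists Z; split => [|z Zz v Fv]; first by rewrite num_real.
    change (mx_norm v <= z); rewrite mx_normrE; apply/bigmax_leP; split => /=.
      by rewrite (le_trans _ (ltW Zz))// sumr_ge0.
    move=> [i0 i] _ /=; rewrite (ord1 i0) (le_trans _ (ltW Zz))//.
    rewrite /Z (bigD1 i)//= ler_wpDr ?sumr_ge0// ler_pdivlMr ?exprn_gt0//.
    have := @shifted_coef_le K i (rVpoly v) ((a + b) / 2) w 0 s0 (2 * c) w0 s01.
    rewrite addr0 comp_polyXr coef_rVpoly_ord; apply; [|exact: size_poly|].
      by rewrite sub0r normrN /s0 [leRHS]mulrDl mul1r divfK ?gt_eqF// lerDr ltW.
    move=> x; rewrite /w => xab; have Ix : I x by rewrite inI; lra.
    rewrite -[_.[x]](subKr (f x)) (le_trans (ler_normB _ _))//.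
    rewrite mulr2n mulrDl mul1r lerD ?fc -?inI//.
    exact: le_trans (FE v x Ix) Fv.
  have -> : A = F @^-1` [set x | x <= c] by [].
  by apply: preimage_closed => //; exact: closed_le.
have [v Av Fmin] : exists2 v, v \in A & forall t, t \in A -> F v <= F t.
  apply: EVT_min_rV => //; first by exists 0.
  exact: continuous_subspaceT.
have FminT t : F v <= F t.
  have [tA|] := leP (F t) c; first by apply: Fmin; rewrite inE.
  by move=> /ltW; apply: le_trans; rewrite inE in Av.
exists (rVpoly v); split => [|P szP]; first exact: size_poly.
have -> : P = rVpoly (poly_rV P : 'rV_K.+1) by rewrite poly_rV_K.
have unifE t : unif_dist I f (horner (rVpoly t)) = (F t)%:E.
  rewrite /unif_dist /F -ereal_sup_EFin//; congr ereal_sup.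
  by rewrite image_comp.
by rewrite !unifE lee_fin.
Qed.
End best_approximation.

(** * Best approximation of the ramp *)

Section ramp_approximation.
Context {R : realType}.
Implicit Types (eps c p x : R) (n K : nat).

Lemma expRNE eps x : expR (- eps) * x = x / expR eps.
Proof. by rewrite expRN mulrC. Qed.

Lemma ramp_ge0 eps p x : 0 <= ramp eps p x.
Proof. by rewrite /ramp le_max lexx orbT. Qed.

Lemma ramp_le eps p x : 0 <= p -> 0 <= x -> ramp eps p x <= p.
Proof.
by move=> p0 x0; rewrite /ramp ge_max p0 andbT gerBl mulr_ge0 ?expR_ge0.
Qed.

Lemma ramp_lipschitz eps p x y :
  `|ramp eps p x - ramp eps p y| <= expR eps * `|x - y|.
Proof.
have max_lip (a b : R) : `|Num.max a 0 - Num.max b 0| <= `|a - b|.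
  have [] := leP a 0; have [] := leP b 0 => hb ha.
  - by rewrite subrr normr0.
  - by rewrite sub0r normrN gtr0_norm// ltr0_norm; lra.
  - by rewrite subr0 gtr0_norm// gtr0_norm; lra.
  - by [].
apply: le_trans (max_lip _ _) _.
have -> : p - expR eps * x - (p - expR eps * y) = expR eps * (y - x) by ring.
by rewrite normrM ger0_norm ?expR_ge0// distrC.
Qed.

(* The threshold in [U] makes both of its cases the interval of center
   [m = max (p / e^eps) (c ln n / n)] and halfwidth [sqrt (c m ln n / n)]. *)
Definition center eps n c p : R := Num.max (p / expR eps) (c * ln n%:R / n%:R).

Definition halfwidth eps n c p : R :=
  Num.sqrt (c * center eps n c p * ln n%:R / n%:R).

Section fixed_parameters.
Variables (eps c p : R) (n : nat).
Hypotheses (c_gt0 : 0 < c) (p_ge0 : 0 <= p) (n_ge2 : (2 <= n)%N).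

Local Notation E := (expR eps).
Local Notation L := (ln (n%:R : R)).
Local Notation m := (center eps n c p).
Local Notation w := (halfwidth eps n c p).
Local Notation small := (p <= c * expR eps * ln n%:R / n%:R).

Lemma ln_nat_gt0 : 0 < L.
Proof. by rewrite ln_gt0// ltr1n. Qed.

Lemma nat_gt0 : 0 < n%:R :> R.
Proof. by rewrite ltr0n (leq_trans _ n_ge2). Qed.

Lemma base_gt0 : 0 < c * L / n%:R.
Proof. by rewrite divr_gt0 ?mulr_gt0 ?ln_nat_gt0 ?nat_gt0. Qed.

Lemma smallE : small = (p / E <= c * L / n%:R).
Proof.
rewrite ler_pdivrMr ?expR_gt0//; congr (_ <= _).
by rewrite -!mulrA; congr (_ * _); rewrite mulrC -!mulrA.
Qed.

Lemma center_small : small -> m = c * L / n%:R.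
Proof. by rewrite smallE => h; rewrite /center max_r. Qed.

Lemma center_large : ~~ small -> m = p / E.
Proof. by rewrite smallE -ltNge => /ltW h; rewrite /center max_l. Qed.

Lemma center_ge : c * L / n%:R <= m.
Proof. by rewrite /center le_max lexx orbT. Qed.

Lemma center_ge_kink : p / E <= m.
Proof. by rewrite /center le_max lexx. Qed.

Lemma center_gt0 : 0 < m.
Proof. exact: lt_le_trans base_gt0 center_ge. Qed.

Lemma sqr_halfwidth : w ^+ 2 = m * (c * L / n%:R).
Proof.
rewrite sqr_sqrtr; first by ring.
by rewrite divr_ge0 ?ler0n// !mulr_ge0 ?ltW// ?ln_nat_gt0 ?center_gt0.
Qed.

Lemma halfwidth_gt0 : 0 < w.
Proof.
rewrite sqrtr_gt0 divr_gt0 ?nat_gt0// mulr_gt0 ?ln_nat_gt0//.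
by rewrite mulr_gt0 ?center_gt0.
Qed.

Lemma halfwidth_le : w <= m.
Proof.
have [w0 m0] := (ltW halfwidth_gt0, ltW center_gt0).
rewrite -(ler_pXn2r (ltn0Sn 1)) ?nnegrE//.
by rewrite sqr_halfwidth expr2 ler_pM2l ?center_gt0// center_ge.
Qed.

Lemma halfwidth_ge : c * L / n%:R <= w.
Proof.
have [w0 b0] := (ltW halfwidth_gt0, ltW base_gt0).
rewrite -(ler_pXn2r (ltn0Sn 1)) ?nnegrE//.
by rewrite sqr_halfwidth expr2 ler_pM2r ?base_gt0// center_ge.
Qed.

Lemma halfwidth_small : small -> w = m.
Proof.
move=> sm; apply/eqP; rewrite eq_le halfwidth_le /=.
by rewrite (center_small sm) halfwidth_ge.
Qed.

Lemma sqrt_window_large c' : 0 <= c' -> ~~ small ->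
  Num.sqrt (c' * expR (- eps) * p * L / n%:R) = Num.sqrt (c' / c) * w.
Proof.
move=> c'0 la; rewrite /halfwidth -sqrtrM; last by rewrite divr_ge0// ltW.
congr Num.sqrt.
by rewrite (center_large la) expRN; field; rewrite !gt_eqF ?expR_gt0 ?nat_gt0.
Qed.

Lemma U_leftE : U_left eps n c c p = m - w.
Proof.
rewrite /U_left; case: ifPn => [sm|la]; first by rewrite halfwidth_small// subrr.
by rewrite (sqrt_window_large (ltW c_gt0) la) divff ?lt0r_neq0// sqrtr1 mul1r expRNE center_large.
Qed.

Lemma U_rightE : U_right eps n c c p = m + w.
Proof.
rewrite /U_right; case: ifPn => [sm|la].
  by rewrite halfwidth_small// center_small// mulrDl mulrDl.
by rewrite (sqrt_window_large (ltW c_gt0) la) divff ?lt0r_neq0// sqrtr1 mul1r expRNE center_large.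
Qed.

Lemma mem_UE : [set` U eps n c c p] = [set x | m - w <= x <= m + w].
Proof. by apply/seteqP; split => x /=; rewrite /U in_itv U_leftE U_rightE. Qed.

(** For small p, p itself lies below the square root. Otherwise the kink of the ramp is the centre,
    so the largest value on the window is E w. *)
Lemma ramp_window_le x : m - w <= x <= m + w ->
  ramp eps p x <= Num.min p (Num.sqrt (c * E * p * L / n%:R)).
Proof.
move=> /andP[x1 x2].
have x0 : 0 <= x by apply: le_trans x1; rewrite subr_ge0 halfwidth_le.
rewrite le_min ramp_le//=.
have [sm|la] := boolP small.
  apply: le_trans (ramp_le _ p_ge0 x0) _.
  rewrite -[leLHS]ger0_norm// -sqrtr_sqr ler_wsqrtr//.
  have -> : c * E * p * L / n%:R = p * (c * E * L / n%:R) by ring.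
  by rewrite expr2 ler_wpM2l.
rewrite /ramp ge_max sqrtr_ge0 andbT.
have -> : c * E * p * L / n%:R = (E * w) ^+ 2.
  rewrite exprMn sqr_halfwidth center_large//; field.
  by rewrite !gt_eqF ?expR_gt0 ?nat_gt0.
rewrite sqrtr_sqr ger0_norm; last by rewrite mulr_ge0 ?expR_ge0// ltW ?halfwidth_gt0.
have pE : p = E * m by rewrite center_large// mulrC divfK// gt_eqF ?expR_gt0.
rewrite [X in X - _]pE -mulrBr ler_pM2l ?expR_gt0//; lra.
Qed.

(** The slope - 2 y is cut off once |y| reaches sqrt p. *)
Lemma sqr_ramp_lipschitz y z :
  `|Num.max (p - y ^+ 2) 0 - Num.max (p - z ^+ 2) 0|
    <= 2 * Num.sqrt p * `|y - z|.
Proof.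
set r := Num.sqrt p.
have r0 : 0 <= r by exact: sqrtr_ge0.
have pE : p = r ^+ 2 by rewrite sqr_sqrtr.
wlog yz : y z / `|y| <= `|z|.
  move=> wl; have [|/ltW] := leP `|y| `|z|; first exact: wl.
  by move=> /wl; rewrite distrC (distrC z y).
rewrite -(real_normK (num_real y)) -(real_normK (num_real z)) pE.
have d0 : `|z| - `|y| <= `|y - z| by rewrite distrC (le_trans (lerB_dist _ _)).
have := normr_ge0 y; have := normr_ge0 z; set Y := `|y| in yz d0 *.
set Z := `|z| in yz d0 *; move=> Z0 Y0.
have [ry|ry] := leP r Y.
  rewrite !max_r; first by rewrite subrr normr0 !mulr_ge0.
  - by nra.
  - by nra.
have [rz|rz] := leP r Z.
  rewrite max_l; last by nra.
  rewrite max_r; last by nra.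
  rewrite subr0 ger0_norm; last by nra.
  have : r * (Z - Y) <= r * `|y - z| by rewrite ler_wpM2l.
  by nra.
rewrite !max_l; [|by nra|by nra].
rewrite ger0_norm; last by nra.
have : r * (Z - Y) <= r * `|y - z| by rewrite ler_wpM2l.
by nra.
Qed.

Lemma even_poly_horner (P : {poly R}) y :
  (even_poly P).[y ^+ 2] = (P.[y] + P.[- y]) / 2.
Proof.
have PE t : P.[t] = (even_poly P).[t ^+ 2] + (odd_poly P).[t ^+ 2] * t.
  by rewrite -{1}[P]poly_even_odd hornerD hornerM !horner_comp hornerX hornerXn.
by rewrite !PE sqrrN; field.
Qed.

(* Substituting [x = 2 w y^2] turns the ramp into an even function of [y] with
   Lipschitz constant of order [sqrt (E p w)], hence the gain over the direct
   Lipschitz bound [E w]. *)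
Lemma ramp_approx_small K : small -> exists2 P : {poly R}, (size P <= K.+1)%N &
  forall x, m - w <= x <= m + w ->
    `|ramp eps p x - P.[x]| <= 6 * Num.sqrt (8 * c * E * p * L / n%:R) / K.+1%:R.
Proof.
move=> sm; have w0 := halfwidth_gt0; have E0 := expR_gt0 eps.
pose f y := ramp eps p (2 * w * y ^+ 2).
pose l := Num.sqrt (8 * c * E * p * L / n%:R).
have lE : l = 2 * Num.sqrt p * Num.sqrt (2 * E * w).
  have s2 : 2 = Num.sqrt (2 ^+ 2) :> R by rewrite sqrtr_sqr ger0_norm.
  rewrite /l [X in _ = X * _ * _]s2.
  rewrite -!sqrtrM ?mulr_ge0// ?sqr_ge0//; congr Num.sqrt.
  by rewrite halfwidth_small// center_small//; field; rewrite gt_eqF ?nat_gt0.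
have flip y z : -1 <= y <= 1 -> -1 <= z <= 1 -> `|f y - f z| <= l * `|y - z|.
  move=> _ _.
  have fE t : f t = Num.max (p - (Num.sqrt (2 * E * w) * t) ^+ 2) 0.
    rewrite /f /ramp exprMn sqr_sqrtr ?mulr_ge0 ?ltW//.
    by congr (Num.max (_ - _) _); ring.
  rewrite !fE (le_trans (sqr_ramp_lipschitz _ _))// -mulrBr normrM.
  by rewrite (ger0_norm (sqrtr_ge0 _)) mulrA lE.
(* Averaging over y and - y keeps the even powers only, so degree 2 K in y becomes degree K in x. *)
have [Q szQ QP] := jackson_lipschitz K.*2 (sqrtr_ge0 _) flip.
exists (even_poly Q \Po ((2 * w)^-1 *: 'X)) => [|x].
  rewrite size_comp_poly2; last first.
    by rewrite size_scale ?size_polyX// invr_eq0 mulf_eq0 !gt_eqF.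
  rewrite (leq_trans (size_even_poly _))// uphalfE.
  have szQ1 : ((size Q).+1 <= K.*2.+2)%N by rewrite ltnS.
  by rewrite (leq_trans (half_leq szQ1))//= doubleK.
rewrite -halfwidth_small// subrr => /andP[x0 x2w].
have y01 : 0 <= x / (2 * w) <= 1.
  rewrite divr_ge0 ?mulr_ge0 ?(ltW w0)//= ler_pdivrMr ?mulr_gt0//.
  by rewrite mul1r mulrDl mul1r.
have /andP[y0 y1] := y01.
pose y := Num.sqrt (x / (2 * w)).
have yle : -1 <= y <= 1.
  rewrite (le_trans _ (sqrtr_ge0 _)) ?lerN10//=.
  by rewrite -sqrtr1 ler_wsqrtr.
have y2 : y ^+ 2 = x / (2 * w) by rewrite sqr_sqrtr.
have xE : 2 * w * y ^+ 2 = x by rewrite y2 mulrC divfK// mulf_eq0 !gt_eqF.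
have -> : (even_poly Q \Po ((2 * w)^-1 *: 'X)).[x] = (Q.[y] + Q.[- y]) / 2.
  by rewrite horner_comp hornerZ hornerX mulrC -y2 even_poly_horner.
have h1 := QP y yle.
have h2 : `|f (- y) - Q.[- y]| <= 6 * l / K.*2.+1%:R.
  by apply: QP; rewrite lerN2 lerNl andbC.
have fN : f (- y) = f y by rewrite /f sqrrN.
have fx : f y = ramp eps p x by rewrite /f xE.
have lK : 6 * l / K.*2.+1%:R <= 6 * l / K.+1%:R.
  rewrite ler_wpM2l ?mulr_ge0 ?sqrtr_ge0// lef_pV2 ?posrE ?ltr0n// ler_nat.
  by rewrite ltnS -addnn leq_addr.
rewrite fN fx in h1 h2.
have -> : ramp eps p x - (Q.[y] + Q.[- y]) / 2
  = ((ramp eps p x - Q.[y]) + (ramp eps p x - Q.[- y])) / 2 by field.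
rewrite normrM [`|2^-1|]ger0_norm// ler_pdivrMr//.
apply: le_trans (ler_normD _ _) _; rewrite -/l.
by move: h1 h2 lK; set A := _ / _; set B := _ / _; lra.
Qed.

(** Here w^2 = c p L / (E n), so the direct Lipschitz constant E w = sqrt (c E p L / n) already has
    the desired order. *)
Lemma ramp_approx_large K : ~~ small -> exists2 P : {poly R}, (size P <= K.+1)%N &
  forall x, m - w <= x <= m + w ->
    `|ramp eps p x - P.[x]| <= 6 * Num.sqrt (8 * c * E * p * L / n%:R) / K.+1%:R.
Proof.
move=> la; have w0 := halfwidth_gt0; have E0 := expR_gt0 eps.
pose f y := ramp eps p (m + w * y).
pose l := Num.sqrt (8 * c * E * p * L / n%:R).
have lE : E * w <= l.
  rewrite -[leLHS]ger0_norm; last by rewrite mulr_ge0// ltW.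
  rewrite -sqrtr_sqr ler_wsqrtr//.
  rewrite exprMn sqr_halfwidth center_large//.
  have -> : E ^+ 2 * (p / E * (c * L / n%:R)) = c * E * p * L / n%:R.
    by field; rewrite !gt_eqF ?nat_gt0.
  have : 0 <= c * E * p * L / n%:R.
    have [c0 L0] := (ltW c_gt0, ltW ln_nat_gt0); have E0' := ltW E0.
    by rewrite divr_ge0// !mulr_ge0.
  have -> : 8 * c * E * p * L / n%:R = 8 * (c * E * p * L / n%:R) by ring.
  lra.
have flip y z : -1 <= y <= 1 -> -1 <= z <= 1 -> `|f y - f z| <= l * `|y - z|.
  move=> _ _; apply: le_trans (ramp_lipschitz _ _ _ _) _.
  rewrite opprD addrACA subrr add0r -mulrBr normrM (gtr0_norm w0) mulrA.
  by rewrite ler_wpM2r.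
have [Q szQ QP] := jackson_lipschitz K (sqrtr_ge0 _) flip.
exists (Q \Po (w^-1 *: ('X - m%:P))) => [|x /andP[x1 x2]].
  rewrite size_comp_poly2//.
  by rewrite size_scale ?size_XsubC// invr_eq0 gt_eqF.
have xE : x = m + w * ((x - m) / w) by field; rewrite gt_eqF.
have <- : f ((x - m) / w) = ramp eps p x by rewrite /f -xE.
rewrite horner_comp hornerZ hornerXsubC [w^-1 * _]mulrC; apply: QP.
by rewrite ler_pdivlMr// ler_pdivrMr//; lra.
Qed.

Variables (K : nat).
Local Notation D := (best_approx eps n c K p).

Lemma best_approxP :
  is_best_approx [set` U eps n c c p] (ramp eps p) K D.
Proof.
rewrite /best_approx; apply: xgetPex.
apply: (@best_approx_exists _ _ _ _ _ p) => [|x].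
  by rewrite U_leftE U_rightE; have := halfwidth_gt0; lra.
rewrite U_leftE U_rightE => /andP[x1 x2].
rewrite ger0_norm ?ramp_ge0 ?ramp_le//.
by apply: le_trans x1; rewrite subr_ge0 halfwidth_le.
Qed.

Lemma size_best_approx : (size D <= K.+1)%N.
Proof. by case: best_approxP. Qed.

Lemma best_approx_err (P : {poly R}) (e : R) : (size P <= K.+1)%N ->
  (forall x, m - w <= x <= m + w -> `|ramp eps p x - P.[x]| <= e) ->
  forall x, m - w <= x <= m + w -> `|ramp eps p x - D.[x]| <= e.
Proof.
move=> szP Pe x xI; rewrite -lee_fin.
have [_ /(_ P szP) DP] := best_approxP.
apply: (le_trans _ (le_trans DP _)).
  by apply: ereal_sup_ubound; exists x => //; rewrite mem_UE.
by apply: ge_ereal_sup => _ [y + <-]; rewrite mem_UE lee_fin; exact: Pe.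
Qed.

Lemma best_approx_jackson x : m - w <= x <= m + w ->
  `|ramp eps p x - D.[x]| <= 6 * Num.sqrt (8 * c * E * p * L / n%:R) / K.+1%:R.
Proof.
have [sm|la] := boolP small.
  by have [P szP PE] := ramp_approx_small K sm; exact: best_approx_err PE x.
by have [P szP PE] := ramp_approx_large K la; exact: best_approx_err PE x.
Qed.

(** The competitor is the zero polynomial; it supplies the bound p, which beats Jackson's for very
    small p. *)
Lemma best_approx_trivial x : m - w <= x <= m + w ->
  `|ramp eps p x - D.[x]| <= Num.min p (Num.sqrt (c * E * p * L / n%:R)).
Proof.
move=> xI; apply: (@best_approx_err 0) => [|{}x {}xI|//]; first by rewrite size_poly0.
by rewrite horner0 subr0 ger0_norm ?ramp_ge0 ?ramp_window_le.
Qed.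

Lemma best_approx_bounded x : m - w <= x <= m + w ->
  `|D.[x]| <= 2 * Num.min p (Num.sqrt (c * E * p * L / n%:R)).
Proof.
move=> xI; rewrite -[D.[x]](subKr (ramp eps p x)) (le_trans (ler_normB _ _))//.
have := best_approx_trivial xI; have := ramp_window_le xI.
by rewrite (ger0_norm (ramp_ge0 _ _ _)); lra.
Qed.

End fixed_parameters.
End ramp_approximation.

(** * Poisson means *)

Section poisson_mean.
Context {R : realType}.
Implicit Types (lam mu t d : R) (g h : nat -> R) (k : nat).

(** As 0 ^+ 0 = 1, rate 0 gives the Dirac mass at 0, which covers symbols with q = 0. *)
Definition poisson_weight lam k : R := expR (- lam) * lam ^+ k / k`!%:R.

Definition poisson_mean lam g : R :=
  limn (series (fun k => poisson_weight lam k * g k)).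

(** At most geometric growth makes the Poisson series converge absolutely at every rate. The class
    contains counts, indicators and exponentials, and is stable under products and shifts. *)
Definition exp_bounded g : Prop :=
  exists a b : R, [/\ 0 <= a, 1 <= b & forall k, `|g k| <= a * b ^+ k].

Lemma exp_bounded_cst c : exp_bounded (fun=> c).
Proof. by exists `|c|, 1; split => // k; rewrite expr1n mulr1. Qed.

Lemma exp_bounded_le g h : (forall k, `|g k| <= `|h k|) ->
  exp_bounded h -> exp_bounded g.
Proof.
by move=> gh [a [b [a0 b1 hab]]]; exists a, b; split => // k; exact: le_trans (hab k).
Qed.

Lemma exp_bounded_bounded c g : (forall k, `|g k| <= c) -> exp_bounded g.
Proof.
move=> gc; apply: exp_bounded_le (exp_bounded_cst c) => k.
by rewrite [leRHS]ger0_norm ?(le_trans _ (gc k)).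
Qed.

Lemma exp_boundedD g h : exp_bounded g -> exp_bounded h ->
  exp_bounded (fun k => g k + h k).
Proof.
move=> [a [b [a0 b1 gab]]] [a' [b' [a'0 b'1 hab]]].
exists (a + a'), (Num.max b b'); split; rewrite ?addr_ge0 ?le_max ?b1// => k.
apply: le_trans (ler_normD _ _) _; rewrite mulrDl lerD//.
  apply: le_trans (gab k) _; rewrite ler_wpM2l// lerXn2r ?nnegrE ?le_max ?lexx//.
    exact: le_trans ler01 b1.
  by rewrite (le_trans ler01 b1).
apply: le_trans (hab k) _; rewrite ler_wpM2l// lerXn2r ?nnegrE ?le_max ?lexx ?orbT//.
  exact: le_trans ler01 b'1.
by rewrite (le_trans ler01 b1).
Qed.

Lemma exp_boundedM g h : exp_bounded g -> exp_bounded h ->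
  exp_bounded (fun k => g k * h k).
Proof.
move=> [a [b [a0 b1 gab]]] [a' [b' [a'0 b'1 hab]]].
exists (a * a'), (b * b'); split; rewrite ?mulr_ge0 ?mulr_ege1// => k.
by rewrite normrM exprMn mulrACA ler_pM.
Qed.

Lemma exp_boundedB g h : exp_bounded g -> exp_bounded h ->
  exp_bounded (fun k => g k - h k).
Proof.
move=> bg bh; apply: exp_boundedD => //.
by apply: exp_bounded_le bh => k; rewrite normrN.
Qed.

Lemma exp_bounded_sqr g : exp_bounded g -> exp_bounded (fun k => g k ^+ 2).
Proof.
move=> bg; have := exp_boundedM bg bg.
by apply: exp_bounded_le => k; rewrite expr2.
Qed.

Lemma exp_bounded_sum (I : Type) (r : seq I) (P : pred I) (g : I -> nat -> R) :
  (forall i, exp_bounded (g i)) -> exp_bounded (fun k => \sum_(i <- r | P i) g i k).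
Proof.
move=> bg; elim: r => [|i r IH].
  by apply: exp_bounded_le (exp_bounded_cst 0) => k; rewrite big_nil.
case Pi : (P i); last first.
  by apply: exp_bounded_le IH => k; rewrite big_cons Pi.
by apply: exp_bounded_le (exp_boundedD (bg i) IH) => k; rewrite big_cons Pi.
Qed.

Lemma exp_bounded_prod (I : Type) (r : seq I) (P : pred I) (g : I -> nat -> R) :
  (forall i, exp_bounded (g i)) -> exp_bounded (fun k => \prod_(i <- r | P i) g i k).
Proof.
move=> bg; elim: r => [|i r IH].
  by apply: exp_bounded_le (exp_bounded_cst 1) => k; rewrite big_nil.
case Pi : (P i); last first.
  by apply: exp_bounded_le IH => k; rewrite big_cons Pi.
by apply: exp_bounded_le (exp_boundedM (bg i) IH) => k; rewrite big_cons Pi.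
Qed.

Lemma exp_bounded_expr t : exp_bounded (fun k => t ^+ k).
Proof.
exists 1, (Num.max 1 `|t|); split; rewrite ?le_max ?lexx// => k.
rewrite mul1r normrX lerXn2r ?nnegrE ?le_max ?lexx ?orbT//.
by rewrite ler01.
Qed.

Lemma exp_bounded_nat : exp_bounded (fun k => k%:R).
Proof.
exists 1, 2; split; rewrite ?ler1n// => k.
by rewrite mul1r ger0_norm// -natrX ler_nat ltnW// ltn_expl.
Qed.

Lemma exp_bounded_succ g : exp_bounded g -> exp_bounded (fun k => g k.+1).
Proof.
move=> [a [b [a0 b1 gab]]]; have b0 := le_trans ler01 b1.
by exists (a * b), b; split; rewrite ?mulr_ge0// => k; rewrite -mulrA -exprS.
Qed.

Lemma exp_bounded_pred g : exp_bounded g -> exp_bounded (fun k => g k.-1).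
Proof.
move=> [a [b [a0 b1 gab]]]; have b0 := le_trans ler01 b1.
exists a, b; split=> // k; apply: le_trans (gab _) _.
by rewrite ler_wpM2l// ler_weXn2l// leq_pred.
Qed.

Lemma poisson_weight_ge0 lam k : 0 <= lam -> 0 <= poisson_weight lam k.
Proof. by move=> l0; rewrite divr_ge0// mulr_ge0 ?expR_ge0 ?exprn_ge0. Qed.

Section rate.
Variable lam : R.
Hypothesis lam_ge0 : 0 <= lam.

Lemma poisson_series_cvg g : exp_bounded g ->
  cvgn (series (fun k => poisson_weight lam k * g k)).
Proof.
move=> [a [b [a0 b1 gab]]]; have b0 := le_trans ler01 b1.
apply: normed_cvg; apply: (@series_le_cvg _ _
    ((expR (- lam) * a) *: exp_coeff (lam * b))).
- by move=> k; exact: normr_ge0.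
- move=> k; apply: mulr_ge0; first by rewrite mulr_ge0 ?expR_ge0.
  by apply: exp_coeff_ge0; rewrite mulr_ge0.
- move=> k; rewrite /= normrM ger0_norm ?poisson_weight_ge0//.
  apply: le_trans (ler_wpM2l (poisson_weight_ge0 k lam_ge0) (gab k)) _.
  rewrite -[leRHS]/(expR (- lam) * a * ((lam * b) ^+ k / k`!%:R)) exprMn.
  by rewrite /poisson_weight le_eqVlt; apply/orP; left; apply/eqP; ring.
by apply: is_cvg_seriesZ; exact: is_cvg_series_exp_coeff.
Qed.

Lemma eq_poisson_mean g h : g =1 h -> poisson_mean lam g = poisson_mean lam h.
Proof. by move=> /funext ->. Qed.

Lemma poisson_meanD g h : exp_bounded g -> exp_bounded h ->
  poisson_mean lam (fun k => g k + h k) = poisson_mean lam g + poisson_mean lam h.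
Proof.
move=> bg bh; rewrite /poisson_mean -lim_seriesD; [|exact: poisson_series_cvg..].
by congr (limn (series _)); apply/funext => k /=; rewrite mulrDr.
Qed.

Lemma poisson_meanZ c g : exp_bounded g ->
  poisson_mean lam (fun k => c * g k) = c * poisson_mean lam g.
Proof.
move=> bg; rewrite /poisson_mean -[RHS]/(c *: _) -lim_seriesZ.
  by congr (limn (series _)); apply/funext => k /=; rewrite mulrCA.
exact: poisson_series_cvg.
Qed.

Lemma poisson_meanB g h : exp_bounded g -> exp_bounded h ->
  poisson_mean lam (fun k => g k - h k) = poisson_mean lam g - poisson_mean lam h.
Proof.
move=> bg bh; rewrite -[X in _ - X]mul1r -mulNr -poisson_meanZ// -poisson_meanD//.
  by apply: eq_poisson_mean => k; rewrite mulN1r.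
by apply: exp_bounded_le bh => k; rewrite mulN1r normrN.
Qed.

Lemma poisson_mean_sum (I : Type) (r : seq I) (P : pred I) (g : I -> nat -> R) :
  (forall i, exp_bounded (g i)) ->
  poisson_mean lam (fun k => \sum_(i <- r | P i) g i k)
    = \sum_(i <- r | P i) poisson_mean lam (g i).
Proof.
move=> bg; elim: r => [|i r IH].
  rewrite big_nil -[RHS](mul0r (poisson_mean lam (fun=> 0))) -poisson_meanZ.
    by apply: eq_poisson_mean => k; rewrite big_nil mul0r.
  exact: exp_bounded_cst.
rewrite big_cons; case Pi : (P i); last first.
  by rewrite -IH; apply: eq_poisson_mean => k; rewrite big_cons Pi.
rewrite -IH -poisson_meanD//; last exact: exp_bounded_sum.
by apply: eq_poisson_mean => k; rewrite big_cons Pi.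
Qed.

Lemma poisson_mean_expr t : poisson_mean lam (fun k => t ^+ k) = expR (lam * (t - 1)).
Proof.
rewrite mulrBr mulr1 addrC expRD [expR (lam * t)]/expR -[RHS]/(_ *: _).
rewrite -lim_seriesZ; last exact: is_cvg_series_exp_coeff.
congr (limn (series _)); apply/funext => k.
rewrite -[RHS]/(expR (- lam) * ((lam * t) ^+ k / k`!%:R)) exprMn.
by rewrite /poisson_weight; ring.
Qed.

Lemma poisson_mean_cst c : poisson_mean lam (fun=> c) = c.
Proof.
transitivity (c * poisson_mean lam (fun k => 1 ^+ k)).
  rewrite -poisson_meanZ; last exact: exp_bounded_expr.
  by apply: eq_poisson_mean => k; rewrite expr1n mulr1.
by rewrite poisson_mean_expr subrr mulr0 expR0 mulr1.
Qed.

Lemma poisson_mean_le g h : exp_bounded g -> exp_bounded h ->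
  (forall k, g k <= h k) -> poisson_mean lam g <= poisson_mean lam h.
Proof.
move=> bg bh gh; apply: lim_series_le; [exact: poisson_series_cvg..|] => k.
by rewrite ler_wpM2l// poisson_weight_ge0.
Qed.

Lemma poisson_mean_ge0 g : exp_bounded g -> (forall k, 0 <= g k) ->
  0 <= poisson_mean lam g.
Proof.
move=> bg g0; rewrite -(poisson_mean_cst 0) poisson_mean_le//.
exact: exp_bounded_cst.
Qed.

(** Stein's identity, from k w(k) = lam w(k - 1) for the Poisson weights w. At k = 0 the factor k
    cancels the default value of [k.-1]. *)
Lemma poisson_mean_stein g : exp_bounded g ->
  poisson_mean lam (fun k => k%:R * g k.-1) = lam * poisson_mean lam g.
Proof.
move=> bg; rewrite -poisson_meanZ//; apply: cvg_lim => //.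
rewrite -cvg_shiftS.
have -> : [sequence series (fun k => poisson_weight lam k * (k%:R * g k.-1)) n.+1]_n
    = series (fun k => poisson_weight lam k * (lam * g k)).
  apply/funext => n; rewrite /= /series /= big_nat_recl// mul0r mulr0 add0r.
  apply: eq_bigr => k _; rewrite /poisson_weight factS natrM exprS.
  have [a0 b0] : k.+1%:R != 0 :> R /\ k`!%:R != 0 :> R.
    by rewrite !pnatr_eq0 -!lt0n fact_gt0.
  by move: k.+1%:R k`!%:R a0 b0 => a b a0 b0; field; rewrite a0 b0.
apply: poisson_series_cvg.
exact: exp_boundedM (exp_bounded_cst lam) bg.
Qed.

Lemma poisson_mean_sqr_le g : exp_bounded g ->
  poisson_mean lam g ^+ 2 <= poisson_mean lam (fun k => g k ^+ 2).
Proof.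
move=> bg; set e := poisson_mean lam g.
have bg2 := exp_bounded_sqr bg; have be := exp_bounded_cst e.
have : 0 <= poisson_mean lam (fun k => (g k - e) ^+ 2).
  apply: poisson_mean_ge0 => [|k]; last exact: sqr_ge0.
  exact: exp_bounded_sqr (exp_boundedB bg be).
have -> : poisson_mean lam (fun k => (g k - e) ^+ 2)
  = poisson_mean lam (fun k => g k ^+ 2 - (2 * e * g k - e ^+ 2)).
  by apply: eq_poisson_mean => k; ring.
rewrite poisson_meanB//; last first.
  by apply: exp_boundedB; [apply: exp_boundedM => //|]; exact: exp_bounded_cst.
rewrite poisson_meanB//; last 2 first.
- by apply: exp_boundedM => //; exact: exp_bounded_cst.
- exact: exp_bounded_cst.
by rewrite poisson_meanZ// poisson_mean_cst -/e; lra.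
Qed.

(** From e^t <= 1 / (1 - t) and (1 - t) (1 + t + 2 t^2) = 1 + t^2 (1 - 2 t). *)
Lemma expR_le_quadratic t : t <= 2^-1 -> expR t <= 1 + t + 2 * t ^+ 2.
Proof.
move=> t12; have t1 : 0 < 1 - t by lra.
have := expR_ge1Dx (- t); rewrite expRN => h.
have : (1 - t) * expR t <= 1.
  by rewrite -ler_pdivlMr ?expR_gt0// div1r.
have : 1 <= (1 - t) * (1 + t + 2 * t ^+ 2) by nra.
by move=> h1 h2; rewrite -(ler_pM2l t1) (le_trans h2).
Qed.

(** The exponent - t d + 2 mu t^2 is minimal at t = d / (4 mu), and d <= 2 mu keeps t <= 1/2 as
    [expR_le_quadratic] demands. The proxy mu allows lam to be arbitrarily small. *)
Lemma poisson_chernoff_upper mu d : 0 < mu -> lam <= mu -> 0 <= d <= 2 * mu ->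
  poisson_mean lam (fun k => (lam + d <= k%:R)%R%:R) <= expR (- (d ^+ 2 / (8 * mu))).
Proof.
move=> mu0 lmu /andP[d0 dmu]; pose t := d / (4 * mu).
have t0 : 0 <= t by rewrite divr_ge0// mulr_ge0// ltW.
have t12 : t <= 2^-1 by rewrite ler_pdivrMr ?mulr_gt0//; lra.
apply: (@le_trans _ _ (poisson_mean lam
    (fun k => expR (- (t * (lam + d))) * expR t ^+ k))).
  apply: poisson_mean_le.
  - by apply: (@exp_bounded_bounded 1) => k; case: (lam + d <= _); rewrite ?normr1 ?normr0.
  - by apply: exp_boundedM; [exact: exp_bounded_cst|exact: exp_bounded_expr].
  move=> k; case: (leP (lam + d)) => [h|_]; last by rewrite /= mulr0n mulr_ge0 ?exprn_ge0 ?expR_ge0.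
  rewrite /= mulr1n -expRM_natl -expRD -[X in X <= _]expR0 ler_expR.
  by have := ler_wpM2l t0 h; lra.
rewrite poisson_meanZ; last exact: exp_bounded_expr.
rewrite poisson_mean_expr -expRD ler_expR.
have := ler_wpM2l lam_ge0 (expR_le_quadratic t12).
have : lam * t ^+ 2 <= mu * t ^+ 2 by rewrite ler_wpM2r// sqr_ge0.
have -> : d ^+ 2 / (8 * mu) = t * d - 2 * (mu * t ^+ 2).
  by rewrite /t; field; rewrite gt_eqF.
by rewrite /=; lra.
Qed.

Lemma poisson_chernoff_lower mu d : 0 < mu -> lam <= mu -> 0 <= d ->
  poisson_mean lam (fun k => (k%:R <= lam - d)%R%:R) <= expR (- (d ^+ 2 / (8 * mu))).
Proof.
move=> mu0 lmu d0; pose t := d / (4 * mu).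
have t0 : 0 <= t by rewrite divr_ge0// mulr_ge0// ltW.
have t12 : - t <= 2^-1 by lra.
apply: (@le_trans _ _ (poisson_mean lam
    (fun k => expR (t * (lam - d)) * expR (- t) ^+ k))).
  apply: poisson_mean_le.
  - by apply: (@exp_bounded_bounded 1) => k; case: (_ <= lam - d); rewrite ?normr1 ?normr0.
  - by apply: exp_boundedM; [exact: exp_bounded_cst|exact: exp_bounded_expr].
  move=> k; case: (leP _ (lam - d)) => [h|_]; last by rewrite /= mulr0n mulr_ge0 ?exprn_ge0 ?expR_ge0.
  rewrite /= mulr1n -expRM_natl -expRD -[X in X <= _]expR0 ler_expR.
  by have := ler_wpM2l t0 h; lra.
rewrite poisson_meanZ; last exact: exp_bounded_expr.
rewrite poisson_mean_expr -expRD ler_expR.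
have := ler_wpM2l lam_ge0 (expR_le_quadratic t12).
have : lam * t ^+ 2 <= mu * t ^+ 2 by rewrite ler_wpM2r// sqr_ge0.
have -> : d ^+ 2 / (8 * mu) = t * d - 2 * (mu * t ^+ 2).
  by rewrite /t; field; rewrite gt_eqF.
by rewrite sqrrN /=; lra.
Qed.

End rate.
End poisson_mean.

Lemma poisson_series_mean (R : realType) (lam : R) (g : nat -> R) :
  0 <= lam -> exp_bounded g -> (forall k, 0 <= g k) ->
  (\sum_(k <oo) (poisson_weight lam k * g k)%:E)%E = (poisson_mean lam g)%:E.
Proof.
move=> l0 bg g0; rewrite /poisson_mean -EFin_lim; last exact: poisson_series_cvg.
by apply/congr_lim/funext => n /=; rewrite /series /= -sumEFin.
Qed.

(** * Second moment of the unbiased polynomial estimator *)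

Section charlier.
Context {R : realType}.
Variables (n : nat) (q : R).
Hypotheses (n_gt0 : (0 < n)%N) (q_ge0 : 0 <= q).

Local Notation lam := (n%:R * q).

Let lam_ge0 : 0 <= lam. Proof. by rewrite mulr_ge0. Qed.

(* Charlier polynomials, normalised so that [charlier j] is [n ^ j] times the
   unbiased estimator of [(x - q) ^ j]. *)
Fixpoint charlier (j : nat) (b : nat) : R :=
  if j is j'.+1 then b%:R * charlier j' b.-1 - lam * charlier j' b else 1.

Lemma charlier_exp_bounded j : exp_bounded (charlier j).
Proof.
elim: j => [|j IH]; first exact: exp_bounded_cst.
apply: exp_boundedB; apply: exp_boundedM => //; first exact: exp_bounded_nat.
  exact: exp_bounded_pred.
exact: exp_bounded_cst.
Qed.

Arguments charlier : simpl never.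

Lemma charlier0 b : charlier 0 b = 1. Proof. by []. Qed.

Lemma charlierS j b : charlier j.+1 b = b%:R * charlier j b.-1 - lam * charlier j b.
Proof. by []. Qed.

(** The forward difference acts on Charlier polynomials as differentiation acts on powers. *)
Lemma charlier_diff j b :
  charlier j.+1 b.+1 - charlier j.+1 b = j.+1%:R * charlier j b.
Proof.
elim: j b => [|j IH] b; first by rewrite !charlierS !charlier0 -natr1; ring.
have h1 : charlier j.+1 b.+1 = charlier j.+1 b + j.+1%:R * charlier j b.
  by rewrite -IH; ring.
rewrite (charlierS j.+1 b.+1) (charlierS j.+1 b) /= h1 -[j.+2%:R]natr1.
case: b {h1} => [|b] /=; first by rewrite (charlierS j) /=; ring.
have := IH b; have := charlierS j b.+1; rewrite /=.
set x := charlier j.+1 b.+1; set y := charlier j.+1 b => xE yE.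
have {yE} -> : y = x - j.+1%:R * charlier j b by rewrite -yE; ring.
move: x xE => x ->; rewrite -[b.+1%:R]natr1.
by ring.
Qed.

(** Summation by parts: raising the degree is adjoint, up to the factor lam, to the forward
    difference. With [charlier_diff] this yields the squared norms by induction. *)
Lemma poisson_mean_charlierS j (g : nat -> R) : exp_bounded g ->
  poisson_mean lam (fun b => charlier j.+1 b * g b)
    = lam * poisson_mean lam (fun b => charlier j b * (g b.+1 - g b)).
Proof.
move=> bg; have bC := charlier_exp_bounded j.
have bg1 := exp_bounded_succ bg.
have bCg := exp_boundedM bC bg; have bCg1 := exp_boundedM bC bg1.
transitivity (poisson_mean lam (fun b => b%:R * (charlier j b.-1 * g b.-1.+1)
    - lam * (charlier j b * g b))).
  by apply: eq_poisson_mean => b; rewrite charlierS; case: b => [|b] /=; ring.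
rewrite poisson_meanB//; last 2 first.
- apply: exp_boundedM; first exact: exp_bounded_nat.
  exact: exp_bounded_pred bCg1.
- by apply: exp_boundedM => //; exact: exp_bounded_cst.
rewrite poisson_meanZ// (poisson_mean_stein lam_ge0 bCg1) -mulrBr -poisson_meanB//.
by congr (_ * _); apply: eq_poisson_mean => b; ring.
Qed.

Lemma poisson_mean_charlier j : poisson_mean lam (charlier j) = (j == 0%N)%:R.
Proof.
case: j => [|j]; first by rewrite poisson_mean_cst.
transitivity (poisson_mean lam (fun b => charlier j.+1 b * 1)).
  by apply: eq_poisson_mean => b; rewrite mulr1.
rewrite poisson_mean_charlierS; last exact: exp_bounded_cst.
rewrite (@eq_poisson_mean _ _ _ (fun=> 0)) ?poisson_mean_cst ?mulr0//.
by move=> b; rewrite subrr mulr0.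
Qed.

Lemma poisson_mean_sqr_charlier j :
  poisson_mean lam (fun b => charlier j b ^+ 2) = j`!%:R * lam ^+ j.
Proof.
elim: j => [|j IH].
  rewrite (@eq_poisson_mean _ _ _ (fun=> 1)) ?poisson_mean_cst ?mulr1//.
  by move=> b; rewrite expr1n.
rewrite (@eq_poisson_mean _ _ _ (fun b => charlier j.+1 b * charlier j.+1 b)).
  rewrite poisson_mean_charlierS; last exact: charlier_exp_bounded.
  rewrite (@eq_poisson_mean _ _ _ (fun b => j.+1%:R * charlier j b ^+ 2)).
    rewrite poisson_meanZ//; last exact: exp_bounded_sqr (charlier_exp_bounded j).
    by rewrite IH factS natrM exprS; ring.
  by move=> b; rewrite charlier_diff; ring.
by move=> b; rewrite expr2.
Qed.

(* [unbiased_approx] is convertible to [falling_eval K.+1] of the best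
   approximation. *)
Definition falling_eval (d : nat) (P : {poly R}) (x : R) : R :=
  \sum_(j < d) P`_j * \prod_(k < j) (x - k%:R / n%:R).

(** The falling product of order j + 1 at b / n is b / n times the one of order j at (b - 1) / n; at
    b = 0 both sides vanish. *)
Lemma falling_evalXM d (P : {poly R}) b :
  falling_eval d.+1 ('X * P) (b%:R / n%:R)
    = b%:R / n%:R * falling_eval d P (b.-1%:R / n%:R).
Proof.
rewrite /falling_eval big_ord_recl coefXM /= mul0r add0r mulr_sumr.
apply: eq_bigr => j _; rewrite coefXM /bump /= add1n /= mulrCA; congr (_ * _).
rewrite big_ord_recl /= mul0r subr0; case: b => [|b]; first by rewrite !mul0r.
congr (_ * _); apply: eq_bigr => k _.
by rewrite /bump /= add1n -!natr1; ring.
Qed.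

Lemma falling_eval_linear d (P Q : {poly R}) c x :
  falling_eval d (P - c *: Q) x = falling_eval d P x - c * falling_eval d Q x.
Proof.
rewrite /falling_eval mulr_sumr -sumrB; apply: eq_bigr => j _.
by rewrite coefB coefZ; ring.
Qed.

Lemma falling_eval_charlier d j b : (j < d)%N ->
  falling_eval d (('X - q%:P) ^+ j) (b%:R / n%:R) = charlier j b / n%:R ^+ j.
Proof.
have n0 : n%:R != 0 :> R by rewrite pnatr_eq0 -lt0n.
elim: j d b => [|j IH] d b jd.
  rewrite /falling_eval; case: d jd => // d _.
  rewrite big_ord_recl big_ord0 expr0 coefC /= !mulr1 invr1.
  by rewrite charlier0 mul1r big1 ?addr0// => i _; rewrite coefC mul0r.
case: d jd => // d; rewrite ltnS => jd.
rewrite exprS mulrBl mul_polyC falling_eval_linear falling_evalXM !IH//; last first.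
  exact: ltnW.
by rewrite charlierS exprS; field; rewrite expf_neq0.
Qed.

Lemma falling_eval_taylor d (P : {poly R}) b : (size P <= d)%N ->
  falling_eval d P (b%:R / n%:R)
    = \sum_(j < d) (P \Po ('X + q%:P))`_j * (charlier j b / n%:R ^+ j).
Proof.
move=> szP; set T := P \Po ('X + q%:P).
have szT : size T = size P by rewrite size_comp_poly2// size_XaddC.
have PE : P = \sum_(i < d) T`_i *: ('X - q%:P) ^+ i.
  rewrite -[LHS](comp_polyXaddC_K P q) -/T comp_polyE szT.
  pose F (i : nat) := T`_i *: ('X - q%:P) ^+ i.
  rewrite -(big_mkord predT F) -(big_mkord predT F) (big_cat_nat (leq0n _) szP) /=.
  rewrite [X in _ + X]big_nat_cond [X in _ + X]big1 ?addr0//.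
  by move=> j /andP[/andP[Pj _] _]; rewrite /F nth_default ?scale0r// szT.
rewrite {1}PE /falling_eval.
under eq_bigr do rewrite coef_sum mulr_suml.
rewrite exchange_big /=; apply: eq_bigr => i _.
rewrite -(falling_eval_charlier b (ltn_ord i)) /falling_eval mulr_sumr.
by apply: eq_bigr => j _; rewrite coefZ mulrA.
Qed.

Lemma falling_eval_exp_bounded d P :
  exp_bounded (fun b => falling_eval d P (b%:R / n%:R)).
Proof.
apply: exp_bounded_sum => j; apply: exp_boundedM; first exact: exp_bounded_cst.
apply: exp_bounded_prod => k; apply: exp_boundedB; last exact: exp_bounded_cst.
by apply: exp_boundedM; [exact: exp_bounded_nat|exact: exp_bounded_cst].
Qed.

Lemma poisson_mean_falling_eval d (P : {poly R}) : (size P <= d)%N ->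
  poisson_mean lam (fun b => falling_eval d P (b%:R / n%:R)) = P.[q].
Proof.
move=> szP; rewrite (eq_poisson_mean _ (fun b => falling_eval_taylor b szP)).
have bC j := charlier_exp_bounded j.
have bCn (j : nat) : exp_bounded (fun b => charlier j b / n%:R ^+ j).
  by apply: exp_boundedM => //; exact: exp_bounded_cst.
rewrite poisson_mean_sum//; last first.
  by move=> j; apply: exp_boundedM => //; exact: exp_bounded_cst.
have T0 : (P \Po ('X + q%:P))`_0 = P.[q].
  by rewrite -horner_coef0 horner_comp !hornerE.
under eq_bigr => j _.
  rewrite poisson_meanZ//.
  rewrite (@eq_poisson_mean _ _ _ (fun b => (n%:R ^+ j)^-1 * charlier j b)); last first.
    by move=> b; rewrite mulrC.
  rewrite poisson_meanZ// poisson_mean_charlier.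
  over.
case: d szP => [|d szP].
  by rewrite leqn0 size_poly_eq0 => /eqP ->; rewrite big_ord0 horner0.
rewrite big_ord_recl T0 big1 ?addr0; first by rewrite /= expr0 invr1 !mulr1.
by move=> i _; rewrite /= !mulr0.
Qed.

Lemma sqr_sum_le d (f : 'I_d -> R) : (\sum_i f i) ^+ 2 <= d%:R * \sum_i f i ^+ 2.
Proof.
have : 0 <= \sum_i \sum_j (f i - f j) ^+ 2.
  by apply: sumr_ge0 => i _; apply: sumr_ge0 => j _; exact: sqr_ge0.
have -> : \sum_i \sum_j (f i - f j) ^+ 2
    = 2 * (d%:R * \sum_i f i ^+ 2) - 2 * (\sum_i f i) ^+ 2.
  transitivity (\sum_i \sum_j (f i ^+ 2 + f j ^+ 2 - 2 * (f i * f j))).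
    by apply: eq_bigr => i _; apply: eq_bigr => j _; ring.
  under eq_bigr do rewrite sumrB big_split /= sumr_const card_ord -mulr_sumr -mulr_sumr.
  rewrite sumrB big_split /= sumr_const card_ord -mulr_sumr -mulr_suml sumrMnl.
  by rewrite !mulr_natl; ring.
lra.
Qed.

(** The Taylor coefficients at q satisfy |T_j| w^j <= Z = B (3 e s)^K, and j! <= K^j bounds the j-th
    second moment by Z^2 (K q / (n w^2))^j <= Z^2 s^K. With (K + 1)^2 <= 4^K the total is B^2 (36
    e^2 s^3)^K, and 36 e^2 s^3 <= e^(6 + 2 + 3 (s - 1)) <= e^(8 s). *)
Lemma falling_eval_second_moment K (P : {poly R}) (m w s B : R) :
  0 < w -> 1 <= s -> `|q - m| <= s * w -> K%:R * q <= s * (n%:R * w ^+ 2) ->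
  (size P <= K.+1)%N ->
  (forall x, m - w <= x <= m + w -> `|P.[x]| <= B) ->
  poisson_mean lam (fun b => falling_eval K.+1 P (b%:R / n%:R) ^+ 2)
    <= B ^+ 2 * expR (8 * s * K%:R).
Proof.
move=> w0 s1 qm Kq szP PB.
have n0 : 0 < n%:R :> R by rewrite ltr0n.
set T := P \Po ('X + q%:P).
have Tw j : `|T`_j| * w ^+ j <= B * (3 * expR 1 * s) ^+ K.
  exact: (@shifted_coef_le _ K j P m w q s B).
set Z := B * _ in Tw.
have Z0 : 0 <= Z.
  by apply: le_trans (Tw 0%N); rewrite mulr_ge0// exprn_ge0// ltW.
have bterm (j : nat) :
    exp_bounded (fun b => (T`_j * (charlier j b / n%:R ^+ j)) ^+ 2).
  apply: exp_bounded_sqr; apply: exp_boundedM; first exact: exp_bounded_cst.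
  by apply: exp_boundedM; [exact: charlier_exp_bounded|exact: exp_bounded_cst].
(* Cauchy-Schwarz costs a factor K + 1 but leaves only squares, so cross moments of Charlier
   polynomials never enter. *)
apply: (@le_trans _ _ (poisson_mean lam (fun b => K.+1%:R *
    \sum_(j < K.+1) (T`_j * (charlier j b / n%:R ^+ j)) ^+ 2))).
  apply: poisson_mean_le => //.
  - exact: exp_bounded_sqr (falling_eval_exp_bounded _ _).
  - apply: exp_boundedM; first exact: exp_bounded_cst.
    exact: exp_bounded_sum.
  - by move=> b; rewrite falling_eval_taylor// sqr_sum_le.
rewrite poisson_meanZ//; last exact: exp_bounded_sum.
rewrite poisson_mean_sum//.
have term (j : 'I_K.+1) :
    poisson_mean lam (fun b => (T`_j * (charlier j b / n%:R ^+ j)) ^+ 2)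
    <= Z ^+ 2 * s ^+ K.
  rewrite (@eq_poisson_mean _ _ _
    (fun b => (T`_j / n%:R ^+ j) ^+ 2 * charlier j b ^+ 2)); last first.
    by move=> b; rewrite !exprMn; ring.
  rewrite poisson_meanZ//; last exact: exp_bounded_sqr (charlier_exp_bounded j).
  rewrite poisson_mean_sqr_charlier.
  have jK : (j <= K)%N by rewrite -ltnS.
  have fj : j`!%:R <= K%:R ^+ j :> R.
    rewrite -natrX ler_nat; elim: (j : nat) jK => [//|i IH] iK.
    by rewrite factS expnS leq_mul// IH// ltnW.
  apply: (@le_trans _ _ ((`|T`_j| * w ^+ j) ^+ 2 * (K%:R * q / (n%:R * w ^+ 2)) ^+ j)).
    have -> : (`|T`_j| * w ^+ j) ^+ 2 * (K%:R * q / (n%:R * w ^+ 2)) ^+ j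
      = (T`_j / n%:R ^+ j) ^+ 2 * (K%:R ^+ j * lam ^+ j).
      rewrite exprMn real_normK ?num_real//.
      have -> : (K%:R * q / (n%:R * w ^+ 2)) ^+ j
          = K%:R ^+ j * q ^+ j / (n%:R ^+ j * (w ^+ j) ^+ 2).
        by rewrite !exprMn exprVn exprMn -!exprM mulnC.
      rewrite [lam ^+ j]exprMn.
      have : w ^+ j != 0 by rewrite expf_neq0// gt_eqF.
      have : n%:R ^+ j != 0 :> R by rewrite expf_neq0// gt_eqF.
      by move: (n%:R ^+ j) (w ^+ j) => x y x0 y0; field; rewrite x0 y0.
    by rewrite ler_wpM2l ?sqr_ge0// ler_wpM2r// exprn_ge0.
  have Kq0 : 0 <= K%:R * q / (n%:R * w ^+ 2).
    apply: divr_ge0; first exact: mulr_ge0.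
    by rewrite mulr_ge0 ?sqr_ge0.
  have Tw0 : 0 <= `|T`_j| * w ^+ j by rewrite mulr_ge0// exprn_ge0// ltW.
  apply: ler_pM; [exact: sqr_ge0|exact: exprn_ge0|by rewrite lerXn2r ?nnegrE|].
  apply: (@le_trans _ _ (s ^+ j)); last by rewrite ler_weXn2l.
  rewrite lerXn2r ?nnegrE//; first exact: le_trans s1.
  by rewrite ler_pdivrMr// mulr_gt0// exprn_gt0.
have s0 : 0 <= s by exact: le_trans s1.
have sK0 : 0 <= Z ^+ 2 * s ^+ K by rewrite mulr_ge0 ?sqr_ge0// exprn_ge0.
apply: (@le_trans _ _ (K.+1%:R ^+ 2 * (Z ^+ 2 * s ^+ K))).
  rewrite expr2 -mulrA ler_wpM2l//.
  apply: (le_trans (ler_sum _ (fun j _ => term j))).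
  by rewrite sumr_const card_ord mulr_natl.
have K4 : K.+1%:R ^+ 2 <= 4 ^+ K :> R.
  have K2 : K.+1%:R <= 2 ^+ K :> R by rewrite -natrX ler_nat ltn_expl.
  have -> : 4 = 2 ^+ 2 :> R by ring.
  by rewrite exprAC lerXn2r ?nnegrE// exprn_ge0.
apply: (le_trans (ler_wpM2r sK0 K4)).
have -> : 4 ^+ K * (Z ^+ 2 * s ^+ K)
    = B ^+ 2 * (36 * expR 1 ^+ 2 * s ^+ 3) ^+ K.
  rewrite /Z [(B * _) ^+ 2]exprMn (exprAC _ K 2).
  have -> : 36 * expR 1 ^+ 2 * s ^+ 3 = 4 * (3 * expR 1 * s) ^+ 2 * s by ring.
  by move: ((3 * expR 1 * s) ^+ 2) => X; rewrite 2!exprMn; ring.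
rewrite ler_wpM2l ?sqr_ge0// expRM_natr lerXn2r ?nnegrE ?expR_ge0//.
  by rewrite !mulr_ge0// exprn_ge0// expR_ge0.
have e2 : 2 <= expR 1 :> R by have := expR_ge1Dx (1 : R); lra.
have e6 : 36 <= expR 1 ^+ 6 :> R.
  apply: (@le_trans _ _ (2 ^+ 6)); first by rewrite -natrX ler_nat.
  by rewrite lerXn2r ?nnegrE ?expR_ge0.
have es : s <= expR (s - 1) by have := expR_ge1Dx (s - 1); lra.
have es3 : s ^+ 3 <= expR (s - 1) ^+ 3 by rewrite lerXn2r ?nnegrE ?expR_ge0.
apply: (@le_trans _ _ (expR 1 ^+ 6 * expR 1 ^+ 2 * expR (s - 1) ^+ 3)).
  apply: ler_pM => //; [by rewrite mulr_ge0 ?ler0n ?sqr_ge0|].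
  by rewrite ler_wpM2r ?exprn_ge0 ?expR_ge0.
rewrite -!expRM_natl -!expRD ler_expR; lra.
Qed.
End charlier.

(** * Poisson splitting *)

Lemma measurable_batch (S : nat) (d : measure_display) (T : measurableType d)
    (A : set (batch S)) (F : batch S -> T) : measurable_fun A F.
Proof. by []. Qed.

Section word_counts.
Context {R : realType} {S : nat}.
Variables (Q : prob_vec R S) (p1 p2 : pred 'I_S).
Hypothesis disj : forall x, p1 x -> ~~ p2 x.

Let q1 := \sum_(x | p1 x) Q x.
Let q2 := \sum_(x | p2 x) Q x.
Let q3 := 1 - q1 - q2.

Definition word_weight (k a b : nat) : R :=
  \sum_(t : k.-tuple 'I_S | (count p1 t == a) && (count p2 t == b))
    \prod_(x <- t) Q x.

Let e (z : R) (m : nat) : R := z ^+ m / m`!%:R.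

Let eS z m : m.+1%:R * e z m.+1 = z * e z m.
Proof.
rewrite /e factS natrM exprS.
have [a0 b0] : m.+1%:R != 0 :> R /\ m`!%:R != 0 :> R.
  by rewrite !pnatr_eq0 -!lt0n fact_gt0.
by move: m.+1%:R m`!%:R a0 b0 => a b a0 b0; field; rewrite a0 b0.
Qed.

Let e0 z : e z 0 = 1. Proof. by rewrite /e expr0 divr1. Qed.

Lemma sum_tuple_cons k (F : k.+1.-tuple 'I_S -> R) :
  \sum_t F t = \sum_(x : 'I_S) \sum_(t : k.-tuple 'I_S) F [tuple of x :: t].
Proof.
rewrite pair_big /= (reindex (fun u : 'I_S * k.-tuple 'I_S => [tuple of u.1 :: u.2]))//.
exists (fun t => (thead t, [tuple of behead t])) => [[x t] _|t _] /=.
  by rewrite theadE; congr (_, _); apply: val_inj.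
by rewrite -tuple_eta.
Qed.

(** Condition on whether the first letter satisfies [p1], [p2] or neither. *)
Lemma word_weightS k a b : word_weight k.+1 a b =
  q1 * (if a is a'.+1 then word_weight k a' b else 0)
  + q2 * (if b is b'.+1 then word_weight k a b' else 0)
  + q3 * word_weight k a b.
Proof.
have q3E : q3 = \sum_(x | ~~ p1 x && ~~ p2 x) Q x.
  have h12 : \sum_(x | ~~ p1 x && p2 x) Q x = q2.
    apply: eq_bigl => x; case: (boolP (p2 x)); rewrite ?andbF// andbT.
    by apply: contraL; exact: disj.
  have := prob_vec_sum1 Q; rewrite (bigID p1) /= (bigID p2 (fun x => ~~ p1 x)) /= h12 -/q1.
  by rewrite /q3 => <-; ring.
rewrite /word_weight big_mkcond sum_tuple_cons /=.
transitivity (\sum_x Q x * (\sum_(t : k.-tuple 'I_S)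
   if ((p1 x + count p1 t)%N == a) && ((p2 x + count p2 t)%N == b)
   then \prod_(y <- t) Q y else 0)).
  apply: eq_bigr => x _; rewrite mulr_sumr; apply: eq_bigr => t _.
  by rewrite big_cons; case: ifP => _; rewrite ?mulr0.
rewrite (bigID p1) /= (bigID p2 (fun x => ~~ p1 x)) /= addrA.
congr (_ + _ + _).
- rewrite mulr_suml; apply: eq_bigr => x p1x.
  rewrite p1x (negbTE (disj p1x)); congr (_ * _).
  case: a => [|a]; first by rewrite big1.
  by rewrite [in RHS]big_mkcond; apply: eq_bigr.
- rewrite mulr_suml; apply: eq_big => [x|x /andP[/negbTE np1 p2x]].
    case: (boolP (p2 x)); rewrite ?andbF// andbT.
    by apply: contraL; exact: disj.
  rewrite np1 p2x; congr (_ * _).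
  case: b => [|b]; first by rewrite big1// => t _; rewrite andbF.
  by rewrite [in RHS]big_mkcond; apply: eq_bigr.
- rewrite q3E mulr_suml; apply: eq_bigr => x /andP[/negbTE np1 /negbTE np2].
  rewrite np1 np2; congr (_ * _).
  by rewrite [in RHS]big_mkcond; apply: eq_bigr.
Qed.

(** The trinomial law. With e_m = z^m / m! one has m e_m = z e_(m-1), so the three terms of the
    recursion carry the factors a, b, d, whose sum is k + 1. *)
Lemma word_weightE k a b : word_weight k a b =
  if (a + b <= k)%N then k`!%:R * (e q1 a * e q2 b * e q3 (k - (a + b))) else 0.
Proof.
elim: k a b => [|k IH] a b.
  rewrite /word_weight big_mkcond.
  rewrite (big_pred1 [tuple]) => [/=|t]; last by rewrite [t]tuple0 /= eqxx.
  rewrite big_nil; case: a => [|a]; case: b => [|b] //=.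
  by rewrite !e0 !mulr1.
rewrite word_weightS !IH.
have [abk|kab] := leqP (a + b) k.+1; last first.
  rewrite (_ : (a + b <= k)%N = false) ?mulr0 ?addr0; last by lia.
  case: a kab => [|a] kab; case: b kab => [|b] kab;
    rewrite ?IH ?mulr0 ?addr0 ?add0r//; do 2?[case: ifP => ?; [lia|]];
    by rewrite ?mulr0 ?addr0.
set d := (k.+1 - (a + b))%N.
have kE : k.+1%:R = a%:R + b%:R + d%:R :> R.
  by rewrite -!natrD; congr (_%:R); rewrite /d; lia.
have T1 : q1 * (if a is a'.+1 then
     if (a' + b <= k)%N then k`!%:R * (e q1 a' * e q2 b * e q3 (k - (a' + b))) else 0
     else 0) = k`!%:R * (a%:R * (e q1 a * e q2 b * e q3 d)).
  case: a abk @d kE => [|a] abk d kE; first by rewrite mul0r !mulr0.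
  rewrite ifT; last by lia.
  have -> : (k - (a + b) = d)%N by rewrite /d; lia.
  transitivity (k`!%:R * (q1 * e q1 a * e q2 b * e q3 d)); first by ring.
  by rewrite -eS; ring.
have T2 : q2 * (if b is b'.+1 then
     if (a + b' <= k)%N then k`!%:R * (e q1 a * e q2 b' * e q3 (k - (a + b'))) else 0
     else 0) = k`!%:R * (b%:R * (e q1 a * e q2 b * e q3 d)).
  case: b abk @d kE {T1} => [|b] abk d kE; first by rewrite mul0r !mulr0.
  rewrite ifT; last by lia.
  have -> : (k - (a + b) = d)%N by rewrite /d; lia.
  transitivity (k`!%:R * (e q1 a * (q2 * e q2 b) * e q3 d)); first by ring.
  by rewrite -eS; ring.
have T3 : q3 * (if (a + b <= k)%N then
     k`!%:R * (e q1 a * e q2 b * e q3 (k - (a + b))) else 0)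
     = k`!%:R * (d%:R * (e q1 a * e q2 b * e q3 d)).
  have [abk'|abk'] := leqP (a + b) k; last first.
    by rewrite (_ : d = 0%N) ?mul0r ?mulr0//; rewrite /d; lia.
  have -> : d = (k - (a + b)).+1 by rewrite /d; lia.
  transitivity (k`!%:R * (e q1 a * e q2 b * (q3 * e q3 (k - (a + b))))); first by ring.
  by rewrite -eS; ring.
have -> : (if a is a'.+1 then word_weight k a' b else 0) =
  (if a is a'.+1 then
     if (a' + b <= k)%N then k`!%:R * (e q1 a' * e q2 b * e q3 (k - (a' + b))) else 0
     else 0) by case: (a) => // a'; rewrite IH.
have -> : (if b is b'.+1 then word_weight k a b' else 0) =
  (if b is b'.+1 then
     if (a + b' <= k)%N then k`!%:R * (e q1 a * e q2 b' * e q3 (k - (a + b'))) else 0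
     else 0) by case: (b) => // b'; rewrite IH.
by rewrite T1 T2 T3 factS natrM kE; ring.
Qed.

Variable n : nat.
Hypothesis n_gt0 : (0 < n)%N.

Lemma poisson_prob_set1 k :
  poisson_prob (n%:R : R) 0 [set k] = (poisson_weight n%:R k)%:E.
Proof.
rewrite /poisson_prob ltr0n n_gt0 esum_set1 ?lee_fin ?poisson_pmf_ge0//.
rewrite /poisson_pmf ltr0n n_gt0 /poisson_weight; congr (_%:E); ring.
Qed.

Lemma esum_batch_pmf_size k a b :
  (\esum_(w in [set w : batch S | size w = k /\ (count p1 w = a /\ count p2 w = b)])
     batch_pmf n Q w)%E
  = (poisson_weight n%:R k * word_weight k a b)%:E.
Proof.
pose tw (t : k.-tuple 'I_S) : batch S := t.
pose A := [set t : k.-tuple 'I_S | count p1 t = a /\ count p2 t = b].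
rewrite (@reindex_esum R _ _ A _ tw); last first.
  split => [t [ta tb]|t t' _ _ /val_inj //|w [wk [wa wb]]].
    by rewrite /= size_tuple.
  by exists (Tuple (introT eqP wk)).
rewrite esum_mkcond esum_fset; [|exact: finite_finset|]; last first.
  by move=> t _; case: ifP => // _; exact: batch_pmf_ge0.
rewrite (eq_fsbigr (fun t : k.-tuple 'I_S => (poisson_weight n%:R k *
    (if (count p1 t == a) && (count p2 t == b) then \prod_(x <- t) Q x else 0))%:E)); last first.
  move=> t _; case: ifPn => tA.
    have [-> ->] : A t by rewrite inE in tA.
    by rewrite !eqxx /batch_pmf size_tuple poisson_prob_set1 -EFinM.
  case: ifPn => [/andP[/eqP ta /eqP tb]|_]; last by rewrite mulr0.
  by move: tA; rewrite notin_setE; case.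
rewrite fsumEFin; last exact: finite_finset.
rewrite (fsbigE (index_enum (k.-tuple 'I_S))) ?index_enum_uniq//; last first.
  by move=> t _; rewrite mem_index_enum.
rewrite /word_weight mulr_sumr; congr (_%:E); rewrite [RHS]big_mkcond /=.
apply: eq_big => [t|t _]; first exact: in_setT.
by case: ifP; rewrite ?mulr0.
Qed.

(** Sum the trinomial law over the number c of remaining letters: k! cancels against the Poisson
    weight, e^(-n) splits into three factors, and the third family of weights has total mass 1. *)
Lemma batch_law_counts a b :
  batch_law n Q [set w | count p1 w = a /\ count p2 w = b]
  = (poisson_weight (n%:R * q1) a * poisson_weight (n%:R * q2) b)%:E.
Proof.
have q3_ge0 : 0 <= q3.
  have := prob_vec_sum1 Q; rewrite (bigID p1) /= (bigID p2 (fun x => ~~ p1 x)) /=.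
  have -> : \sum_(x | ~~ p1 x && p2 x) Q x = q2.
    apply: eq_bigl => x; case: (boolP (p2 x)); rewrite ?andbF// andbT.
    by apply: contraL; exact: disj.
  rewrite -/q1 => h.
  have -> : q3 = \sum_(x | ~~ p1 x && ~~ p2 x) Q x by rewrite /q3 -h; ring.
  by apply: sumr_ge0 => x _; exact: prob_vec_ge0.
have setE : [set w : batch S | count p1 w = a /\ count p2 w = b] =
    \bigcup_(k in [set: nat])
      [set w : batch S | size w = k /\ (count p1 w = a /\ count p2 w = b)].
  by apply/seteqP; split => [w ab|w [k _ [_ ab]]//]; exists (size w).
rewrite /batch_law setE esum_bigcupT; last 2 first.
- apply/trivIsetP => i j _ _ /eqP ij; apply/seteqP.
  by split => // w [/= [wi _] [wj _]]; apply: ij; rewrite -wi.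
- by move=> w; exact: batch_pmf_ge0.
under eq_esum do rewrite esum_batch_pmf_size.
have weight_ge0 k : 0 <= poisson_weight (n%:R : R) k * word_weight k a b.
  rewrite mulr_ge0 ?poisson_weight_ge0//; apply: sumr_ge0 => t _.
  by apply: prodr_ge0 => x _; exact: prob_vec_ge0.
rewrite -nneseries_esumT; last by move=> k; rewrite lee_fin.
rewrite (nneseries_split 0 (a + b)); last by move=> k _; rewrite lee_fin.
rewrite big1_seq ?add0e => [|k /andP[_]]; last first.
  rewrite mem_index_iota add0n => /andP[_ kab].
  by rewrite word_weightE leqNgt kab mulr0.
rewrite add0n -nneseries_addn; last by move=> k; rewrite lee_fin.
transitivity (\sum_(c <oo) (poisson_weight (n%:R * q1) a * poisson_weight (n%:R * q2) b)%:E
   * (poisson_weight (n%:R * q3) c * 1)%:E)%E.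
  apply: eq_eseriesr => c _; rewrite -EFinM; congr (_%:E).
  rewrite word_weightE leq_addl addnK /poisson_weight /e.
  have -> : expR (- n%:R) = expR (- (n%:R * q1)) * expR (- (n%:R * q2))
     * expR (- (n%:R * q3)) :> R by rewrite -!expRD; congr expR; rewrite /q3; ring.
  rewrite !exprMn exprD exprD.
  have f0 m : m`!%:R != 0 :> R by rewrite pnatr_eq0 -lt0n fact_gt0.
  by field; rewrite !f0.
rewrite nneseriesZl/=; last first.
  move=> c _; rewrite lee_fin mulr1 poisson_weight_ge0// mulr_ge0//.
rewrite poisson_series_mean ?mulr_ge0//; last exact: exp_bounded_cst.
by rewrite poisson_mean_cst ?mulr_ge0// mule1.
Qed.

Lemma integral_batch_counts (g h : nat -> R) :
  exp_bounded g -> exp_bounded h -> (forall k, 0 <= g k) -> (forall k, 0 <= h k) ->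
  (\int[batch_law n Q]_w (g (count p1 w) * h (count p2 w))%:E)%E
  = (poisson_mean (n%:R * q1) g * poisson_mean (n%:R * q2) h)%:E.
Proof.
move=> bg bh g0 h0.
have l1 : 0 <= n%:R * q1.
  by rewrite mulr_ge0//; apply: sumr_ge0 => x _; exact: prob_vec_ge0.
have l2 : 0 <= n%:R * q2.
  by rewrite mulr_ge0//; apply: sumr_ge0 => x _; exact: prob_vec_ge0.
have mF := @measurable_batch S.
have gh0 (w : batch S) : (0 <= (g (count p1 w) * h (count p2 w))%:E)%E.
  by rewrite lee_fin mulr_ge0.
have T1 : [set: batch S] = \bigcup_a [set w : batch S | count p1 w = a].
  by apply/seteqP; split => // w _; exists (count p1 w).
have T2 a : [set w : batch S | count p1 w = a] =
    \bigcup_b [set w : batch S | count p1 w = a /\ count p2 w = b].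
  apply/seteqP; split => [w wa|w [b _ []]//]; by exists (count p2 w).
rewrite T1 ge0_integral_bigcup//; last first.
  apply/trivIsetP => i j _ _ /eqP ij; apply/seteqP.
  by split => // w [/= wi wj]; apply: ij; rewrite -wi.
transitivity (\sum_(a <oo) (poisson_weight (n%:R * q1) a * g a)%:E
   * (poisson_mean (n%:R * q2) h)%:E)%E.
  apply: eq_eseriesr => a _; rewrite T2 ge0_integral_bigcup//; last first.
    apply/trivIsetP => i j _ _ /eqP ij; apply/seteqP.
    by split => // w [/= [_ wi] [_ wj]]; apply: ij; rewrite -wi.
  rewrite -poisson_series_mean// -nneseriesZl; last first.
    by move=> b _; rewrite lee_fin mulr_ge0// poisson_weight_ge0.
  apply: eq_eseriesr => b _.
  rewrite (eq_integral (cst (g a * h b)%:E)); last first.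
    by move=> w; rewrite inE /= => -[-> ->].
  rewrite integral_cst//.
  by rewrite /= batch_law_counts -!EFinM; congr (_%:E); ring.
under eq_eseriesr do rewrite muleC.
rewrite nneseriesZl; last first.
  by move=> a _; rewrite lee_fin mulr_ge0// poisson_weight_ge0.
by rewrite poisson_series_mean// -EFinM mulrC.
Qed.

End word_counts.

(** * Second moments of sums over the alphabet *)

Section independent_counts.
Context {R : realType} {S : nat}.
Variables (Q : prob_vec R S) (n : nat).
Hypothesis n_gt0 : (0 < n)%N.

Local Notation mu := (batch_law n Q).
Local Notation mean i := (poisson_mean (n%:R * Q i)).
Local Notation cnt i w := (count_mem i w).

Lemma rate_ge0 i : 0 <= n%:R * Q i :> R.
Proof. by rewrite mulr_ge0// prob_vec_ge0. Qed.

Lemma integral_count (i : 'I_S) (g : nat -> R) : exp_bounded g -> (forall k, 0 <= g k) ->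
  (\int[mu]_w (g (cnt i w))%:E)%E = (mean i g)%:E.
Proof.
move=> bg g0.
have := @integral_batch_counts R S Q (pred1 i) pred0 (fun _ _ => isT) n n_gt0 g
  (fun=> 1) bg (exp_bounded_cst 1) g0 (fun=> ler01).
rewrite big_pred1_eq big_pred0_eq mulr0 poisson_mean_cst// mulr1 => <-.
by apply: eq_integral => w _; rewrite mulr1.
Qed.

Lemma integral_count2 (i j : 'I_S) (g h : nat -> R) : i != j ->
  exp_bounded g -> exp_bounded h -> (forall k, 0 <= g k) -> (forall k, 0 <= h k) ->
  (\int[mu]_w (g (cnt i w) * h (cnt j w))%:E)%E = (mean i g * mean j h)%:E.
Proof.
move=> ij bg bh g0 h0.
have disj x : pred1 i x -> ~~ pred1 j x by move=> /eqP ->.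
by rewrite (integral_batch_counts Q disj)// !big_pred1_eq.
Qed.

Lemma integral_diff (f1 f2 f : batch S -> R) (r1 r2 r : R) :
  (forall w, 0 <= f1 w) -> (forall w, 0 <= f2 w) ->
  (\int[mu]_w (f1 w)%:E)%E = r1%:E -> (\int[mu]_w (f2 w)%:E)%E = r2%:E ->
  (forall w, f w = f1 w - f2 w) -> r = r1 - r2 ->
  mu.-integrable setT (fun w => (f w)%:E) /\ (\int[mu]_w (f w)%:E)%E = r%:E.
Proof.
move=> f10 f20 I1 I2 /funext -> ->.
have int (f0 : batch S -> R) r0 : (forall w, 0 <= f0 w) ->
    (\int[mu]_w (f0 w)%:E)%E = r0%:E -> mu.-integrable setT (fun w => (f0 w)%:E).
  move=> f00 fr; apply/integrableP; split; first by [].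
  by under eq_integral do rewrite gee0_abs ?lee_fin//; rewrite fr ltry.
have [J1 J2] := (int _ _ f10 I1, int _ _ f20 I2).
split; first exact: (integrableB measurableT J1 J2).
by rewrite EFinB -I1 -I2 -integralB.
Qed.

Variable xi : 'I_S -> nat -> R.
Hypothesis bxi : forall i, exp_bounded (xi i).

Let cov i j : R := if i == j then mean i (fun k => xi i k ^+ 2)
                   else mean i (xi i) * mean j (xi j).

(* Adding exponential dominators writes the product of two signed functions as
   a difference of integrable nonnegative ones. *)
Lemma integral_cross i j :
  mu.-integrable setT (fun w => (xi i (cnt i w) * xi j (cnt j w))%:E) /\
  (\int[mu]_w (xi i (cnt i w) * xi j (cnt j w))%:E)%E = (cov i j)%:E.
Proof.
rewrite /cov; case: eqVneq => [<-{j}|ij].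
  apply: (@integral_diff (fun w => xi i (cnt i w) ^+ 2) (fun=> 0) _
    (mean i (fun k => xi i k ^+ 2)) 0) => //.
  - by move=> w; exact: sqr_ge0.
  - apply: (@integral_count i (fun k => xi i k ^+ 2)) => [|k]; last exact: sqr_ge0.
    exact: exp_bounded_sqr.
  - exact: integral0.
  - by move=> w; rewrite subr0 expr2.
  - by rewrite subr0.
have dom l : exists m : nat -> R,
    [/\ exp_bounded m, forall k, 0 <= m k & forall k, 0 <= xi l k + m k].
  have [a [b [a0 b1 xab]]] := bxi l; have b0 := le_trans ler01 b1.
  exists (fun k => a * b ^+ k); split.
  - by apply: exp_boundedM; [exact: exp_bounded_cst|exact: exp_bounded_expr].
  - by move=> k; rewrite mulr_ge0// exprn_ge0.
  - by move=> k; have := xab k; rewrite ler_norml; lra.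
have [m [bm m0 g0]] := dom i; have [m' [bm' m'0 g'0]] := dom j.
have bg := exp_boundedD (bxi i) bm; have bg' := exp_boundedD (bxi j) bm'.
pose g k := xi i k + m k; pose g' k := xi j k + m' k.
have {}g0 k : 0 <= g k by exact: g0.
have {}g'0 k : 0 <= g' k by exact: g'0.
have {}bg : exp_bounded g by exact: bg.
have {}bg' : exp_bounded g' by exact: bg'.
have add_int (f1 f2 : batch S -> R) (r1 r2 : R) :
    (forall w, 0 <= f1 w) -> (forall w, 0 <= f2 w) ->
    (\int[mu]_w (f1 w)%:E)%E = r1%:E -> (\int[mu]_w (f2 w)%:E)%E = r2%:E ->
    (\int[mu]_w (f1 w + f2 w)%:E)%E = (r1 + r2)%:E.
  move=> f10 f20 I1 I2.
  by rewrite EFinD -I1 -I2 -ge0_integralD//; move=> w _; rewrite lee_fin.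
apply: (@integral_diff
  (fun w => g (cnt i w) * g' (cnt j w) + m (cnt i w) * m' (cnt j w))
  (fun w => g (cnt i w) * m' (cnt j w) + m (cnt i w) * g' (cnt j w))
  (fun w => xi i (cnt i w) * xi j (cnt j w))
  (mean i g * mean j g' + mean i m * mean j m')
  (mean i g * mean j m' + mean i m * mean j g') (mean i (xi i) * mean j (xi j))).
- by move=> w; rewrite addr_ge0// mulr_ge0.
- by move=> w; rewrite addr_ge0// mulr_ge0.
- by apply: (add_int) => [w|w||]; rewrite ?mulr_ge0//; exact: integral_count2.
- by apply: (add_int) => [w|w||]; rewrite ?mulr_ge0//; exact: integral_count2.
- by move=> w; rewrite /g /g'; ring.
- by rewrite /g /g' !poisson_meanD ?rate_ge0//; ring.
Qed.

Lemma integral_sqr_sum_le :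
  (\int[mu]_w ((\sum_i xi i (cnt i w)) ^+ 2)%:E
   <= ((\sum_i `|mean i (xi i)|) ^+ 2 + \sum_i mean i (fun k => xi i k ^+ 2))%:E)%E.
Proof.
have -> : (\int[mu]_w ((\sum_i xi i (cnt i w)) ^+ 2)%:E)%E
    = (\sum_i \sum_j cov i j)%:E.
  transitivity (\int[mu]_w (\sum_i \sum_j (xi i (cnt i w) * xi j (cnt j w))%:E))%E.
    apply: eq_integral => w _; rewrite expr2 mulr_suml -sumEFin.
    by apply: eq_bigr => i _; rewrite mulr_sumr -sumEFin.
  rewrite integral_sum//; last first.
    by move=> i; apply: integrable_sum => // j _; have [] := integral_cross i j.
  rewrite -sumEFin; apply: eq_bigr => i _.
  rewrite integral_sum//; last by move=> j; have [] := integral_cross i j.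
  by rewrite -sumEFin; apply: eq_bigr => j _; have [_ ->] := integral_cross i j.
rewrite lee_fin expr2 mulr_suml -big_split /=; apply: ler_sum => i _.
rewrite (bigD1 i)//= {1}/cov eqxx addrC.
have mi0 : 0 <= `|mean i (xi i)| * `|mean i (xi i)| by [].
rewrite lerD2r mulr_sumr [leRHS](bigD1 i)//= -[leLHS]add0r lerD//.
apply: ler_sum => j ji; rewrite /cov eq_sym (negbTE ji) -normrM; exact: ler_norm.
Qed.

End independent_counts.

(** Singletons are measurable rectangles and the space is countable; the measurability of the
    estimator follows at once. *)
Lemma countable_prod_measurable (S : nat) (A : set (batch S * batch S)) :
  measurable A.
Proof.
apply: countable_measurable; last exact: countableP.
move=> x; rewrite (_ : [set x] = [set x.1] `*` [set x.2]); first exact: measurableX.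
apply/seteqP; split => [y ->//|y [/= y1 y2]].
by rewrite (surjective_pairing y) y1 y2 -surjective_pairing.
Qed.

Section two_batches.
Context {R : realType} {S : nat}.
Variables (Q : prob_vec R S) (n : nat).
Hypothesis n_gt0 : (0 < n)%N.

Local Notation mean i := (poisson_mean (n%:R * Q i)).

(** [integral_sqr_sum_le] is used for the second batch with the first fixed, then for the
    conditional biases [B] as functions of the first. As B^2 <= V, the second application adds the
    sum of second moments once more, whence the factor 2. The uniform bounds make [B] and [V]
    admissible integrands. *)
Lemma integral_sampling_le (f : batch S * batch S -> R) (xi : 'I_S -> nat -> nat -> R) :
  (forall i a, exp_bounded (xi i a)) ->
  (forall i, exists M, forall a, `|mean i (xi i a)| <= M) ->
  (forall i, exists M, forall a, mean i (fun b => xi i a b ^+ 2) <= M) ->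
  (forall w, 0 <= f w <= (\sum_i xi i (count_mem i w.1) (count_mem i w.2)) ^+ 2) ->
  ('E_(sampling n Q)[f]
   <= ((\sum_i mean i (fun a => `|mean i (xi i a)|)) ^+ 2
       + 2 * \sum_i mean i (fun a => mean i (fun b => xi i a b ^+ 2)))%:E)%E.
Proof.
move=> bxi bM bV fle.
have r0 i := rate_ge0 Q n i.
have msq_ge0 i a : 0 <= mean i (fun b => xi i a b ^+ 2).
  apply: poisson_mean_ge0 => // [|b]; last exact: sqr_ge0.
  exact: exp_bounded_sqr.
pose B i a := `|mean i (xi i a)|.
pose V i a := mean i (fun b => xi i a b ^+ 2).
have bB i : exp_bounded (B i).
  by have [M MP] := bM i; apply: (@exp_bounded_bounded _ M) => a; rewrite /B normr_id.
have bVi i : exp_bounded (V i).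
  have [M MP] := bV i; apply: (@exp_bounded_bounded _ M) => a.
  by rewrite ger0_norm; [exact: MP|exact: msq_ge0].
have BV i a : B i a ^+ 2 <= V i a.
  by rewrite /B /V real_normK ?num_real//; exact: poisson_mean_sqr_le.
rewrite unlock fubini_tonelli1; last 2 first.
- by move=> _ Y _; exact: countable_prod_measurable.
- by move=> w; rewrite lee_fin; have /andP[] := fle w.
apply: (@le_trans _ _ (\int[batch_law n Q]_w
    ((\sum_i B i (count_mem i w)) ^+ 2 + \sum_i V i (count_mem i w))%:E)%E).
  apply: ge0_le_integral => //.
  - move=> w _; apply: integral_ge0 => w' _; rewrite /= lee_fin.
    by have /andP[] := fle (w, w').
  move=> w _; rewrite /fubini_F.
  apply: (le_trans _ (integral_sqr_sum_le Q n_gt0 (fun i => bxi i (count_mem i w)))).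
  apply: ge0_le_integral => //.
  - by move=> w' _; rewrite lee_fin; have /andP[] := fle (w, w').
  - by move=> w' _; rewrite lee_fin; have /andP[] := fle (w, w').
under eq_integral do rewrite EFinD.
rewrite ge0_integralD//; last 2 first.
- by move=> w _; rewrite lee_fin sqr_ge0.
- by move=> w _; rewrite lee_fin sumr_ge0// => i _; exact: msq_ge0.
set X := \sum_i mean i (fun a => `|_|); set Y := \sum_i mean i _.
have -> : (X ^+ 2 + 2 * Y)%:E = ((X ^+ 2 + Y)%:E + Y%:E)%E.
  by rewrite -EFinD; congr (_%:E); ring.
apply: leeD.
  apply: (le_trans (integral_sqr_sum_le Q n_gt0 bB)); rewrite lee_fin lerD//.
    rewrite le_eqVlt; apply/orP; left; apply/eqP; congr (_ ^+ 2).
    apply: eq_bigr => i _; rewrite ger0_norm// poisson_mean_ge0// => a.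
    exact: normr_ge0.
  apply: ler_sum => i _; apply: poisson_mean_le;
    [exact: r0|exact: exp_bounded_sqr (bB i)|exact: bVi|exact: BV].
under eq_integral do rewrite -sumEFin.
rewrite ge0_integral_sum//; last by move=> i w _; rewrite lee_fin; exact: msq_ge0.
rewrite -sumEFin; apply: lee_sum => i _.
rewrite (integral_count Q n_gt0 i (bVi i))// => k; exact: msq_ge0.
Qed.

End two_batches.

(** * Risk of one symbol *)

Section local_risk.
Context {R : realType}.
Variables (eps p q c1 c2 : R) (n K : nat).
Hypotheses (p_ge0 : 0 <= p) (p_le1 : p <= 1) (q_ge0 : 0 <= q) (n_ge2 : (2 <= n)%N).
Hypothesis K_le : K%:R <= ln (n%:R : R).
Hypotheses (c1_ge : 1024 <= c1) (c2E : c2 = c1 / 4).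

Local Notation E := (expR eps).
Local Notation L := (ln (n%:R : R)).
Local Notation m := (center eps n c1 p).
Local Notation w := (halfwidth eps n c1 p).
Local Notation small := (p <= c1 * expR eps * ln n%:R / n%:R).
Local Notation D := (best_approx eps n c1 K p).
Local Notation f := (ramp eps p q).
Local Notation lam := (n%:R * q).
Local Notation mean := (poisson_mean lam).
Local Notation B := (2 * Num.min p (Num.sqrt (c1 * E * p * L / n%:R))).

Let c1_gt0 : 0 < c1. Proof. by apply: lt_le_trans c1_ge; rewrite ltr0n. Qed.
Let n_gt0 : 0 < n%:R :> R. Proof. exact: nat_gt0. Qed.
Let L_gt0 : 0 < L. Proof. exact: ln_nat_gt0. Qed.
Let E_gt0 : 0 < E. Proof. exact: expR_gt0. Qed.
Let w_gt0 : 0 < w. Proof. exact: halfwidth_gt0. Qed.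
Let m_gt0 : 0 < m. Proof. exact: center_gt0. Qed.
Let w_le_m : w <= m. Proof. exact: halfwidth_le. Qed.
Let lam_ge0 : 0 <= lam. Proof. by rewrite mulr_ge0// ltW. Qed.
Let f_ge0 : 0 <= f. Proof. exact: ramp_ge0. Qed.
Let f_le : f <= p. Proof. exact: ramp_le. Qed.

Lemma ln_nat_ge_half : 2^-1 <= L.
Proof.
have n2 : 2 <= n%:R :> R by rewrite ler_nat.
have := expR_ge1Dx (- L); rewrite expRN lnK ?posrE// => h.
have : n%:R^-1 <= 2^-1 :> R by rewrite lef_pV2 ?posrE.
by lra.
Qed.

Let c2_ge0 : 0 <= c2. Proof. by rewrite c2E divr_ge0// ltW. Qed.

(** For large p the selection window has half the width of the approximation window; the margin w /
    2 feeds the Chernoff bounds. *)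
Lemma sqrt_ratio : Num.sqrt (c2 / c1) = 2^-1.
Proof.
have -> : c2 / c1 = 2^-1 ^+ 2 by rewrite c2E; field; rewrite gt_eqF.
by rewrite sqrtr_sqr ger0_norm.
Qed.

(** For small p the endpoint is 5 m / 4 = m + w / 4, for large p it is m + w / 2. *)
Lemma U_right_le : U_right eps n c1 c2 p <= m + w / 2.
Proof.
rewrite /U_right; case: ifPn => [sm|la].
  rewrite halfwidth_small// center_small//.
  have := base_gt0 c1_gt0 n_ge2; have -> : (c1 + c2) * L / n%:R
    = c1 * L / n%:R + (c1 * L / n%:R) / 4 by rewrite c2E; field; rewrite gt_eqF.
  by lra.
by rewrite (sqrt_window_large c1_gt0 n_ge2 c2_ge0 la) sqrt_ratio expRNE center_large// [_^-1 * _]mulrC.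
Qed.

Lemma U_right_ge : m + w / 4 <= U_right eps n c1 c2 p.
Proof.
rewrite /U_right; case: ifPn => [sm|la].
  rewrite halfwidth_small// center_small//.
  have -> : (c1 + c2) * L / n%:R
    = c1 * L / n%:R + (c1 * L / n%:R) / 4 by rewrite c2E; field; rewrite gt_eqF.
  by [].
rewrite (sqrt_window_large c1_gt0 n_ge2 c2_ge0 la) sqrt_ratio expRNE center_large//.
by rewrite lerD2l; move: w_gt0; lra.
Qed.

Lemma U_left_small : small -> U_left eps n c1 c2 p = 0.
Proof. by rewrite /U_left => ->. Qed.

Lemma U_left_large : ~~ small -> U_left eps n c1 c2 p = m - w / 2.
Proof.
move=> la; rewrite /U_left (negbTE la) (sqrt_window_large c1_gt0 n_ge2 c2_ge0 la) sqrt_ratio.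
by rewrite expRNE center_large// [_^-1 * _]mulrC.
Qed.

Lemma nsqr_w : n%:R * w ^+ 2 = m * (c1 * L).
Proof. by rewrite sqr_halfwidth//; field; rewrite gt_eqF. Qed.

Definition local_error (a b : nat) : R :=
  local_estimator eps n c1 c2 K p (a%:R / n%:R) (b%:R / n%:R) - f.

Definition above_window (a : nat) : bool := U_right eps n c1 c2 p < a%:R / n%:R.
Definition below_window (a : nat) : bool := ~~ above_window a && (a%:R / n%:R < U_left eps n c1 c2 p).
Definition in_window (a : nat) : bool := ~~ above_window a && ~~ below_window a.

Definition plug_in (b : nat) : R := ramp eps p (b%:R / n%:R).
Definition poly_est (b : nat) : R := falling_eval n K.+1 D (b%:R / n%:R).

Lemma local_errorE a b : local_error a b =
  if above_window a then - f else if below_window a then plug_in b - f else poly_est b - f.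
Proof.
rewrite /local_error /local_estimator /below_window -/(above_window a) /plug_in /poly_est.
by case: ifP => hi /=; [rewrite sub0r|case: ifP].
Qed.

Lemma plug_bounded : exp_bounded plug_in.
Proof.
apply: (@exp_bounded_bounded _ p) => b.
by rewrite ger0_norm ?ramp_ge0// ramp_le// divr_ge0.
Qed.

Lemma poly_est_bounded : exp_bounded poly_est.
Proof. exact: falling_eval_exp_bounded. Qed.

Lemma local_error_bounded a : exp_bounded (local_error a).
Proof.
rewrite (_ : local_error a = fun b => if above_window a then - f else
   if below_window a then plug_in b - f else poly_est b - f); last first.
  by apply/funext => b; exact: local_errorE.
case: (above_window a); first exact: exp_bounded_cst.
by case: (below_window a); apply: exp_boundedB; [exact: plug_bounded|
  exact: exp_bounded_cst|exact: poly_est_bounded|exact: exp_bounded_cst].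
Qed.

Let bL := `|mean plug_in - f|.
Let bM := `|D.[q] - f|.
Let vL := mean (fun b => (plug_in b - f) ^+ 2).
Let vM := mean (fun b => (poly_est b - f) ^+ 2).

Lemma mean_poly_est : mean poly_est = D.[q].
Proof.
apply: poisson_mean_falling_eval => //; first by rewrite (leq_trans _ n_ge2).
exact: size_best_approx.
Qed.

Lemma abs_mean_local_error a : `|mean (local_error a)| =
  if above_window a then f else if below_window a then bL else bM.
Proof.
rewrite (eq_poisson_mean _ (local_errorE a)).
case: (above_window a); first by rewrite poisson_mean_cst// normrN ger0_norm.
case: (below_window a); rewrite poisson_meanB ?poisson_mean_cst ?mean_poly_est//;
  by [exact: plug_bounded|exact: exp_bounded_cst|exact: poly_est_bounded].
Qed.

Lemma mean_sqr_local_error a : mean (fun b => local_error a b ^+ 2) =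
  if above_window a then f ^+ 2 else if below_window a then vL else vM.
Proof.
transitivity (mean (fun b => (if above_window a then - f else if below_window a then plug_in b - f
   else poly_est b - f) ^+ 2)).
  by apply: eq_poisson_mean => b; rewrite local_errorE.
case: (above_window a); first by rewrite poisson_mean_cst// sqrrN.
by case: (below_window a).
Qed.

Let Ph := mean (fun a => (above_window a)%:R).
Let Pl := mean (fun a => (below_window a)%:R).
Let Pm := mean (fun a => (in_window a)%:R).

Lemma ind_bounded (T : nat -> bool) : exp_bounded (fun a => (T a)%:R : R).
Proof.
by apply: (@exp_bounded_bounded _ 1) => a; case: (T a); rewrite ?normr1 ?normr0.
Qed.

Lemma mean_ind_le (T T' : nat -> bool) : (forall a, T a -> T' a) ->
  mean (fun a => (T a)%:R) <= mean (fun a => (T' a)%:R).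
Proof.
move=> TT'; apply: poisson_mean_le => //; [exact: ind_bounded|exact: ind_bounded|].
move=> a; rewrite ler_nat; have := TT' a.
by case: (T a) => //; case: (T' a) => // /(_ isT).
Qed.

Lemma mean_ind_ge0 (T : nat -> bool) : 0 <= mean (fun a => (T a)%:R).
Proof. by apply: poisson_mean_ge0 => //; exact: ind_bounded. Qed.

Lemma mean_ind_le1 (T : nat -> bool) : mean (fun a => (T a)%:R) <= 1.
Proof.
rewrite -[leRHS](poisson_mean_cst lam_ge0 1); apply: poisson_mean_le => //.
- exact: ind_bounded.
- exact: exp_bounded_cst.
by move=> a; rewrite lern1; case: (T a).
Qed.

Lemma mean_ind0 (T : nat -> bool) : (forall a, ~~ T a) -> mean (fun a => (T a)%:R) = 0.
Proof.
move=> T0; rewrite (@eq_poisson_mean _ _ _ (fun=> 0)) ?poisson_mean_cst// => a.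
by rewrite (negbTE (T0 a)).
Qed.

Lemma mean_split (x y z : R) :
  mean (fun a => if above_window a then x else if below_window a then y else z)
  = Ph * x + Pl * y + Pm * z.
Proof.
have bi (T : nat -> bool) (c : R) : exp_bounded (fun a : nat => c * (T a)%:R : R).
  by apply: exp_boundedM; [exact: exp_bounded_cst|exact: ind_bounded].
transitivity (mean (fun a => (x * (above_window a)%:R + y * (below_window a)%:R) + z * (in_window a)%:R)).
  apply: eq_poisson_mean => a; rewrite /in_window /below_window.
  by case: (above_window a) => /=; [|case: (_ < _)] => /=; rewrite ?mulr1 ?mulr0 ?addr0 ?add0r.
rewrite poisson_meanD//; last exact: exp_boundedD.
rewrite poisson_meanD// !poisson_meanZ//; try exact: ind_bounded.
by rewrite /Ph /Pl /Pm; ring.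
Qed.

(** * Probabilities of the three branches *)

Local Notation t := (expR (- (4 * L))).

Lemma ind_upper_tail (T : nat -> bool) (mu d x : R) : 0 < mu -> lam <= mu ->
  0 <= d <= 2 * mu -> (forall a, T a -> lam + d <= a%:R) ->
  8 * mu * x <= d ^+ 2 ->
  mean (fun a => (T a)%:R) <= expR (- x).
Proof.
move=> mu0 lmu dmu Td xd.
apply: (le_trans (@mean_ind_le T (fun a => lam + d <= a%:R) Td)).
apply: (le_trans (poisson_chernoff_upper lam_ge0 mu0 lmu dmu)).
by rewrite ler_expR lerN2 ler_pdivlMr ?mulr_gt0// mulrC.
Qed.

Lemma ind_lower_tail (T : nat -> bool) (mu d x : R) : 0 < mu -> lam <= mu ->
  0 <= d -> (forall a, T a -> a%:R <= lam - d) ->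
  8 * mu * x <= d ^+ 2 ->
  mean (fun a => (T a)%:R) <= expR (- x).
Proof.
move=> mu0 lmu d0 Td xd.
apply: (le_trans (@mean_ind_le T (fun a => a%:R <= lam - d) Td)).
apply: (le_trans (poisson_chernoff_lower lam_ge0 mu0 lmu d0)).
by rewrite ler_expR lerN2 ler_pdivlMr ?mulr_gt0// mulrC.
Qed.

Let nmL_gt0 : 0 < n%:R * m * L.
Proof. by rewrite !mulr_gt0. Qed.

Let nmL_c1 : n%:R * m * L * 1024 <= n%:R * m * L * c1.
Proof. by rewrite ler_pM2l. Qed.

(** With d = n w / 4, mu = n m, x = 8 L and n w^2 = c1 m L, the condition 8 mu x <= d^2 reads 64 <=
    c1 / 16. This is the origin of 1024; [lo_tail] and [not_hi_tail] lead to the same value. *)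
Lemma above_center_tail (T : nat -> bool) : q <= m - w / 4 ->
  (forall a, T a -> m <= a%:R / n%:R) -> mean (fun a => (T a)%:R) <= expR (- (8 * L)).
Proof.
move=> qm Ta; apply: (@ind_upper_tail _ (n%:R * m) (n%:R * (w / 4))).
- by rewrite mulr_gt0.
- by rewrite ler_pM2l//; move: w_gt0; lra.
- rewrite mulr_ge0 ?divr_ge0 ?(ltW n_gt0) ?(ltW w_gt0)//.
  by rewrite /= [leRHS]mulrCA ler_pM2l//; move: w_gt0 w_le_m; lra.
- move=> a /Ta; rewrite ler_pdivlMr// => h.
  by rewrite -mulrDr (le_trans _ h)// mulrC ler_pM2r//; lra.
have -> : (n%:R * (w / 4)) ^+ 2 = n%:R * (n%:R * w ^+ 2) / 16 by field.
by rewrite nsqr_w; have := nmL_c1; lra.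
Qed.

Lemma hi_tail : q <= m -> Ph <= t.
Proof.
move=> qm; apply: (@ind_upper_tail _ (n%:R * m) (n%:R * (w / 4))).
- by rewrite mulr_gt0.
- by rewrite ler_pM2l.
- rewrite mulr_ge0 ?divr_ge0 ?(ltW n_gt0) ?(ltW w_gt0)//.
  by rewrite /= [leRHS]mulrCA ler_pM2l//; move: w_gt0 w_le_m; lra.
- move=> a; rewrite /above_window => /(le_lt_trans U_right_ge); rewrite ltr_pdivlMr// => h.
  rewrite -mulrDr (le_trans _ (ltW h))// mulrC ler_pM2r//; lra.
have -> : (n%:R * (w / 4)) ^+ 2 = n%:R * (n%:R * w ^+ 2) / 16 by field.
by rewrite nsqr_w; have := nmL_c1; have := nmL_gt0; lra.
Qed.

Lemma lo_tail : ~~ small -> m - w / 4 <= q -> q <= m + w -> Pl <= t.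
Proof.
move=> la mq qm; apply: (@ind_lower_tail _ (n%:R * (2 * m)) (n%:R * (w / 4))).
- by rewrite !mulr_gt0.
- by rewrite ler_pM2l//; move: w_le_m; lra.
- by rewrite mulr_ge0 ?divr_ge0 ?(ltW n_gt0) ?(ltW w_gt0).
- move=> a; rewrite /below_window U_left_large// => /andP[_]; rewrite ltr_pdivrMr// => /ltW h.
  by rewrite -mulrBr (le_trans h)// mulrC ler_pM2l//; lra.
have -> : (n%:R * (w / 4)) ^+ 2 = n%:R * (n%:R * w ^+ 2) / 16 by field.
by rewrite nsqr_w; have := nmL_c1; have := nmL_gt0; lra.
Qed.

(** q exceeds the endpoint by at least s w / 2. The Poisson variance n q is at most 2 s n m, so one
    power of s cancels and the exponent is linear in s. *)
Lemma not_hi_tail (T : nat -> bool) s : 1 <= s -> q = m + s * w ->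
  (forall a, T a -> ~~ above_window a) -> mean (fun a => (T a)%:R) <= expR (- (16 * s * L)).
Proof.
move=> s1 qE Ta.
have s0 : 0 < s by exact: lt_le_trans s1.
have q0 : 0 < q by rewrite qE addr_gt0// mulr_gt0.
apply: (@ind_lower_tail _ lam (n%:R * (s * w / 2))).
- by rewrite mulr_gt0.
- by [].
- by rewrite mulr_ge0 ?divr_ge0 ?mulr_ge0 ?(ltW n_gt0) ?(ltW s0) ?(ltW w_gt0).
- move=> a /Ta; rewrite /above_window -leNgt => /le_trans /(_ U_right_le).
  rewrite ler_pdivrMr// => h; rewrite -mulrBr (le_trans h)// mulrC ler_pM2l// qE.
  have wsw : w <= s * w by rewrite ler_pMl.
  by lra.
have -> : (n%:R * (s * w / 2)) ^+ 2 = n%:R * (s ^+ 2 * (n%:R * w ^+ 2)) / 4 by field.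
rewrite nsqr_w.
have -> : 8 * lam * (16 * s * L) = n%:R * (s * (q * (128 * L))) by ring.
rewrite -mulrA ler_pM2l//.
apply: (@le_trans _ _ (s * (s * m * (256 * L)))); last first.
  have : 0 < s * (s * m * L) by rewrite !mulr_gt0.
  by move=> /ltW h0; have := ler_wpM2l h0 c1_ge; lra.
rewrite ler_pM2l// (_ : s * m * (256 * L) = (2 * (s * m)) * (128 * L)); last by ring.
rewrite ler_pM2r ?mulr_gt0// qE.
have : m <= s * m by rewrite ler_pMl.
have : s * w <= s * m by rewrite ler_pM2l.
lra.
Qed.

Lemma not_lo_tail (T : nat -> bool) s : ~~ small -> 1 <= s -> q = m - s * w ->
  (forall a, T a -> ~~ below_window a) -> mean (fun a => (T a)%:R) <= expR (- (16 * s * L)).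
Proof.
move=> la s1 qE Ta.
have s0 : 0 < s by exact: lt_le_trans s1.
have sw0 : 0 < s * w by exact: mulr_gt0.
(* Since q >= 0, the deviation stays in the range of the upper Chernoff bound. *)
have swm : s * w <= m by move: q_ge0; rewrite qE; lra.
have wsw : w <= s * w by rewrite ler_pMl.
apply: (@ind_upper_tail _ (n%:R * m) (n%:R * (s * w / 2))).
- by rewrite mulr_gt0.
- by rewrite ler_pM2l//; lra.
- rewrite mulr_ge0 ?divr_ge0 ?(ltW n_gt0) ?(ltW sw0)//.
  by rewrite /= [leRHS]mulrCA ler_pM2l//; lra.
- move=> a /Ta; rewrite /below_window negb_and negbK -leNgt U_left_large// => aT.
  have h : m - w / 2 <= a%:R / n%:R.
    case/orP: aT => //; rewrite /above_window => /ltW; apply: le_trans.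
    by apply: le_trans U_right_ge; move: w_gt0; lra.
  move: h; rewrite ler_pdivlMr// => h.
  by rewrite -mulrDr (le_trans _ h)// mulrC ler_pM2r//; lra.
have -> : (n%:R * (s * w / 2)) ^+ 2 = n%:R * (s ^+ 2 * (n%:R * w ^+ 2)) / 4 by field.
rewrite nsqr_w.
have -> : 8 * (n%:R * m) * (16 * s * L) = (n%:R * m * L * s) * 128 by ring.
have -> : n%:R * (s ^+ 2 * (m * (c1 * L))) / 4 = (n%:R * m * L * s) * (c1 / 4 * s) by field.
have h256 : 256 <= c1 / 4 by rewrite ler_pdivlMr//; move: c1_ge; lra.
have h256s : 256 * s <= c1 / 4 * s by rewrite ler_pM2r.
rewrite ler_pM2l ?mulr_gt0//; lra.
Qed.

Let n_pos : (0 < n)%N. Proof. exact: leq_trans n_ge2. Qed.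

(** * Plug-in branch *)

Lemma mean_sqr_freq_dev : mean (fun b => (b%:R / n%:R - q) ^+ 2) = q / n%:R.
Proof.
rewrite (@eq_poisson_mean _ _ _ (fun b => (n%:R ^+ 2)^-1 * charlier n q 1 b ^+ 2)).
  rewrite poisson_meanZ//; last exact: exp_bounded_sqr (charlier_exp_bounded _ _ _).
  by rewrite poisson_mean_sqr_charlier// mul1r expr1; field; rewrite gt_eqF.
by move=> b; rewrite charlierS !charlier0; field; rewrite gt_eqF.
Qed.

Let freq_bounded : exp_bounded (fun b => b%:R / n%:R : R).
Proof. by apply: exp_boundedM; [exact: exp_bounded_nat|exact: exp_bounded_cst]. Qed.

Let dev_bounded : exp_bounded (fun b => (b%:R / n%:R - q) ^+ 2 : R).
Proof. by apply/exp_bounded_sqr/exp_boundedB => //; exact: exp_bounded_cst. Qed.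

Let plug_dev_bounded : exp_bounded (fun b => (plug_in b - f) ^+ 2).
Proof.
apply/exp_bounded_sqr/exp_boundedB; [exact: plug_bounded|exact: exp_bounded_cst].
Qed.

Let poly_dev_bounded : exp_bounded (fun b => (poly_est b - f) ^+ 2).
Proof.
apply/exp_bounded_sqr/exp_boundedB; [exact: poly_est_bounded|exact: exp_bounded_cst].
Qed.

Lemma plug_var : vL <= E ^+ 2 * (q / n%:R).
Proof.
rewrite -mean_sqr_freq_dev -poisson_meanZ//; apply: poisson_mean_le => //.
  by apply: exp_boundedM => //; exact: exp_bounded_cst.
move=> b; rewrite -exprMn -(real_normK (num_real (plug_in b - f))).
rewrite -[leRHS]real_normK ?num_real// lerXn2r ?nnegrE//.
by rewrite normrM (gtr0_norm E_gt0) ramp_lipschitz.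
Qed.

Lemma plug_var_le : vL <= p ^+ 2.
Proof.
rewrite -(poisson_mean_cst lam_ge0 (p ^+ 2)); apply: poisson_mean_le => //.
  exact: exp_bounded_cst.
move=> b; rewrite -real_normK ?num_real// lerXn2r ?nnegrE//.
rewrite ler_norml; move: f_ge0 f_le (ramp_ge0 eps p (b%:R / n%:R)).
have : plug_in b <= p by apply: ramp_le => //; rewrite divr_ge0.
by rewrite /plug_in; lra.
Qed.

Lemma plug_bias_le : bL <= p.
Proof.
have h1 : 0 <= mean plug_in.
  by apply: poisson_mean_ge0 => //; [exact: plug_bounded|move=> b; exact: ramp_ge0].
have h2 : mean plug_in <= p.
  rewrite -(poisson_mean_cst lam_ge0 p); apply: poisson_mean_le => //.
  - exact: plug_bounded.
  - exact: exp_bounded_cst.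
  - by move=> b; apply: ramp_le => //; rewrite divr_ge0.
by rewrite /bL ler_norml; move: f_ge0 f_le; lra.
Qed.

Lemma inv_n_le_center : n%:R^-1 <= m.
Proof.
apply: le_trans (center_ge eps c1 p n); rewrite ler_pdivlMr// mulVf ?gt_eqF//.
have c1_ge2 : 2 <= c1 by move: c1_ge; lra.
have : 2 * 2^-1 <= c1 * L by apply: ler_pM => //; exact: ln_nat_ge_half.
lra.
Qed.

(** Below the kink m the ramp is linear and the frequency x is unbiased, so the bias is E times the
    mean of [x - m]^+. The event x >= m has probability at most e^(-8 L) = t^2, and the mean square
    of x is of order m^2. The weight k = t / m balances the two AM-GM terms, giving (5/2) E m t with
    E m = p. *)
Lemma plug_bias : ~~ small -> q <= m - w / 4 -> bL <= 3 * (p * t).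
Proof.
move=> la qm.
have qm' : q <= m by move: w_gt0; lra.
have pE : p = E * m by rewrite center_large// mulrC divfK// gt_eqF.
have fE : f = p - E * q.
  by rewrite /ramp max_l// [X in X - _]pE -mulrBr mulr_ge0 ?subr_ge0// ltW.
pose z (b : nat) : R := Num.max (b%:R / n%:R - m) 0.
have zle b : 0 <= z b <= b%:R / n%:R.
  rewrite /z le_max lexx orbT/= ge_max divr_ge0// andbT.
  by rewrite gerBl ltW.
have bz : exp_bounded z.
  apply: exp_bounded_le freq_bounded => b; have /andP[z0 zb] := zle b.
  by rewrite !ger0_norm// divr_ge0.
have plugE b : plug_in b = (p - E * (b%:R / n%:R)) + E * z b.
  have pB : p - E * (b%:R / n%:R) = E * (m - b%:R / n%:R) by rewrite mulrBr -pE.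
  rewrite /plug_in /ramp /z pB; case: (leP (b%:R / n%:R) m) => h.
    rewrite max_l; last by rewrite mulr_ge0 ?subr_ge0 ?(ltW E_gt0).
    by rewrite max_r ?subr_le0// mulr0 addr0.
  have h' := ltW h.
  rewrite max_r; last by rewrite mulr_ge0_le0 ?subr_le0 ?(ltW E_gt0).
  by rewrite max_l ?subr_ge0//; ring.
have bLE : bL = E * mean z.
  rewrite /bL (eq_poisson_mean _ plugE) poisson_meanD//; last 2 first.
  - by apply: exp_boundedB; [|apply: exp_boundedM => //]; exact: exp_bounded_cst.
  - by apply: exp_boundedM => //; exact: exp_bounded_cst.
  rewrite poisson_meanB//; last 2 first.
  - exact: exp_bounded_cst.
  - by apply: exp_boundedM => //; exact: exp_bounded_cst.
  rewrite poisson_mean_cst// !poisson_meanZ//.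
  have -> : mean (fun b => b%:R / n%:R) = q.
    have := @poisson_mean_falling_eval R n q n_pos q_ge0 2 'X.
    rewrite size_polyX hornerX => /(_ isT) {2}<-; apply: eq_poisson_mean => b.
    rewrite /falling_eval !big_ord_recl !big_ord0 !coefX /= !mul0r add0r !mulr1 mul1r.
    by rewrite subr0 addr0.
  rewrite fE [X in `|X|](_ : _ = E * mean z); last by ring.
  rewrite ger0_norm// mulr_ge0 ?(ltW E_gt0)//; apply: poisson_mean_ge0 => // b.
  by have /andP[] := zle b.
rewrite bLE [X in X * t]pE -mulrA mulrCA ler_pM2l//.
have t0 : 0 < t by exact: expR_gt0.
pose T b := m <= b%:R / n%:R.
pose k : R := t / m; have k0 : 0 < k by rewrite divr_gt0.
(* AM-GM with weight [k]: [x 1_(m <= x) <= k x^2 / 2 + 1_(m <= x) / (2 k)]. *)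
have zk b : z b <= k / 2 * (2 * (b%:R / n%:R - q) ^+ 2 + 2 * q ^+ 2)
    + (2 * k)^-1 * (T b)%:R.
  have /andP[z0 zb] := zle b.
  set x := b%:R / n%:R in zb *.
  have sq0 : 0 <= k / 2 * (2 * (x - q) ^+ 2 + 2 * q ^+ 2).
    apply: mulr_ge0; first by rewrite divr_ge0// ltW.
    by have := sqr_ge0 (x - q); have := sqr_ge0 q; lra.
  rewrite /T -/x; case: (leP m x) => mx; last first.
    by rewrite /= mulr0 addr0 (_ : z b = 0)// /z max_r// subr_le0 ltW.
  rewrite mulr1; apply: (le_trans zb).
  have : k / 2 * x ^+ 2 <= k / 2 * (2 * (x - q) ^+ 2 + 2 * q ^+ 2).
    rewrite ler_pM2l ?divr_gt0//; have := sqr_ge0 (x - 2 * q); nra.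
  have : x <= k / 2 * x ^+ 2 + (2 * k)^-1.
    have -> : k / 2 * x ^+ 2 + (2 * k)^-1 = x + (k * x - 1) ^+ 2 / (2 * k).
      by field; rewrite gt_eqF.
    by rewrite lerDl divr_ge0 ?sqr_ge0// mulr_ge0// ltW.
  lra.
have b1 : exp_bounded (fun b => 2 * (b%:R / n%:R - q) ^+ 2 + 2 * q ^+ 2 : R).
  apply: exp_boundedD; last exact: exp_bounded_cst.
  by apply: exp_boundedM => //; exact: exp_bounded_cst.
apply: (@le_trans _ _ (mean (fun b =>
   k / 2 * (2 * (b%:R / n%:R - q) ^+ 2 + 2 * q ^+ 2) + (2 * k)^-1 * (T b)%:R))).
  apply: poisson_mean_le => //; apply: exp_boundedD; apply: exp_boundedM => //;
    try exact: exp_bounded_cst; exact: ind_bounded.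
rewrite poisson_meanD//; last 2 first.
- by apply: exp_boundedM => //; exact: exp_bounded_cst.
- by apply: exp_boundedM; [exact: exp_bounded_cst|exact: ind_bounded].
rewrite !poisson_meanZ//; last exact: ind_bounded.
rewrite poisson_meanD//; last 2 first.
- by apply: exp_boundedM => //; exact: exp_bounded_cst.
- exact: exp_bounded_cst.
rewrite [mean (fun=> 2 * q ^+ 2)]poisson_mean_cst// poisson_meanZ// mean_sqr_freq_dev.
have tail : mean (fun b => (T b)%:R) <= t ^+ 2.
  apply: (le_trans (@above_center_tail T qm _)); first by [].
  by rewrite -expRM_natl ler_expR; lra.
have h1 : 2 * (q / n%:R) + 2 * q ^+ 2 <= 4 * m ^+ 2.
  have : q / n%:R <= m * m by rewrite ler_pM ?invr_ge0// inv_n_le_center.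
  have : q ^+ 2 <= m ^+ 2 by rewrite lerXn2r ?nnegrE// ltW.
  by rewrite expr2 -!expr2; lra.
have h2 := ler_wpM2l (ltW (divr_gt0 k0 (ltr0Sn _ 1))) h1.
have h3 : (2 * k)^-1 * mean (fun b => (T b)%:R) <= (2 * k)^-1 * t ^+ 2.
  by rewrite ler_wpM2l// invr_ge0 mulr_ge0// ltW.
apply: (le_trans (lerD h2 h3)).
have -> : k / 2 * (4 * m ^+ 2) + (2 * k)^-1 * t ^+ 2 = 5 / 2 * (m * t).
  by rewrite /k; field; rewrite !gt_eqF.
have : 0 < m * t by exact: mulr_gt0.
lra.
Qed.

(** * Polynomial branch *)

Lemma B_ge0 : 0 <= B.
Proof. by rewrite mulr_ge0// le_min p_ge0 sqrtr_ge0. Qed.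

Lemma B_le : B <= 2 * p.
Proof. by rewrite ler_pM2l// ge_min lexx. Qed.

Lemma sqr_B_le : B ^+ 2 <= 4 * c1 * (E * p * L / n%:R).
Proof.
have h0 : 0 <= c1 * E * p * L / n%:R.
  by rewrite divr_ge0 ?(ltW n_gt0)// !mulr_ge0// ltW.
apply: (@le_trans _ _ ((2 * Num.sqrt (c1 * E * p * L / n%:R)) ^+ 2)).
  by rewrite lerXn2r ?nnegrE ?B_ge0 ?mulr_ge0 ?sqrtr_ge0// ler_pM2l// ge_min lexx orbT.
by rewrite exprMn sqr_sqrtr//; lra.
Qed.

Lemma poly_est_second_moment s : 1 <= s -> `|q - m| <= s * w ->
  mean (fun b => poly_est b ^+ 2) <= B ^+ 2 * expR (8 * s * K%:R).
Proof.
move=> s1 qm; have s0 : 0 <= s by exact: le_trans s1.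
apply: (@falling_eval_second_moment R n q n_pos q_ge0 K D m w s B) => //.
- rewrite nsqr_w; apply: (@le_trans _ _ (L * (2 * s * m))).
    apply: ler_pM => //; move: qm; rewrite ler_norml => /andP[_].
    have : s * w <= s * m by rewrite ler_wpM2l.
    have : m <= s * m by rewrite ler_pMl.
    lra.
  have smL : 0 <= s * m * L by rewrite !mulr_ge0// ltW.
  by have := ler_wpM2l smL c1_ge; lra.
- exact: size_best_approx.
- by move=> x; exact: best_approx_bounded.
Qed.

(** D(q) is the mean of [poly_est], so its growth outside the window is read off from the second
    moment. *)
Lemma poly_value_le s : 1 <= s -> `|q - m| <= s * w ->
  `|D.[q]| <= B * expR (4 * s * K%:R).
Proof.
move=> s1 qm.
have BE : 0 <= B * expR (4 * s * K%:R) := mulr_ge0 B_ge0 (expR_ge0 _).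
rewrite -(ler_pXn2r (ltn0Sn 1)) ?nnegrE//.
rewrite real_normK ?num_real// exprMn -expRM_natl.
have -> : 2 * (4 * s * K%:R) = 8 * s * K%:R by ring.
rewrite -mean_poly_est.
apply: le_trans (poly_est_second_moment s1 qm).
exact: poisson_mean_sqr_le poly_est_bounded.
Qed.

Lemma poly_var_le s : 1 <= s -> `|q - m| <= s * w ->
  vM <= 2 * (B ^+ 2 * expR (8 * s * K%:R)) + 2 * f ^+ 2.
Proof.
move=> s1 qm.
have bp2 : exp_bounded (fun b => 2 * poly_est b ^+ 2).
  apply: exp_boundedM; first exact: exp_bounded_cst.
  exact: exp_bounded_sqr poly_est_bounded.
apply: (@le_trans _ _ (mean (fun b => 2 * poly_est b ^+ 2 + 2 * f ^+ 2))).
  apply: poisson_mean_le => //; first by apply: exp_boundedD => //; exact: exp_bounded_cst.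
  by move=> b; have := sqr_ge0 (poly_est b + f); nra.
rewrite poisson_meanD//; last exact: exp_bounded_cst.
rewrite poisson_mean_cst// poisson_meanZ//; last exact: exp_bounded_sqr poly_est_bounded.
by rewrite lerD2r ler_pM2l// poly_est_second_moment.
Qed.

Let pt_ge0 : 0 <= p * t. Proof. by rewrite mulr_ge0// ltW. Qed.
Let Ph_ge0 : 0 <= Ph. Proof. exact: mean_ind_ge0. Qed.
Let Pl_ge0 : 0 <= Pl. Proof. exact: mean_ind_ge0. Qed.
Let Pm_ge0 : 0 <= Pm. Proof. exact: mean_ind_ge0. Qed.
Let Pl_le1 : Pl <= 1. Proof. exact: mean_ind_le1. Qed.
Let Pm_le1 : Pm <= 1. Proof. exact: mean_ind_le1. Qed.
Let bL_ge0 : 0 <= bL. Proof. exact: normr_ge0. Qed.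
Let bM_ge0 : 0 <= bM. Proof. exact: normr_ge0. Qed.
Let vL_ge0 : 0 <= vL.
Proof. by apply: poisson_mean_ge0 => // b; exact: sqr_ge0. Qed.
Let vM_ge0 : 0 <= vM.
Proof. by apply: poisson_mean_ge0 => // b; exact: sqr_ge0. Qed.

Lemma ramp_above_center : m <= q -> f = 0.
Proof.
move=> mq; apply: max_r; rewrite subr_le0 mulrC -ler_pdivrMr//.
exact: le_trans (center_ge_kink eps c1 p n) mq.
Qed.

Lemma lo_small : small -> Pl = 0.
Proof.
move=> sm; apply: mean_ind0 => a; apply/negP; rewrite /below_window U_left_small//.
by move=> /andP[_]; rewrite ltNge divr_ge0.
Qed.

Lemma far_weight s X : 1 <= s -> X <= expR (- (16 * s * L)) -> X <= t.
Proof.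
move=> s1 /le_trans; apply; rewrite ler_expR lerN2.
have sL : 1 * L <= s * L by rewrite ler_pM2r.
by move: L_gt0; lra.
Qed.

(** The exponents combine to - 16 s L + 4 s K <= - 12 s L <= - 4 L. *)
Lemma far_poly_value s X : 1 <= s -> `|q - m| <= s * w -> 0 <= X ->
  X <= expR (- (16 * s * L)) -> X * `|D.[q]| <= 2 * (p * t).
Proof.
move=> s1 qm X0 Xs.
have h := ler_pM X0 (normr_ge0 _) Xs (poly_value_le s1 qm).
apply: (le_trans h); rewrite mulrCA -expRD mulrA.
apply: ler_pM; [exact: B_ge0|exact: expR_ge0|exact: B_le|].
have sL : 1 * L <= s * L by rewrite ler_pM2r.
have s0 : 0 <= s by exact: le_trans s1.
have := ler_wpM2l s0 K_le.
by rewrite ler_expR; move: L_gt0; lra.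
Qed.

(** Now - 16 s L + 8 s K <= - 8 s L <= - 4 L, and p <= 1 turns p^2 into p. *)
Lemma far_poly_var s X : 1 <= s -> `|q - m| <= s * w -> 0 <= X ->
  X <= expR (- (16 * s * L)) -> X * vM <= 10 * (p * t).
Proof.
move=> s1 qm X0 Xs.
have p2 : p ^+ 2 <= p by rewrite expr2 ler_piMr.
have h := ler_wpM2l X0 (poly_var_le s1 qm).
apply: (le_trans h); rewrite mulrDr.
have h1 : X * (B ^+ 2 * expR (8 * s * K%:R)) <= 4 * p * t.
  apply: (@le_trans _ _ (expR (- (16 * s * L)) * (B ^+ 2 * expR (8 * s * K%:R)))).
    by rewrite ler_wpM2r// mulr_ge0 ?sqr_ge0 ?expR_ge0.
  rewrite mulrCA -expRD.
  apply: ler_pM; [exact: sqr_ge0|exact: expR_ge0| |].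
    apply: (@le_trans _ _ ((2 * p) ^+ 2)); last by rewrite exprMn; lra.
    by rewrite lerXn2r ?nnegrE ?B_ge0 ?B_le// mulr_ge0.
  have sL : 1 * L <= s * L by rewrite ler_pM2r.
  have s0 : 0 <= s by exact: le_trans s1.
  have := ler_wpM2l s0 K_le.
  by rewrite ler_expR; move: L_gt0; lra.
have h2 : X * f ^+ 2 <= t * p.
  apply: ler_pM; [by []|exact: sqr_ge0|exact: far_weight Xs|].
  by apply: le_trans p2; rewrite lerXn2r ?nnegrE.
lra.
Qed.

(** [Below] can carry [~~ small] because for small p the window starts at 0. *)
Variant position : Prop :=
| Near of m - w <= q <= m + w
| Above s of 1 <= s & q = m + s * w
| Below s of ~~ small & 1 <= s & q = m - s * w.

Lemma positionP : position.
Proof.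
have w0 : w != 0 by rewrite gt_eqF.
have [q1|q1] := leP q (m + w); last first.
  apply: (@Above ((q - m) / w)); last by field.
  by rewrite ler_pdivlMr// mul1r; move: q1; lra.
have [q2|q2] := leP (m - w) q; first by apply: Near; rewrite q2.
have la : ~~ small.
  apply/negP => sm; move: q2; rewrite (halfwidth_small c1_gt0)// subrr.
  by rewrite ltNge q_ge0.
apply: (@Below ((m - q) / w)) => //; last by field.
by rewrite ler_pdivlMr// mul1r; move: q2; lra.
Qed.

Lemma hi_bias : Ph * f <= p * t.
Proof.
have [qm|qm] := leP q m; last by rewrite ramp_above_center ?mulr0// ltW.
by rewrite mulrC ler_pM// hi_tail.
Qed.

(** For small p this branch is never taken; for q near m or above it is improbable; for q further
    below, the plug-in estimator is itself almost unbiased. *)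
Lemma lo_bias : q <= m + w -> Pl * bL <= 3 * (p * t).
Proof.
move=> qm; have [sm|la] := boolP small.
  by rewrite (lo_small sm) mul0r mulr_ge0.
have [q1|q1] := leP (m - w / 4) q.
  have : Pl * bL <= t * p by rewrite ler_pM ?lo_tail ?plug_bias_le.
  by move: pt_ge0; lra.
apply: le_trans (plug_bias la (ltW q1)).
by rewrite ler_piMl.
Qed.

(** The approximation error J enters only when q is in the window. The tail terms total at most 7 p
    t, reached below the window as 1 + 3 + 3. *)
Lemma local_bias (J : R) :
  (forall x, m - w <= x <= m + w -> `|ramp eps p x - D.[x]| <= J) ->
  mean (fun a => `|mean (local_error a)|) <= J + 8 * (p * t).
Proof.
move=> DJ.
have J0 : 0 <= J.
  by apply: le_trans (normr_ge0 _) (DJ m _); move: w_gt0; lra.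
rewrite (eq_poisson_mean _ abs_mean_local_error) mean_split.
have hb := hi_bias.
case: positionP => [qI|s s1 qE|s la s1 qE].
- have lb : Pl * bL <= 3 * (p * t) by apply: lo_bias; case/andP: qI.
  have mb : Pm * bM <= J.
    by apply: (@le_trans _ _ bM); [rewrite ler_piMl|rewrite /bM distrC DJ].
  by move: pt_ge0; lra.
- have qm : `|q - m| <= s * w.
    rewrite qE addrAC subrr add0r ger0_norm//.
    by rewrite mulr_ge0 ?(ltW w_gt0)//; exact: le_trans s1.
  have f0 : f = 0.
    apply: ramp_above_center; rewrite qE lerDl mulr_ge0 ?(ltW w_gt0)//.
    exact: le_trans s1.
  have lb : Pl * bL <= t * p.
    apply: ler_pM => //; last exact: plug_bias_le.
    apply: (far_weight s1); apply: (not_hi_tail s1 qE) => a.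
    by rewrite /below_window => /andP[].
  have mb : Pm * bM <= 2 * (p * t).
    rewrite /bM f0 subr0; apply: (far_poly_value s1 qm) => //.
    by apply: (not_hi_tail s1 qE) => a; rewrite /in_window => /andP[].
  by move: pt_ge0; lra.
- have qm : `|q - m| <= s * w.
    rewrite qE addrAC subrr add0r normrN ger0_norm//.
    by rewrite mulr_ge0 ?(ltW w_gt0)//; exact: le_trans s1.
  have wsw : w <= s * w by rewrite ler_pMl.
  have lb : Pl * bL <= 3 * (p * t) by apply: lo_bias; move: w_gt0; lra.
  have Pmt : Pm <= expR (- (16 * s * L)).
    by apply: (not_lo_tail la s1 qE) => a; rewrite /in_window => /andP[].
  have mb : Pm * bM <= 3 * (p * t).
    have h1 := far_poly_value s1 qm Pm_ge0 Pmt.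
    have h2 : Pm * f <= t * p by rewrite ler_pM// (far_weight s1 Pmt).
    have : Pm * bM <= Pm * (`|D.[q]| + f).
      rewrite ler_wpM2l// /bM (le_trans (ler_normB _ _))//.
      by rewrite (ger0_norm f_ge0).
    by rewrite mulrDr; lra.
  by move: pt_ge0; lra.
Qed.

Lemma abs_mean_local_error_bounded : exists M, forall a, `|mean (local_error a)| <= M.
Proof.
exists (f + bL + bM) => a; rewrite abs_mean_local_error.
by case: (above_window a); [|case: (below_window a)]; move: f_ge0 bL_ge0 bM_ge0; lra.
Qed.

Lemma mean_sqr_local_error_bounded : exists M, forall a, mean (fun b => local_error a b ^+ 2) <= M.
Proof.
exists (f ^+ 2 + vL + vM) => a; rewrite mean_sqr_local_error.
by case: (above_window a); [|case: (below_window a)]; move: (sqr_ge0 f) vL_ge0 vM_ge0; lra.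
Qed.

Hypothesis eps_ge0 : 0 <= eps.

Let G := E * p * L / n%:R.

Let G_ge0 : 0 <= G.
Proof. by rewrite divr_ge0 ?(ltW n_gt0)// !mulr_ge0// ltW. Qed.

Let E_ge1 : 1 <= E.
Proof. by rewrite -expR0 ler_expR. Qed.

Let freq_le_G : E * p / n%:R <= 2 * G.
Proof.
have -> : 2 * G = E * p / n%:R * (2 * L) by rewrite /G; ring.
rewrite ler_peMr ?divr_ge0 ?mulr_ge0 ?(ltW n_gt0) ?(ltW E_gt0)//.
by have := ln_nat_ge_half; lra.
Qed.

Lemma expR_ln_le_inv : t <= n%:R^-1.
Proof.
have -> : n%:R^-1 = expR (- L) :> R by rewrite expRN lnK.
by rewrite ler_expR; move: L_gt0; lra.
Qed.

Let pt_le_G : p * t <= 2 * G.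
Proof.
apply: le_trans freq_le_G.
apply: (@le_trans _ _ (p / n%:R)); first by rewrite ler_wpM2l// expR_ln_le_inv.
by rewrite ler_wpM2r ?invr_ge0// ler_peMl.
Qed.

Lemma lo_var_le x : ~~ small -> q <= x * m -> vL <= x * (2 * G).
Proof.
move=> la qm; apply: (le_trans plug_var).
have pE : E * m = p by rewrite (center_large la) mulrC divfK// gt_eqF.
have : E ^+ 2 * (q / n%:R) <= E ^+ 2 * (x * m / n%:R).
  by rewrite ler_pM2l ?exprn_gt0// ler_pM2r ?invr_gt0.
have -> : E ^+ 2 * (x * m / n%:R) = x * (E * (E * m) / n%:R) by ring.
rewrite pE => /le_trans; apply.
have x0 : 0 <= x.
  by rewrite -(pmulr_lge0 _ m_gt0) (le_trans _ qm).
by rewrite ler_wpM2l.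
Qed.

(** In the window f^2 <= B^2, so the polynomial branch costs at most 4 B^2 e^(8 K) with B^2 <= 4 c1
    G, hence 16 c1. All other terms are at most 24 G. *)
Lemma local_var : mean (fun a => mean (fun b => local_error a b ^+ 2))
  <= (16 * c1 + 100) * G * expR (8 * K%:R).
Proof.
rewrite (eq_poisson_mean _ mean_sqr_local_error) mean_split.
have e1 : 1 <= expR (8 * K%:R) :> R by rewrite -expR0 ler_expR mulr_ge0.
have Ge : G <= G * expR (8 * K%:R) by rewrite ler_peMr.
have c1G : 0 <= c1 * (G * expR (8 * K%:R)).
  by rewrite mulr_ge0 ?(ltW c1_gt0)// mulr_ge0// expR_ge0.
have p2 : p ^+ 2 <= p by rewrite expr2 ler_piMr.
have f2 : f ^+ 2 <= p by apply: le_trans p2; rewrite lerXn2r ?nnegrE.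
have hb : Ph * f ^+ 2 <= 2 * G.
  have [qm|qm] := leP q m; last first.
    by rewrite ramp_above_center ?expr0n ?mulr0 ?mulr_ge0// ltW.
  apply: le_trans pt_le_G; rewrite mulrC.
  by apply: ler_pM; [exact: sqr_ge0|by []|by []|exact: hi_tail].
have -> : (16 * c1 + 100) * G * expR (8 * K%:R)
  = 16 * (c1 * (G * expR (8 * K%:R))) + 100 * (G * expR (8 * K%:R)) by ring.
have sum_near (a b d X Y : R) : a <= 2 * G -> b <= 4 * G -> d <= 16 * X -> 0 <= X ->
    G <= Y -> a + b + d <= 16 * X + 100 * Y.
  by move: (G) G_ge0 => g g0; lra.
have sum_far (a b d X Y : R) : a <= 2 * G -> b <= 2 * G -> d <= 10 * (p * t) -> 0 <= X ->
    G <= Y -> a + b + d <= 16 * X + 100 * Y.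
  by move: (G) (p * t) G_ge0 pt_le_G => g u g0 ug; lra.
case: positionP => [qI|s s1 qE|s la s1 qE].
- have lb : Pl * vL <= 4 * G.
    have [sm|la] := boolP small; first by rewrite (lo_small sm) mul0r mulr_ge0.
    apply: (@le_trans _ _ vL); first by rewrite ler_piMl.
    have q2 : q <= 2 * m by move: w_le_m; case/andP: qI; lra.
    by have := lo_var_le la q2; lra.
  have qm : `|q - m| <= 1 * w by rewrite mul1r ler_norml; move: qI; lra.
  have mb : Pm * vM <= 16 * (c1 * (G * expR (8 * K%:R))).
    apply: (@le_trans _ _ vM); first by rewrite ler_piMl.
    apply: (le_trans (poly_var_le (lexx 1) qm)); rewrite mulr1.
    have fB : f ^+ 2 <= B ^+ 2.
      rewrite lerXn2r ?nnegrE ?B_ge0//.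
      have := @ramp_window_le _ eps c1 p n c1_gt0 p_ge0 n_ge2 q qI.
      have : 0 <= Num.min p (Num.sqrt (c1 * E * p * L / n%:R)).
        by rewrite le_min p_ge0 sqrtr_ge0.
      lra.
    have fBe : f ^+ 2 <= B ^+ 2 * expR (8 * K%:R).
      by apply: (le_trans fB); rewrite ler_peMr// sqr_ge0.
    have := ler_wpM2r (expR_ge0 (8 * K%:R)) sqr_B_le; rewrite -/G.
    lra.
  exact: sum_near hb lb mb c1G Ge.
- have qm : `|q - m| <= s * w.
    rewrite qE addrAC subrr add0r ger0_norm//.
    by rewrite mulr_ge0 ?(ltW w_gt0)//; exact: le_trans s1.
  have lb : Pl * vL <= 2 * G.
    apply: le_trans pt_le_G; rewrite mulrC; apply: ler_pM => //.
      exact: le_trans plug_var_le p2.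
    apply: (far_weight s1); apply: (not_hi_tail s1 qE) => a.
    by rewrite /below_window => /andP[].
  have mb : Pm * vM <= 10 * (p * t).
    apply: (far_poly_var s1 qm) => //.
    by apply: (not_hi_tail s1 qE) => a; rewrite /in_window => /andP[].
  exact: sum_far hb lb mb c1G Ge.
- have qm : `|q - m| <= s * w.
    rewrite qE addrAC subrr add0r normrN ger0_norm//.
    by rewrite mulr_ge0 ?(ltW w_gt0)//; exact: le_trans s1.
  have lb : Pl * vL <= 2 * G.
    apply: (@le_trans _ _ vL); first by rewrite ler_piMl.
    rewrite -[leRHS]mul1r; apply: lo_var_le => //; rewrite mul1r qE gerBl.
    by rewrite mulr_ge0 ?(ltW w_gt0)//; exact: le_trans s1.
  have mb : Pm * vM <= 10 * (p * t).
    apply: (far_poly_var s1 qm) => //.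
    by apply: (not_lo_tail la s1 qE) => a; rewrite /in_window => /andP[].
  exact: sum_far hb lb mb c1G Ge.
Qed.

End local_risk.

(** * Total risk *)

(** Clipping is a contraction that fixes [0, 1], where the divergence lies. *)
Lemma clip_dist_le (R : realType) (x d : R) : 0 <= d <= 1 ->
  `|Num.max 0 (Num.min 1 x) - d| <= `|x - d|.
Proof.
move=> /andP[d0 d1]; case: (leP 1 x) => x1; last first.
  case: (leP 0 x) => x0; first by [].
  by rewrite !ler0_norm; lra.
by rewrite max_r// !ger0_norm; lra.
Qed.

Section risk_bound.
Context {R : realType} {S : nat}.
Variables (C eps : R) (n : nat) (P Q : prob_vec R S).
Hypotheses (C_gt0 : 0 < C) (eps_ge0 : 0 <= eps) (n_ge2 : (2 <= n)%N).

Local Notation E := (expR eps).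
Local Notation L := (ln (n%:R : R)).
Local Notation T := (\sum_i Num.min (P i) (Num.sqrt (E * P i / (n%:R * L)))).

Hypothesis L_le : L <= C * ln (expR (- eps) *
        \sum_i Num.min (Num.sqrt (E * P i)) (P i * Num.sqrt (n%:R * L))).

Let n_gt0 : 0 < n%:R :> R. Proof. exact: nat_gt0. Qed.
Let L_gt0 : 0 < L. Proof. exact: ln_nat_gt0. Qed.
Let E_gt0 : 0 < E. Proof. exact: expR_gt0. Qed.
Let E_ge1 : 1 <= E. Proof. by rewrite -expR0 ler_expR. Qed.
Let nL_gt0 : 0 < n%:R * L. Proof. exact: mulr_gt0. Qed.

Lemma prob_vec_le1 (V : prob_vec R S) i : V i <= 1.
Proof.
rewrite -(prob_vec_sum1 V) (bigD1 i)//= lerDl.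
by apply: sumr_ge0 => j _; exact: prob_vec_ge0.
Qed.

Lemma hockey_stick_bounds : 0 <= hockey_stick eps P Q <= 1.
Proof.
apply/andP; split; first by apply: sumr_ge0 => i _; rewrite le_max lexx orbT.
rewrite -(prob_vec_sum1 P); apply: ler_sum => i _.
by apply: ramp_le; exact: prob_vec_ge0.
Qed.

(** Factoring r = sqrt (n L) out of each minimum turns the sum in the hypothesis into r T, so that
    e^(L / C) <= e^(- eps) r T <= r T. *)
Lemma rate_sum_lower_bound : expR (2 * (L / C)) <= n%:R * L * T ^+ 2.
Proof.
have T0 : 0 <= T.
  by apply: sumr_ge0 => i _; rewrite le_min prob_vec_ge0 sqrtr_ge0.
set r := Num.sqrt (n%:R * L).
have r0 : 0 <= r by exact: sqrtr_ge0.
have sumE : \sum_i Num.min (Num.sqrt (E * P i)) (P i * r) = r * T.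
  rewrite mulr_sumr; apply: eq_bigr => i _.
  rewrite minr_pMr// minC [r * _]mulrC; congr (Num.min _ _).
  rewrite -sqrtrM ?(ltW nL_gt0)//; congr Num.sqrt.
  by field; rewrite !gt_eqF.
move: L_le; rewrite -/r sumE; set Y := expR (- eps) * (r * T) => LY.
(* [ln] takes the value 0 at 0, so Y = 0 would force L <= 0. *)
have Y0 : 0 < Y.
  have : 0 <= Y by rewrite !mulr_ge0// expR_ge0.
  rewrite le_eqVlt => /predU1P[Y0|//].
  by move: LY; rewrite -Y0 (ln0 (lexx 0)) mulr0 leNgt L_gt0.
have eY : expR (L / C) <= Y.
  by rewrite -[leRHS]lnK ?posrE// ler_expR ler_pdivrMr// mulrC.
have Yr : Y <= r * T.
  rewrite /Y expRNE ler_pdivrMr// ler_peMr// mulr_ge0//.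
rewrite expRM_natl; apply: (@le_trans _ _ ((r * T) ^+ 2)).
  rewrite lerXn2r ?nnegrE ?expR_ge0 ?mulr_ge0//; exact: le_trans eY Yr.
by rewrite exprMn sqr_sqrtr// ltW.
Qed.

Variable c3 : R.
Hypotheses (c3_gt0 : 0 < c3) (c3_le1 : c3 <= 1) (c3_le : 8 * c3 <= C^-1).

Local Notation K := (Num.truncn (c3 * L)).

Let c3L_ge0 : 0 <= c3 * L. Proof. by rewrite mulr_ge0// ltW. Qed.

Lemma degree_le : K%:R <= c3 * L.
Proof. by rewrite truncn_le. Qed.

Lemma degree_gt : c3 * L <= K.+1%:R.
Proof. by rewrite ltW// truncnS_gt. Qed.

(** The square root is L times the target rate, up to a constant, and K + 1 >= c3 L removes the
    factor L. *)
Lemma approx_err_le (c1 p : R) : 0 <= c1 -> 0 <= p ->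
  6 * Num.sqrt (8 * c1 * E * p * L / n%:R) / K.+1%:R
  <= 6 * Num.sqrt (8 * c1) / c3 * Num.sqrt (E * p / (n%:R * L)).
Proof.
move=> c10 p0.
have -> : 8 * c1 * E * p * L / n%:R = 8 * c1 * (L ^+ 2 * (E * p / (n%:R * L))).
  by field; rewrite !gt_eqF.
rewrite sqrtrM; last exact: mulr_ge0.
rewrite [Num.sqrt (L ^+ 2 * _)]sqrtrM ?sqr_ge0// sqrtr_sqr (gtr0_norm L_gt0).
set X := Num.sqrt (8 * c1); set Y := Num.sqrt _.
have XY0 : 0 <= 6 * X * Y by rewrite !mulr_ge0 ?sqrtr_ge0.
rewrite ler_pdivrMr ?ltr0n//.
have -> : 6 * (X * (L * Y)) = 6 * X * Y / c3 * (c3 * L).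
  by field; rewrite gt_eqF.
have -> : 6 * X / c3 * Y * K.+1%:R = 6 * X * Y / c3 * K.+1%:R by ring.
by rewrite ler_wpM2l ?degree_gt// divr_ge0// ltW.
Qed.

Lemma risk_le (c1 c2 A : R) : 1024 <= c1 -> c2 = c1 / 4 ->
  1 <= A -> 6 * Num.sqrt (8 * c1) / c3 <= A ->
  ('E_(sampling n Q)[(fun w =>
      `|d_hat eps n c1 c2 K P w - hockey_stick eps P Q| ^+ 2)%R]
   <= ((2 * A ^+ 2 + 128 + 8 * (16 * c1 + 100) * E * C ^+ 2) * T ^+ 2)%:E)%E.
Proof.
move=> c1_ge c2E A1 A2.
have c1_gt0 : 0 < c1 by apply: lt_le_trans c1_ge; rewrite ltr0n.
have K_le : K%:R <= L.
  by apply: (le_trans degree_le); rewrite ler_piMl// ltW.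
have P0 i : 0 <= P i := prob_vec_ge0 P i.
have P1 i : P i <= 1 := prob_vec_le1 P i.
have Q0 i : 0 <= Q i := prob_vec_ge0 Q i.
pose xi i := local_error eps (P i) (Q i) c1 c2 n K.
have A0 : 0 <= A by exact: le_trans A1.
have t_n := @expR_ln_le_inv R n n_ge2.
set t := expR _ in t_n.
have t0 : 0 <= t by exact: expR_ge0.
apply: (@le_trans _ _ ((\sum_i (A * Num.min (P i) (Num.sqrt (E * P i / (n%:R * L)))
     + 8 * (P i * t))) ^+ 2
   + 2 * \sum_i (16 * c1 + 100) * (E * P i * L / n%:R) * expR (8 * K%:R))%:E).
  apply: (le_trans (@integral_sampling_le R S Q n _ _ xi _ _ _ _)).
  - by rewrite (leq_trans _ n_ge2).
  - by move=> i a; exact: local_error_bounded.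
  - by move=> i; exact: abs_mean_local_error_bounded.
  - by move=> i; exact: mean_sqr_local_error_bounded.
  - move=> w; rewrite sqr_ge0/= real_normK ?num_real//.
    have -> : \sum_i xi i (count_mem i w.1) (count_mem i w.2)
        = \sum_i local_estimator eps n c1 c2 K (P i) (empirical R n w.1 i)
            (empirical R n w.2 i) - hockey_stick eps P Q.
      by rewrite -sumrB.
    rewrite -real_normK ?num_real// -[leRHS]real_normK ?num_real//.
    rewrite lerXn2r ?nnegrE// /d_hat.
    exact: clip_dist_le hockey_stick_bounds.
  rewrite lee_fin; apply: lerD.
    rewrite lerXn2r ?nnegrE//; last 1 first.
    - apply: ler_sum => i _.
      apply: (local_bias (P0 i) (Q0 i) n_ge2 K_le c1_ge c2E) => x xI.
      have h1 := best_approx_trivial c1_gt0 (P0 i) n_ge2 K xI.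
      have h2 := best_approx_jackson c1_gt0 (P0 i) n_ge2 K xI.
      rewrite minr_pMr// le_min; apply/andP; split.
        rewrite (le_trans h1)// ge_min; apply/orP; left.
        by rewrite ler_peMl.
      apply: (le_trans h2); apply: (le_trans (approx_err_le (ltW c1_gt0) (P0 i))).
      by rewrite ler_wpM2r ?sqrtr_ge0.
    - apply: sumr_ge0 => i _; apply: poisson_mean_ge0 => [||a]; last exact: normr_ge0.
        by rewrite mulr_ge0// ltW.
      have [M MP] := abs_mean_local_error_bounded eps c2 K (P0 i) (Q0 i) n_ge2 c1_ge.
      by apply: (@exp_bounded_bounded _ M) => a; rewrite normr_id; exact: MP.
    - apply: sumr_ge0 => i _; rewrite addr_ge0 ?mulr_ge0//.
      by rewrite le_min P0 sqrtr_ge0.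
  rewrite ler_pM2l//; apply: ler_sum => i _.
  exact: (local_var (P0 i) (P1 i) (Q0 i) n_ge2 K_le c1_ge c2E eps_ge0).
rewrite lee_fin big_split /= -mulr_sumr -mulr_sumr -mulr_suml prob_vec_sum1 mul1r.
have T0 : 0 <= T by apply: sumr_ge0 => i _; rewrite le_min P0 sqrtr_ge0.
have HT := rate_sum_lower_bound.
have eLC : 0 < L / C by rewrite divr_gt0.
(* From 1 <= n L T^2 and L <= n; this absorbs the accumulated tail term 8 t. *)
have inv_n2 : (n%:R ^+ 2)^-1 <= T ^+ 2.
  have Ln : L <= n%:R by have := expR_ge1Dx L; rewrite lnK ?posrE//; lra.
  have LC0 : 0 <= 2 * (L / C) by rewrite mulr_ge0// ltW.
  have e1 : 1 <= expR (2 * (L / C)) by rewrite -[leLHS]expR0 ler_expR.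
  rewrite -div1r ler_pdivrMr ?exprn_gt0//; apply: (le_trans (le_trans e1 HT)).
  by rewrite [leRHS]mulrC ler_wpM2r ?sqr_ge0// expr2 ler_pM2l.
have bias : (A * T + 8 * t) ^+ 2 <= (2 * A ^+ 2 + 128) * T ^+ 2.
  have t2 : t ^+ 2 <= T ^+ 2.
    by apply: le_trans inv_n2; rewrite -exprVn lerXn2r ?nnegrE ?invr_ge0.
  have := sqr_ge0 (A * T - 8 * t).
  have -> : (2 * A ^+ 2 + 128) * T ^+ 2 = 2 * (A * T) ^+ 2 + 128 * T ^+ 2 by ring.
  by move: (A * T) => a; nra.
have var : 2 * \sum_i (16 * c1 + 100) * (E * P i * L / n%:R) * expR (8 * K%:R)
    <= 8 * (16 * c1 + 100) * E * C ^+ 2 * T ^+ 2.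
  have -> : \sum_i (16 * c1 + 100) * (E * P i * L / n%:R) * expR (8 * K%:R)
      = (16 * c1 + 100) * E * (L / n%:R * expR (8 * K%:R)).
    transitivity ((16 * c1 + 100) * E * (L / n%:R * expR (8 * K%:R)) * \sum_i P i).
      by rewrite mulr_sumr; apply: eq_bigr => i _; ring.
    by rewrite prob_vec_sum1 mulr1.
  have main : L / n%:R * expR (8 * K%:R) <= 4 * C ^+ 2 * T ^+ 2.
    have eK : expR (8 * K%:R) <= expR (L / C).
      rewrite ler_expR (le_trans (ler_wpM2l _ degree_le))// mulrA mulrC.
      by rewrite ler_wpM2l// ltW.
    (* Trading L^2 for another e^(L / C) matches the lower bound e^(2 L / C) on n L T^2. *)
    have L2 : L ^+ 2 <= 4 * C ^+ 2 * expR (L / C).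
      have h : L / (2 * C) <= expR (L / (2 * C)).
        by have := expR_ge1Dx (L / (2 * C)); lra.
      have LC : L / C = 2 * (L / (2 * C)) by field; rewrite gt_eqF.
      have -> : L ^+ 2 = 4 * C ^+ 2 * (L / (2 * C)) ^+ 2 by field; rewrite gt_eqF.
      have h0 : 0 <= L / (2 * C) by rewrite divr_ge0 ?mulr_ge0 ?(ltW L_gt0) ?(ltW C_gt0).
      rewrite LC expRM_natl; apply: ler_wpM2l; first by rewrite mulr_ge0 ?sqr_ge0.
      by rewrite lerXn2r ?nnegrE ?expR_ge0.
    apply: (@le_trans _ _ (L / n%:R * expR (L / C))).
      by rewrite ler_wpM2l// divr_ge0// ltW.
    rewrite -(ler_pM2r nL_gt0).
    have -> : L / n%:R * expR (L / C) * (n%:R * L) = L ^+ 2 * expR (L / C).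
      by field; rewrite gt_eqF.
    apply: (le_trans (ler_wpM2r (expR_ge0 _) L2)).
    have -> : 4 * C ^+ 2 * expR (L / C) * expR (L / C) = 4 * C ^+ 2 * expR (2 * (L / C)).
      by rewrite expRM_natl; ring.
    have -> : 4 * C ^+ 2 * T ^+ 2 * (n%:R * L) = 4 * C ^+ 2 * (n%:R * L * T ^+ 2) by ring.
    by apply: ler_wpM2l HT; rewrite mulr_ge0 ?sqr_ge0.
  have coef_ge0 : 0 <= (16 * c1 + 100) * E.
    by rewrite mulr_ge0 ?(ltW E_gt0)// addr_ge0// mulr_ge0// ltW.
  have := ler_wpM2l coef_ge0 main; lra.
by rewrite [leRHS]mulrDl; exact: lerD bias var.
Qed.
End risk_bound.

Theorem theorem3 (R : realType) (c C eps : R) (c_gt0 : 0 < c) (C_gt0 : 0 < C)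
    (eps_ge0 : 0 <= eps) :
  exists c1 c2 c3 M : R,
    [/\ c2 < c1, 0 < c2, 0 < c3 & 0 < M] /\
    forall (S n : nat) (P : prob_vec R S), (0 < S)%N -> (2 <= n)%N ->
      c * ln S%:R <= ln n%:R ->
      ln n%:R <= C * ln (expR (- eps) *
        \sum_i Num.min (Num.sqrt (expR eps * P i))
                       (P i * Num.sqrt (n%:R * ln n%:R))) ->
      (ereal_sup (range (fun Q : prob_vec R S =>
         'E_(sampling n Q)[(fun w =>
           `|d_hat eps n c1 c2 (Num.truncn (c3 * ln n%:R)) P w
             - hockey_stick eps P Q| ^+ 2)%R]))
       <= (M * (\sum_i Num.min (P i)
             (Num.sqrt (expR eps * P i / (n%:R * ln n%:R)))) ^+ 2)%:E)%E.
Proof.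
have [c1 c1E] : exists c1 : R, c1 = 1024 by exists 1024.
have c1_gt0 : 0 < c1 by rewrite c1E ltr0n.
(* The bound 1 ensures K <= L, as the one-symbol estimates require; 1 / (8 C) ensures that the
   variance growth e^(8 K) is at most n^(1/C). *)
pose c3 : R := Num.min 1 (C^-1 / 8).
have c3_gt0 : 0 < c3 by rewrite lt_min ltr01 divr_gt0 ?invr_gt0.
pose A := Num.max 1 (6 * Num.sqrt (8 * c1) / c3).
exists c1, (c1 / 4), c3, (2 * A ^+ 2 + 128 + 8 * (16 * c1 + 100) * expR eps * C ^+ 2).
split.
  split => //; [lra|by rewrite divr_gt0|].
  have h1 : 0 <= 2 * A ^+ 2 by rewrite mulr_ge0 ?sqr_ge0.
  have h2 : 0 <= 8 * (16 * c1 + 100) * expR eps * C ^+ 2.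
    have h3 : 0 <= 16 * c1 + 100 by move: c1_gt0; lra.
    by rewrite !mulr_ge0 ?expR_ge0// ltW.
  lra.
move=> S n P _ n2 _ L_le; apply: ge_ereal_sup => _ [Q _ <-].
apply: risk_le => //; first by rewrite ge_min lexx.
- have : c3 <= C^-1 / 8 by rewrite ge_min lexx orbT.
  by rewrite ler_pdivlMr// mulrC.
- by rewrite c1E.
- by rewrite le_max lexx.
- by rewrite le_max lexx orbT.
Qed.
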